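(* Let $\hat M=\{1,\dots,d\}^{\mathbb Z}$, let $\hat f:\hat M\to\hat M$ be the left shift and let $\hat\mu$ be a fully supported Bernoulli measure on $\hat M$. Let $\alpha>0$ and let $\hat A\in\mathcal S_\alpha(\hat M,2)$ be a non-uniformly fiber-bunched, locally constant and irreducible cocycle. If $\hat A_k\to\hat A$ in $\mathcal S_\alpha(\hat M,2)$, then $\lambda_+(\hat A_k)\to\lambda_+(\hat A)$.
   Context: A fully supported Bernoulli measure is $\hat\mu=p^{\mathbb Z}$ with $p$ a probability vector on $\{1,\dots,d\}$ with all weights positive. Fix $\rho\in(0,1)$ and put $d_\rho(\hat x,\hat y)=\rho^{N(\hat x,\hat y)}$, $N(\hat x,\hat y)=\max\{N\ge0:x_n=y_n\ \text{for all }|n|<N\}$ (distance $0$ if $\hat x=\hat y$); put $\sigma=1/\rho$. $\mathcal S_\alpha(\hat M,2)$ is the set of $\alpha$-Hölder maps $\hat A:\hat M\to SL(2,\mathbb R)$ with respect to $d_\rho$, with distance $D_\alpha(\hat A,\hat B)=\sup_{\hat x}\|\hat A(\hat x)-\hat B(\hat x)\|+H_\alpha(\hat A-\hat B)$, where $H_\alpha(\hat C)$ is the smallest constant $C\ge 0$ with $\|\hat C(\hat x)-\hat C(\hat y)\|\le C\,d_\rho(\hat x,\hat y)^\alpha$ for all $\hat x,\hat y$. Convergence in $\mathcal S_\alpha(\hat M,2)$ is convergence for $D_\alpha$. (The maps $\hat A_k$ need not be locally constant.) Write $\hat A^n(\hat x)=\hat A(\hat f^{n-1}(\hat x))\cdots\hat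 A(\hat x)$. $\lambda_+(\hat A)$ is the $\hat\mu$-a.e. constant value of $\lim_n\frac1n\log\|\hat A^n(\hat x)\|$. $\hat A\in\mathcal S_\alpha(\hat M,2)$ is non-uniformly fiber-bunched if $2\lambda_+(\hat A)<\alpha\log\sigma$. $\hat A$ is locally constant if it depends only on the zeroth coordinate: $\hat A(\hat x)=A(x_0)$ for some $A:\{1,\dots,d\}\to SL(2,\mathbb R)$. A locally constant $\hat A$ is irreducible if there is no one-dimensional linear subspace of $\mathbb R^2$ invariant under $A(i)$ for every $i\in\{1,\dots,d\}$. *)

(* Defs.v *)
From HB Require Import structures.
From mathcomp Require Import all_boot all_order all_algebra.
From mathcomp Require Import all_classical all_reals all_analysis.
Import Order.TTheory GRing.Theory Num.Theory.
Import numFieldNormedType.Exports.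

Set Implicit Arguments.
Unset Strict Implicit.
Unset Printing Implicit Defensive.

Local Open Scope classical_set_scope.
Local Open Scope ring_scope.

(* The alphabet {1, ..., d} is rendered as 'I_m.+1 with d = m.+1 (letters are
   numbered from 0); a measurableType has to be inhabited, hence the successor. *)
Definition biseq (m : nat) : Type := int -> 'I_m.+1.

HB.instance Definition _ (m : nat) := Choice.on (biseq m).
HB.instance Definition _ (m : nat) := isPointed.Build (biseq m) (fun=> ord0).

Definition one_cylinders (m : nat) : set (set (biseq m)) :=
  [set C | exists (n : int) (i : 'I_m.+1), C = [set x | x n = i]].

(* The product sigma-algebra, which is also the Borel sigma-algebra. *)
Definition shift_space (m : nat) : Type :=
  g_sigma_algebraType (@one_cylinders m).

Definition shift (m : nat) (x : shift_space m) : shift_space m :=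
  fun n : int => x (n + 1).

Definition positive_probability_vector (R : realType) (m : nat)
    (p : 'I_m.+1 -> R) : Prop :=
  (forall i, 0 < p i) /\ \sum_i p i = 1.

(* mu = p^Z, characterized by its values on the cylinders
   [x_j = a_j for all j in J] with J a finite set of integers. *)
Definition is_bernoulli (R : realType) (m : nat) (p : 'I_m.+1 -> R)
    (mu : probability (shift_space m) R) : Prop :=
  forall (J : seq int) (a : int -> 'I_m.+1), uniq J ->
    mu [set x | forall j, j \in J -> x j = a j] = (\prod_(j <- J) p (a j))%:E.

Definition agree (m : nat) (x y : shift_space m) (N : nat) : Prop :=
  forall n : int, (absz n < N)%N -> x n = y n.

(* For x <> y the maximum exists; the default value 0 is then irrelevant. *)
Definition agreement (m : nat) (x y : shift_space m) : nat :=
  xget 0%N [set N | agree x y N /\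
                    forall N', agree x y N' -> (N' <= N)%N].

Definition shift_dist (R : realType) (rho : R) (m : nat)
    (x y : shift_space m) : R :=
  if `[< x = y >] then 0 else rho ^+ agreement x y.

Definition enorm (R : realType) (v : 'cV[R]_2) : R :=
  Num.sqrt (\sum_i v i 0 ^+ 2).

Definition opnorm (R : realType) (B : 'M[R]_2) : R :=
  sup [set enorm (B *m v) | v in [set v : 'cV[R]_2 | enorm v = 1]].

Definition holder_bound (R : realType) (rho alpha : R) (m : nat)
    (F : shift_space m -> 'M[R]_2) (C : R) : Prop :=
  0 <= C /\
  forall x y, opnorm (F x - F y) <= C * (shift_dist rho x y) `^ alpha.

(* The infimum is attained as soon as F is Hoelder. *)
Definition holder_const (R : realType) (rho alpha : R) (m : nat)
    (F : shift_space m -> 'M[R]_2) : R :=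
  inf [set C | holder_bound rho alpha F C].

Definition holder_SL2 (R : realType) (rho alpha : R) (m : nat)
    : set (shift_space m -> 'M[R]_2) :=
  [set A | (forall x, \det (A x) = 1) /\
           exists C, holder_bound rho alpha A C].

(* On holder_SL2 the supremum is taken over a bounded set, since shift_dist
   is at most 1. *)
Definition holder_dist (R : realType) (rho alpha : R) (m : nat)
    (A B : shift_space m -> 'M[R]_2) : R :=
  sup (range (fun x => opnorm (A x - B x))) +
  holder_const rho alpha (fun x => A x - B x).

Fixpoint cocycle (R : realType) (m : nat) (A : shift_space m -> 'M[R]_2)
    (n : nat) (x : shift_space m) : 'M[R]_2 :=
  if n is k.+1 then A (iter k (@shift m) x) *m cocycle A k x else 1%:M.

Definition is_lyapunov (R : realType) (m : nat)
    (mu : probability (shift_space m) R) (A : shift_space m -> 'M[R]_2)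
    (l : R) : Prop :=
  {ae mu, forall x,
    (fun n : nat => n%:R^-1 * ln (opnorm (cocycle A n x))) @ \oo --> l}.

(* The almost everywhere constant value of the limit. It is unique because
   mu is nonzero; for mu Bernoulli and A in holder_SL2 it exists by the
   theorem of Furstenberg and Kesten and the ergodicity of the shift. *)
Definition lambda_plus (R : realType) (m : nat)
    (mu : probability (shift_space m) R) (A : shift_space m -> 'M[R]_2) : R :=
  xget 0 [set l | is_lyapunov mu A l].

Definition nonunif_fiber_bunched (R : realType) (rho alpha : R) (m : nat)
    (mu : probability (shift_space m) R) (A : shift_space m -> 'M[R]_2)
    : Prop :=
  2 * lambda_plus mu A < alpha * ln (rho^-1).

Definition locally_constant_by (R : realType) (m : nat)
    (A : shift_space m -> 'M[R]_2) (A0 : 'I_m.+1 -> 'M[R]_2) : Prop :=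
  forall x, A x = A0 (x 0).

Definition irreducible_family (R : realType) (m : nat)
    (A0 : 'I_m.+1 -> 'M[R]_2) : Prop :=
  ~ exists L : {vspace 'cV[R]_2}, \dim L = 1%N /\
      forall i v, v \in L -> A0 i *m v \in L.

(* Main.v *)
(* The exponent is the infimum over n of the means of (1/n) ln |A^n|, hence upper
   semicontinuous. For the lower bound let lam = lambda_plus A > 0. Since A is
   irreducible, there is an n such that every vector w is stretched by A^n, in
   the mean of ln |A^n w|, by at least n (lam - eta). Let B be eps-close to A.
   For a block of n letters starting at time J, compare u = B^J(x) v with
   w = B^J(x') v, where x' is x with all letters from time J on replaced by a
   fixed one: w is independent of the block, so B^n, being close to A^n,
   stretches it in the mean almost by n (lam - eta). The sine of the angle of u
   and w is at most \sum_i |B^(J-i-1)|^2 eps r^(J-i) with r = rho^alpha. As the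
   sine is at most 1, each term may be replaced by its power of exponent s <= 1.
   Fiber bunching, 2 lam + ln r < 0, gives q and a small s for which the mean of
   |A^q|^(2s) r^(qs) is less than 1, so that the mean of the sine is O(eps^s)
   uniformly in J, and the growth of u is as good as that of w. *)
From Pilot Require Import Defs.
From HB Require Import structures.
From mathcomp Require Import all_boot all_order all_algebra.
From mathcomp Require Import all_classical all_reals all_analysis measurable_realfun.
From mathcomp Require Import ring lra zify.
Import Order.TTheory GRing.Theory Num.Theory.
Import numFieldNormedType.Exports.
Set Implicit Arguments.
Unset Strict Implicit.
Unset Printing Implicit Defensive.
Local Open Scope classical_set_scope.
Local Open Scope ring_scope.
Import Pilot.Defs.

(** * Linear algebra of the plane *)

(** The obstacle is that [B] reads the whole sequence: the vector reached at time J already depends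
    on the letters of the coming block, so the block cannot be averaged with the vector fixed. As
    [A] only reads the zeroth letter, the dependence of [B] on all other letters comes from [B - A],
    whose Hölder constant is at most eps; this is the eps in the sum of sines. The power s is needed
    because fiber bunching controls the mean of ln |A^q|, not the possibly much larger logarithm of
    the mean of |A^q|^2. For small s, the mean of |A^q|^(2s) r^(qs) is close to 1 + s (2 E ln |A^q|
    + q ln r). Vectors are followed rather than norms because lower bounds on growth add up along
    consecutive blocks only for a vector. Uniform stretching by [A] is obtained without stationary
    measures: the growth rate of a vector, taken along an ultrafilter of times, is a harmonic
    function on lines, and a maximum principle shows that a value below lam would produce a finite
    family of lines permuted by the matrices. If lam is not positive, the lower bound is immediate,
    since all exponents are nonnegative. *)

Section plane.
Variable R : realType.
Implicit Types (u v w z : 'cV[R]_2) (M N : 'M[R]_2).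

Definition wedge u v : R := u 0 0 * v 1 0 - u 1 0 * v 0 0.

Lemma enormE v : enorm v = Num.sqrt (v 0 0 ^+ 2 + v 1 0 ^+ 2).
Proof. by rewrite /enorm big_ord_recl big_ord1; congr (Num.sqrt (_ ^+ 2 + v _ _ ^+ 2)); exact: val_inj. Qed.

Lemma mulmx2E M v i : (M *m v) i 0 = M i 0 * v 0 0 + M i 1 * v 1 0.
Proof.
rewrite mxE big_ord_recl big_ord1.
by congr (_ + M _ _ * v _ _); exact: val_inj.
Qed.

Lemma cV2P u v : u 0 0 = v 0 0 -> u 1 0 = v 1 0 -> u = v.
Proof.
move=> h0 h1; apply/matrixP => i j; rewrite (ord1 j).
case: i => [[|[|//]] hi].
  by rewrite (_ : Ordinal hi = 0)//; exact: val_inj.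
by rewrite (_ : Ordinal hi = 1)//; exact: val_inj.
Qed.

Lemma det2E M : \det M = M 0 0 * M 1 1 - M 0 1 * M 1 0.
Proof.
rewrite (expand_det_row _ 0) big_ord_recl big_ord1 /cofactor !det_mx11 !mxE /=.
rewrite (_ : lift 0 0 = 1 :> 'I_2); last exact: val_inj.
rewrite (_ : lift 1 0 = 0 :> 'I_2); last exact: val_inj.
by rewrite /= expr0 expr1; ring.
Qed.

Lemma enorm_sq v : enorm v ^+ 2 = v 0 0 ^+ 2 + v 1 0 ^+ 2.
Proof. by rewrite enormE sqr_sqrtr// addr_ge0 ?sqr_ge0. Qed.

Lemma enorm_ge0 v : 0 <= enorm v. Proof. exact: sqrtr_ge0. Qed.

Lemma enorm_eq0 v : (enorm v == 0) = (v == 0).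
Proof.
apply/idP/eqP => [/eqP h|->]; last by rewrite enormE !mxE expr0n addr0 sqrtr0.
have /eqP := enorm_sq v; rewrite h expr0n /= eq_sym paddr_eq0 ?sqr_ge0//.
by rewrite !sqrf_eq0 => /andP[/eqP h0 /eqP h1]; apply: cV2P; rewrite mxE.
Qed.

Lemma enorm_gt0 v : (0 < enorm v) = (v != 0).
Proof. by rewrite lt0r enorm_eq0 enorm_ge0 andbT. Qed.

Lemma enormZ a v : enorm (a *: v) = `|a| * enorm v.
Proof.
apply/eqP; rewrite -(@eqrXn2 _ 2)// ?mulr_ge0 ?enorm_ge0//.
by rewrite exprMn !enorm_sq !mxE real_normK ?num_real//; apply/eqP; ring.
Qed.

Lemma normr_le_sqr (a b : R) : 0 <= b -> a ^+ 2 <= b ^+ 2 -> `|a| <= b.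
Proof.
by move=> b0 h; rewrite -(@ler_pXn2r _ 2)// ?nnegrE// real_normK ?num_real.
Qed.

Lemma wedge_le u v : `|wedge u v| <= enorm u * enorm v.
Proof.
apply: normr_le_sqr; first by rewrite mulr_ge0 ?enorm_ge0.
rewrite exprMn !enorm_sq /wedge -subr_ge0.
rewrite (_ : _ - _ = (u 0 0 * v 0 0 + u 1 0 * v 1 0) ^+ 2) ?sqr_ge0//; ring.
Qed.

Definition dot u v : R := u 0 0 * v 0 0 + u 1 0 * v 1 0.

Lemma dot_le u v : `|dot u v| <= enorm u * enorm v.
Proof.
apply: normr_le_sqr; first by rewrite mulr_ge0 ?enorm_ge0.
rewrite exprMn !enorm_sq /dot -subr_ge0.
rewrite (_ : _ - _ = wedge u v ^+ 2) ?sqr_ge0// /wedge; ring.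
Qed.

Lemma enormD u v : enorm (u + v) <= enorm u + enorm v.
Proof.
have h := le_trans (ler_norm _) (dot_le u v).
rewrite -(@ler_pXn2r _ 2)// ?nnegrE ?addr_ge0 ?enorm_ge0//.
rewrite sqrrD !enorm_sq !mxE; move: h; rewrite /dot; lra.
Qed.

Lemma wedge_mul M u v : wedge (M *m u) (M *m v) = \det M * wedge u v.
Proof. by rewrite det2E /wedge !mulmx2E; ring. Qed.

Lemma wedgeC u v : wedge v u = - wedge u v.
Proof. by rewrite /wedge; ring. Qed.

Lemma wedgeZl a u v : wedge (a *: u) v = a * wedge u v.
Proof. by rewrite /wedge !mxE; ring. Qed.

Lemma wedgeZr a u v : wedge u (a *: v) = a * wedge u v.
Proof. by rewrite /wedge !mxE; ring. Qed.

(** Cramer's rule. Its norm gives the triangle inequality for sines, and applying a matrix to it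
    bounds the matrix by its values on two independent vectors. *)
Lemma wedge_plucker u v z :
  wedge u v *: z = wedge u z *: v + wedge z v *: u.
Proof. by apply: cV2P; rewrite !mxE /wedge; ring. Qed.

Lemma wedge0P u v : u != 0 -> wedge u v = 0 -> exists a, v = a *: u.
Proof.
move=> u0 h; exists (dot u v / enorm u ^+ 2).
have e0 : enorm u ^+ 2 != 0 by rewrite sqrf_eq0 enorm_eq0.
apply: (scalerI e0); rewrite scalerA mulrCA divff// mulr1 enorm_sq.
move: h; rewrite /wedge /dot => h.
by apply: cV2P; rewrite !mxE; [have := congr1 (fun t => t * - u 1 0) h|
  have := congr1 (fun t => t * u 0 0) h]; lra.
Qed.

(** A crude bound whose purpose is to make the supremum in [opnorm] a supremum over a bounded
    set. *)
Let frob M : R := `|M 0 0| + `|M 0 1| + `|M 1 0| + `|M 1 1|.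

Lemma coord_le_enorm v i : `|v i 0| <= enorm v.
Proof.
apply: normr_le_sqr; first exact: enorm_ge0.
rewrite enorm_sq; case: i => [[|[|//]] hi].
  by rewrite (_ : Ordinal hi = 0); [rewrite lerDl sqr_ge0|exact: val_inj].
by rewrite (_ : Ordinal hi = 1); [rewrite lerDr sqr_ge0|exact: val_inj].
Qed.

Lemma enorm_le_coord v : enorm v <= `|v 0 0| + `|v 1 0|.
Proof.
rewrite -(@ler_pXn2r _ 2)// ?nnegrE ?addr_ge0 ?enorm_ge0//.
rewrite sqrrD enorm_sq !real_normK ?num_real//.
have : 0 <= `|v 0 0| * `|v 1 0| by rewrite mulr_ge0.
lra.
Qed.

Lemma enorm_mulmx_frob M v : enorm (M *m v) <= frob M * enorm v.
Proof.
apply: (le_trans (enorm_le_coord _)); rewrite !mulmx2E.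
have c0 := coord_le_enorm v 0; have c1 := coord_le_enorm v 1.
have h i : `|M i 0 * v 0 0 + M i 1 * v 1 0| <= (`|M i 0| + `|M i 1|) * enorm v.
  apply: (le_trans (ler_normD _ _)); rewrite !normrM mulrDl.
  by rewrite lerD// ler_wpM2l.
have := h 0; have := h 1; rewrite /frob; lra.
Qed.

Definition e1 : 'cV[R]_2 := \col_i (i == 0)%:R.

Lemma enorm_e1 : enorm e1 = 1.
Proof. by rewrite enormE !mxE /= expr0n addr0 expr1n sqrtr1. Qed.

Lemma e1_neq0 : e1 != 0.
Proof. by rewrite -enorm_eq0 enorm_e1 oner_neq0. Qed.

Let opset M := [set enorm (M *m v) | v in [set v : 'cV[R]_2 | enorm v = 1]].

Let has_sup_opset M : has_sup (opset M).
Proof.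
split; first by exists (enorm (M *m e1)), e1 => //; exact: enorm_e1.
exists (frob M) => _ [v /= hv <-].
by rewrite (le_trans (enorm_mulmx_frob _ _))// hv mulr1.
Qed.

Lemma opnorm_ge0 M : 0 <= opnorm M.
Proof.
apply: (@le_trans _ _ (enorm (M *m e1))); first exact: enorm_ge0.
by apply: sup_upper_bound; [exact: has_sup_opset|exists e1 => //; exact: enorm_e1].
Qed.

Lemma enorm_mulmx M v : enorm (M *m v) <= opnorm M * enorm v.
Proof.
have [->|v0] := eqVneq v 0.
  by rewrite mulmx0 (_ : enorm 0 = 0) ?mulr0//; apply/eqP; rewrite enorm_eq0.
have e0 : 0 < enorm v by rewrite enorm_gt0.
rewrite -ler_pdivrMr// mulrC -[(enorm v)^-1]ger0_norm ?invr_ge0 ?enorm_ge0//.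
rewrite -enormZ scalemxAr; apply: sup_upper_bound; first exact: has_sup_opset.
exists ((enorm v)^-1 *: v) => //=.
by rewrite enormZ ger0_norm ?invr_ge0 ?enorm_ge0// mulVf// gt_eqF.
Qed.

Lemma opnorm_le M c : (forall v, enorm (M *m v) <= c * enorm v) -> opnorm M <= c.
Proof.
move=> h; apply: ge_sup; first by case: (has_sup_opset M).
by move=> _ [v /= hv <-]; rewrite (le_trans (h v))// hv mulr1.
Qed.

Lemma opnormM M N : opnorm (M *m N) <= opnorm M * opnorm N.
Proof.
apply: opnorm_le => v; rewrite -mulmxA (le_trans (enorm_mulmx _ _))//.
by rewrite -mulrA ler_wpM2l ?opnorm_ge0// enorm_mulmx.
Qed.

Lemma opnormD M N : opnorm (M + N) <= opnorm M + opnorm N.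
Proof.
apply: opnorm_le => v; rewrite mulmxDl (le_trans (enormD _ _))//.
by rewrite mulrDl lerD// enorm_mulmx.
Qed.

Lemma opnormN M : opnorm (- M) = opnorm M.
Proof.
rewrite /opnorm; congr (sup _); apply: eq_imagel => v _.
by rewrite mulNmx -scaleN1r enormZ normrN1 mul1r.
Qed.

Lemma opnorm_distC M N : opnorm (M - N) = opnorm (N - M).
Proof. by rewrite -opnormN opprB. Qed.

Lemma opnorm1_le : opnorm (1%:M : 'M[R]_2) <= 1.
Proof. by apply: opnorm_le => v; rewrite mul1mx mul1r. Qed.

(** In determinant one a matrix and its inverse have the same norm. Invariance of area shows it
    without the inverse. *)
Lemma enorm_le_SL2 M v : \det M = 1 -> enorm v <= opnorm M * enorm (M *m v).
Proof.
move=> dM; have [->|v0] := eqVneq v 0.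
  rewrite (_ : enorm 0 = 0) ?mulr_ge0 ?opnorm_ge0 ?enorm_ge0//.
  by apply/eqP; rewrite enorm_eq0.
(* [Jv] is [v] turned by a right angle, so that [wedge v Jv] is the square of the length of [v]. *)
pose Jv : 'cV[R]_2 := \col_i (if i == 0 then - v 1 0 else v 0 0).
have J0 : Jv 0 0 = - v 1 0 by rewrite mxE.
have J1 : Jv 1 0 = v 0 0 by rewrite mxE.
have eJ : enorm Jv = enorm v by rewrite !enormE J0 J1 sqrrN addrC.
have ev : 0 < enorm v by rewrite enorm_gt0.
rewrite -(ler_pM2r ev) -expr2.
have -> : enorm v ^+ 2 = wedge (M *m v) (M *m Jv).
  by rewrite wedge_mul dM mul1r enorm_sq /wedge J0 J1; ring.
rewrite (le_trans (ler_norm _))// (le_trans (wedge_le _ _))//.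
by rewrite mulrC mulrAC ler_wpM2r ?enorm_ge0// -eJ enorm_mulmx.
Qed.

Lemma opnorm_ge1 M : \det M = 1 -> 1 <= opnorm M.
Proof.
move=> dM; have h := enorm_le_SL2 e1 dM.
have := enorm_mulmx M e1; rewrite enorm_e1 mulr1 => h2.
rewrite leNgt; apply/negP => h3.
have : opnorm M * enorm (M *m e1) <= opnorm M * opnorm M.
  by rewrite ler_wpM2l ?opnorm_ge0.
move: h; rewrite enorm_e1 => h.
have := opnorm_ge0 M; nra.
Qed.

Lemma opnorm_gt0 M : \det M = 1 -> 0 < opnorm M.
Proof. by move=> /opnorm_ge1; exact: lt_le_trans. Qed.

Lemma mulSL2_neq0 M v : \det M = 1 -> v != 0 -> M *m v != 0.
Proof.
move=> dM; rewrite -!enorm_gt0 => v0.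
have := lt_le_trans v0 (enorm_le_SL2 v dM).
by rewrite pmulr_rgt0// opnorm_gt0.
Qed.

(** Expand an arbitrary vector by [wedge_plucker]; its coefficients are wedges, bounded by products
    of lengths. *)
Lemma opnorm_le_pair M u v : wedge u v != 0 ->
  opnorm M <= (enorm (M *m u) * enorm v + enorm (M *m v) * enorm u) / `|wedge u v|.
Proof.
move=> h; apply: opnorm_le => z.
have h0 : 0 < `|wedge u v| by rewrite normr_gt0.
rewrite mulrAC ler_pdivlMr// mulrC -enormZ scalemxAr wedge_plucker.
rewrite mulmxDr -!scalemxAr (le_trans (enormD _ _))// !enormZ.
have h1 := wedge_le u z; have h2 := wedge_le z v.
rewrite addrC mulrDl lerD//.
  by rewrite mulrC -mulrA ler_wpM2l ?enorm_ge0// mulrC.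
by rewrite mulrC -mulrA ler_wpM2l ?enorm_ge0.
Qed.

(* [sdist u w] is the sine of the angle between [u] and [w]. *)
Definition sdist u w : R := `|wedge u w| / (enorm u * enorm w).

Lemma sdist_ge0 u w : 0 <= sdist u w.
Proof. by rewrite divr_ge0// mulr_ge0 ?enorm_ge0. Qed.

Lemma sdist_le1 u w : u != 0 -> w != 0 -> sdist u w <= 1.
Proof.
move=> u0 w0; rewrite ler_pdivrMr ?mulr_gt0 ?enorm_gt0// mul1r.
exact: wedge_le.
Qed.

Lemma sdistC u w : sdist u w = sdist w u.
Proof. by rewrite /sdist wedgeC normrN [enorm w * _]mulrC. Qed.

Lemma sdistxx u : sdist u u = 0.
Proof.
by rewrite /sdist (_ : wedge u u = 0) ?normr0 ?mul0r// /wedge mulrC subrr.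
Qed.

(** Take lengths in [wedge_plucker] and divide by the product of the three lengths. *)
Lemma sdist_tri u w z : u != 0 -> w != 0 -> z != 0 ->
  sdist u w <= sdist u z + sdist z w.
Proof.
move=> u0 w0 z0.
have [eu ew ez] : [/\ 0 < enorm u, 0 < enorm w & 0 < enorm z].
  by rewrite !enorm_gt0.
have := congr1 (@enorm R) (wedge_plucker u w z); rewrite enormZ => h.
have := enormD (wedge u z *: w) (wedge z w *: u); rewrite -h !enormZ.
rewrite /sdist => {}h.
have -> : `|wedge u z| / (enorm u * enorm z) + `|wedge z w| / (enorm z * enorm w)
  = (`|wedge u z| * enorm w + `|wedge z w| * enorm u) / (enorm u * enorm w * enorm z).
  by field; rewrite !gt_eqF.
rewrite ler_pdivlMr ?mulr_gt0// mulrA divfK ?mulf_neq0 ?gt_eqF//.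
Qed.

(** The area in the numerator is preserved, and each of the two lengths in the denominator shrinks
    at most by the factor [opnorm M]. *)
Lemma sdist_mul M u w : \det M = 1 -> u != 0 -> w != 0 ->
  sdist (M *m u) (M *m w) <= opnorm M ^+ 2 * sdist u w.
Proof.
move=> dM u0 w0; rewrite /sdist wedge_mul dM mul1r.
have h v : v != 0 -> (enorm (M *m v))^-1 <= opnorm M * (enorm v)^-1.
  move=> v0; have ev : 0 < enorm v by rewrite enorm_gt0.
  have eMv : 0 < enorm (M *m v) by rewrite enorm_gt0 mulSL2_neq0.
  by rewrite ler_pdivlMr// mulrC ler_pdivrMr// enorm_le_SL2.
rewrite mulrCA ler_wpM2l// !invfM expr2 mulrACA.
by rewrite ler_pM ?invr_ge0 ?enorm_ge0 ?h.
Qed.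

Lemma sdist_pert M N u : \det M = 1 -> \det N = 1 -> u != 0 ->
  sdist (M *m u) (N *m u) <= opnorm (M - N) * opnorm M.
Proof.
move=> dM dN u0.
have eM : 0 < enorm (M *m u) by rewrite enorm_gt0 mulSL2_neq0.
have eN : 0 < enorm (N *m u) by rewrite enorm_gt0 mulSL2_neq0.
rewrite /sdist ler_pdivrMr ?mulr_gt0//.
(* Subtracting a multiple of the second vector from the first does not change the area. *)
have -> : wedge (M *m u) (N *m u) = wedge ((M - N) *m u) (N *m u).
  by rewrite mulmxBl /wedge !mxE; ring.
rewrite (le_trans (wedge_le _ _))// mulrA ler_wpM2r ?enorm_ge0//.
rewrite -mulrA (le_trans (enorm_mulmx _ _))// ler_wpM2l ?opnorm_ge0//.
exact: enorm_le_SL2.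
Qed.

Definition lgrow M u : R := ln (enorm (M *m u)) - ln (enorm u).

Lemma ln_le_sub1 (a : R) : 0 < a -> ln a <= a - 1.
Proof. by move=> a0; have := expR_ge1Dx (ln a); rewrite lnK ?posrE//; lra. Qed.

Lemma ln_sub_le (a b : R) : 0 < a -> 0 < b -> ln a - ln b <= (a - b) / b.
Proof.
move=> a0 b0; rewrite -ln_div ?posrE// (le_trans (ln_le_sub1 _)) ?divr_gt0//.
by rewrite mulrBl divff ?gt_eqF.
Qed.

(* Split [u] into its components along [w] and orthogonally to [w]. *)
Lemma lgrow_lip M u w : \det M = 1 -> u != 0 -> w != 0 ->
  lgrow M u - lgrow M w <= opnorm M ^+ 2 * sdist u w.
Proof.
move=> dM u0 w0.
have [eu ew] : 0 < enorm u /\ 0 < enorm w by rewrite !enorm_gt0.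
have eMu : 0 < enorm (M *m u) by rewrite enorm_gt0 mulSL2_neq0.
have eMw : 0 < enorm (M *m w) by rewrite enorm_gt0 mulSL2_neq0.
pose Jw : 'cV[R]_2 := \col_i (if i == 0 then - w 1 0 else w 0 0).
have J0 : Jw 0 0 = - w 1 0 by rewrite mxE.
have J1 : Jw 1 0 = w 0 0 by rewrite mxE.
have eJ : enorm Jw = enorm w by rewrite !enormE J0 J1 sqrrN addrC.
have dec : (enorm w ^+ 2) *: u = dot u w *: w + wedge w u *: Jw.
  by rewrite enorm_sq; apply: cV2P; rewrite !mxE /= /dot /wedge; ring.
have h1 : enorm w ^+ 2 * enorm (M *m u) <=
    enorm u * enorm w * enorm (M *m w) + `|wedge u w| * (opnorm M * enorm w).
  rewrite -[enorm w ^+ 2]ger0_norm ?sqr_ge0// -enormZ scalemxAr dec.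
  rewrite mulmxDr -!scalemxAr (le_trans (enormD _ _))// !enormZ lerD//.
    by rewrite ler_wpM2r ?enorm_ge0// dot_le.
  by rewrite wedgeC normrN ler_wpM2l// -eJ enorm_mulmx.
have h2 : enorm (M *m u) / enorm u - enorm (M *m w) / enorm w
    <= opnorm M * sdist u w.
  rewrite lerBlDr ler_pdivrMr// -(ler_pM2l (exprn_gt0 2 ew)).
  apply: (le_trans h1); rewrite /sdist le_eqVlt; apply/orP; left; apply/eqP.
  by field; rewrite !gt_eqF.
have h3 : enorm w / enorm (M *m w) <= opnorm M.
  by rewrite ler_pdivrMr// enorm_le_SL2.
rewrite /lgrow -(ln_div eMu eu) -(ln_div eMw ew).
apply: (le_trans (ln_sub_le _ _)); rewrite ?divr_gt0//.
rewrite invf_div expr2 -mulrA mulrC.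
apply: (@le_trans _ _ (enorm w / enorm (M *m w) * (opnorm M * sdist u w))).
  by rewrite ler_wpM2l// divr_ge0 ?enorm_ge0.
by rewrite ler_wpM2r// mulr_ge0 ?opnorm_ge0 ?sdist_ge0.
Qed.

Lemma lgrow_le M u : \det M = 1 -> u != 0 -> lgrow M u <= ln (opnorm M).
Proof.
move=> dM u0; have eu : 0 < enorm u by rewrite enorm_gt0.
have eMu : 0 < enorm (M *m u) by rewrite enorm_gt0 mulSL2_neq0.
rewrite /lgrow lerBlDr -lnM ?posrE ?opnorm_gt0//.
by rewrite ler_ln ?posrE ?mulr_gt0 ?opnorm_gt0// enorm_mulmx.
Qed.

Lemma lgrow_ge M u : \det M = 1 -> u != 0 -> - ln (opnorm M) <= lgrow M u.
Proof.
move=> dM u0; have eu : 0 < enorm u by rewrite enorm_gt0.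
have eMu : 0 < enorm (M *m u) by rewrite enorm_gt0 mulSL2_neq0.
rewrite /lgrow lerBrDr addrC lerBlDr addrC -lnM ?posrE ?opnorm_gt0//.
by rewrite ler_ln ?posrE ?mulr_gt0 ?opnorm_gt0// enorm_le_SL2.
Qed.

Lemma ln_opnorm_ge0 M : \det M = 1 -> 0 <= ln (opnorm M).
Proof. by move=> dM; rewrite ln_ge0// opnorm_ge1. Qed.

Lemma ln_opnormM M N : \det M = 1 -> \det N = 1 ->
  ln (opnorm (M *m N)) <= ln (opnorm M) + ln (opnorm N).
Proof.
move=> dM dN; rewrite -lnM ?posrE ?opnorm_gt0// ler_ln ?posrE ?mulr_gt0 ?opnorm_gt0//.
  exact: opnormM.
by rewrite det_mulmx dM dN mul1r.
Qed.

Lemma opnorm_le_mulr M N : \det N = 1 -> opnorm M <= opnorm (M *m N) * opnorm N.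
Proof.
move=> dN; have uN : N \in unitmx by rewrite unitmxE dN unitr1.
apply: opnorm_le => v; rewrite -{1}[v](mulKVmx uN) [M *m _]mulmxA.
rewrite (le_trans (enorm_mulmx _ _))// -mulrA ler_wpM2l ?opnorm_ge0//.
by have := enorm_le_SL2 (invmx N *m v) dN; rewrite mulKVmx.
Qed.

Lemma opnorm_le_mull M N : \det M = 1 -> opnorm N <= opnorm M * opnorm (M *m N).
Proof.
move=> dM; apply: opnorm_le => v.
rewrite (le_trans (enorm_le_SL2 _ dM))// -mulrA ler_wpM2l ?opnorm_ge0// mulmxA.
exact: enorm_mulmx.
Qed.

Lemma opnorm_sub_le M N : opnorm M <= opnorm N + opnorm (M - N).
Proof. by rewrite -{1}(subrK N M) addrC; exact: opnormD. Qed.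

Lemma ln_opnorm_lip M N : \det M = 1 -> \det N = 1 ->
  ln (opnorm M) - ln (opnorm N) <= opnorm (M - N).
Proof.
move=> dM dN; apply: (le_trans (ln_sub_le _ _)); rewrite ?opnorm_gt0//.
rewrite ler_pdivrMr ?opnorm_gt0//.
have := opnorm_sub_le M N; have := opnorm_ge1 dN; have := opnorm_ge0 (M - N).
nra.
Qed.

Lemma lgrow_pert M N u : \det M = 1 -> \det N = 1 -> u != 0 ->
  lgrow M u - lgrow N u <= opnorm (M - N) * opnorm N.
Proof.
move=> dM dN u0.
have eM : 0 < enorm (M *m u) by rewrite enorm_gt0 mulSL2_neq0.
have eN : 0 < enorm (N *m u) by rewrite enorm_gt0 mulSL2_neq0.
rewrite /lgrow opprB addrA subrK (le_trans (ln_sub_le _ _))//.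
rewrite ler_pdivrMr// -mulrA.
apply: (@le_trans _ _ (enorm ((M - N) *m u))).
  rewrite lerBlDr addrC (le_trans _ (enormD _ _))//.
  by rewrite mulmxBl addrC subrK.
rewrite (le_trans (enorm_mulmx _ _))// ler_wpM2l ?opnorm_ge0//.
exact: enorm_le_SL2.
Qed.

End plane.

(** * Subadditive ergodic theorem *)

Lemma natmul_bounded_le0 (R : realType) (a K : R) :
  (forall n, n%:R * a <= K) -> a <= 0.
Proof.
move=> h; rewrite leNgt; apply/negP => a0.
have := h (Num.truncn (K / a)).+1.
apply/negP; rewrite -ltNge -ltr_pdivrMr//.
exact: truncnS_gt.
Qed.

Lemma sumr_const_seq (V : nmodType) (I : Type) (s : seq I) (a : V) :
  \sum_(i <- s) a = a *+ size s.
Proof. by rewrite big_const_seq count_predT iter_addr_0. Qed.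

(** * Bounded measurable functions and their means *)

Section bounded_measurable.
Context d (T : measurableType d) (R : realType) (mu : probability T R).
Implicit Types phi psi : T -> R.

(** A class stable under all operations used below and contained in the integrable functions, so
    that linearity of the mean has no further side conditions. *)
Definition bm phi := measurable_fun [set: T] phi /\ exists C, forall x, `|phi x| <= C.

Definition Ex phi : R := \int[mu]_x phi x.

Lemma bm_integrable phi : bm phi -> mu.-integrable setT (EFin \o phi).
Proof.
move=> [mphi [C hC]]; apply: measurable_bounded_integrable => //.
  by rewrite -ge0_fin_numE// fin_num_measure.
exists C; split; first exact: num_real.
by move=> x Cx y _ /=; rewrite (le_trans (hC y))// ltW.
Qed.

Lemma bm_cst c : bm (fun=> c).
Proof. by split; [exact: measurable_cst|exists `|c|]. Qed.

Lemma bmD phi psi : bm phi -> bm psi -> bm (fun x => phi x + psi x).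
Proof.
move=> [m1 [C1 h1]] [m2 [C2 h2]]; split; first exact: measurable_funD.
by exists (C1 + C2) => x; rewrite (le_trans (ler_normD _ _))// lerD.
Qed.

Lemma bmZ c phi : bm phi -> bm (fun x => c * phi x).
Proof.
move=> [m1 [C1 h1]]; split; first exact: measurable_funM.
by exists (`|c| * C1) => x; rewrite normrM ler_wpM2l.
Qed.

Lemma bmN phi : bm phi -> bm (fun x => - phi x).
Proof.
by move=> /(bmZ (-1)); under eq_fun do rewrite mulN1r.
Qed.

Lemma bm_sum (I : Type) (s : seq I) (phi : I -> T -> R) :
  (forall i, bm (phi i)) -> bm (fun x => \sum_(i <- s) phi i x).
Proof.
move=> h; elim: s => [|i s ih].
  by under eq_fun do rewrite big_nil; exact: bm_cst.
by under eq_fun do rewrite big_cons; exact: bmD.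
Qed.

Lemma bm_indic A : measurable A -> bm (\1_A : T -> R).
Proof.
move=> mA; split; first exact: measurable_indic.
by exists 1 => x; rewrite indicE ger0_norm//; case: (x \in A).
Qed.

Lemma bm_comp phi (f : T -> T) : measurable_fun setT f -> bm phi -> bm (phi \o f).
Proof.
move=> mf [m1 [C1 h1]]; split; first exact: measurableT_comp.
by exists C1 => x; exact: h1.
Qed.

Lemma Ex_cst c : Ex (fun=> c) = c.
Proof. by rewrite /Ex Rintegral_cst// [X in fine X](@probability_setT _ _ _ mu) mulr1. Qed.

Lemma ExD phi psi : bm phi -> bm psi ->
  Ex (fun x => phi x + psi x) = Ex phi + Ex psi.
Proof. by move=> /bm_integrable i1 /bm_integrable i2; exact: RintegralD. Qed.

Lemma ExZ c phi : bm phi -> Ex (fun x => c * phi x) = c * Ex phi.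
Proof. by move=> /bm_integrable i1; exact: RintegralZl. Qed.

Lemma ExN phi : bm phi -> Ex (fun x => - phi x) = - Ex phi.
Proof.
move=> b; rewrite -mulN1r -ExZ//.
by congr Ex; apply/funext => x; rewrite mulN1r.
Qed.

Lemma Ex_sum (I : Type) (s : seq I) (phi : I -> T -> R) :
  (forall i, bm (phi i)) ->
  Ex (fun x => \sum_(i <- s) phi i x) = \sum_(i <- s) Ex (phi i).
Proof.
move=> h; elim: s => [|i s ih].
  by rewrite big_nil; under eq_fun do rewrite big_nil; exact: Ex_cst.
rewrite big_cons -ih -ExD//; last exact: bm_sum.
by congr Ex; apply/funext => x; rewrite big_cons.
Qed.

Lemma Ex_le phi psi : bm phi -> bm psi -> (forall x, phi x <= psi x) ->
  Ex phi <= Ex psi.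
Proof.
move=> /bm_integrable i1 /bm_integrable i2 h.
by apply: le_Rintegral => // x _; exact: h.
Qed.

Lemma Ex_indic A : measurable A -> Ex (\1_A) = fine (mu A).
Proof. by move=> mA; rewrite /Ex /Rintegral integral_indic// setIT. Qed.

End bounded_measurable.

(** * Subadditive sequences over an ergodic map *)

Section ergodic.
Context d (T : measurableType d) (R : realType) (mu : probability T R).
Variable f : T -> T.
Hypothesis mf : measurable_fun [set: T] f.
Hypothesis finv : forall A, measurable A -> mu (f @^-1` A) = mu A.

Local Notation Ex := (Ex mu).

Lemma Ex_invariant phi : bm phi -> Ex (phi \o f) = Ex phi.
Proof.
move=> b; rewrite /Ex /Rintegral; congr fine.
have i := bm_integrable mu b.
have -> : (\int[mu]_x (phi x)%:E = \int[pushforward mu f]_x (phi x)%:E)%E.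
  by apply: eq_measure_integral => A mA _; apply/esym/finv.
rewrite integral_pushforward//.
  by apply/measurable_EFinP; case: b.
by rewrite preimage_setT; exact: bm_integrable (bm_comp mf b).
Qed.

Lemma measurable_iter n : measurable_fun setT (iter n f).
Proof.
elim: n => [|n ih]; first exact: measurable_id.
exact: (measurableT_comp mf ih).
Qed.

Lemma Ex_iter phi n : bm phi -> Ex (phi \o iter n f) = Ex phi.
Proof.
move=> b; elim: n => [//|n ih]; rewrite -ih -[RHS]Ex_invariant//.
  by congr Ex; apply/funext => x /=; rewrite -iterSr.
by apply: bm_comp => //; exact: measurable_iter.
Qed.

Section subadditive.
Variables (g : nat -> T -> R) (C : R).
Hypothesis bg : forall n, bm (g n).
Hypothesis gC : forall n x, `|g n x| <= C * n%:R.
Hypothesis gsub : forall a b x, g (a + b)%N x <= g a x + g b (iter a f x).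

Section mean_le.
Variable c : R.

(** The bad points, from which no block of length at most [N] grows slowly. These sets decrease with
    [N]. *)
Let B N := [set x | forall n, (0 < n <= N)%N -> c * n%:R < g n x].

Let mB N : measurable (B N).
Proof.
have -> : B N = \bigcap_n (if (0 < n <= N)%N then g n @^-1` `]c * n%:R, +oo[
    else setT).
  apply/seteqP; split=> x /=.
    by move=> h n _; case: ifP => // /h /=; rewrite in_itv/= andbT.
  move=> h n hn; have := h n I; rewrite hn /= in_itv/= andbT//.
apply: bigcapT_measurable => n; case: ifP => // _.
rewrite -[_ @^-1` _]setTI.
by case: (bg n) => + _; apply.
Qed.

(** Large enough that [c + C'] pays for one step from a bad point, and that [C' * N%:R] pays for the
    incomplete block at the end. *)
Let C' := C + `|c|.

Let C_ge0 : 0 <= C.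
Proof. by have x : T := point; rewrite -[C]mulr1 (le_trans _ (gC 1 x)). Qed.

Let c_le_C' : - C' <= c.
Proof. by rewrite /C'; have := ler_norm (- c); rewrite normrN; have := C_ge0; lra. Qed.

(* Cut [0, n) greedily: at a point outside [B N] use a block of length at most
   [N] along which [g] grows slowly, at a point of [B N] use a block of length
   one. *)
Let block_bound N n x :
  g n x <= \sum_(i <- iota 0 n) (c + C' * \1_(B N) (iter i f x)) + C' * N%:R.
Proof.
have C'0 : 0 <= C' by rewrite addr_ge0.
have term i y : - C' <= c + C' * \1_(B N) (iter i f y).
  by rewrite (le_trans c_le_C')// lerDl mulr_ge0// indicE.
have split_sum k l y : \sum_(i <- iota 0 (k + l)) (c + C' * \1_(B N) (iter i f y)) =
    \sum_(i <- iota 0 k) (c + C' * \1_(B N) (iter i f y)) +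
    \sum_(i <- iota 0 l) (c + C' * \1_(B N) (iter i f (iter k f y))).
  rewrite iotaD big_cat /= add0n; congr (_ + _).
  rewrite -[k in iota k _]addn0 iotaDl big_map; apply: eq_bigr => i _.
  by rewrite -iterD addnC.
elim/ltn_ind: n x => n ih x.
have [nN|Nn] := leqP n N.
  have h1 : C * n%:R <= C * N%:R by rewrite ler_wpM2l// ler_nat.
  have h2 : c * n%:R <= \sum_(i <- iota 0 n) (c + C' * \1_(B N) (iter i f x)).
    rewrite mulr_natr -[n in _ *+ n](size_iota 0) -sumr_const_seq.
    by apply: ler_sum => i _; rewrite lerDl mulr_ge0// indicE.
  have h3 : `|c| * n%:R <= `|c| * N%:R by rewrite ler_wpM2l// ler_nat.
  have h4 : - c * n%:R <= `|c| * n%:R by rewrite ler_wpM2r// -normrN ler_norm.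
  have h5 := le_trans (ler_norm _) (gC n x).
  rewrite /C'; lra.
have [xB|xB] := pselect (B N x).
  have n0 : (0 < n)%N by apply: leq_ltn_trans Nn.
  have -> : n = (1 + n.-1)%N by rewrite add1n prednK.
  rewrite split_sum (le_trans (gsub _ _ _))// -addrA lerD//; last first.
    by apply: ih; rewrite ltn_predL.
  rewrite big_seq1 /= indicE mem_set//= mulr1.
  have := le_trans (ler_norm _) (gC 1 x); rewrite mulr1.
  by have := ler_norm (- c); rewrite normrN /C'; lra.
have [l [/andP[l0 lN] hl]] : exists l, (0 < l <= N)%N /\ g l x <= c * l%:R.
  apply: contrapT => h; apply: xB => l hl; rewrite ltNge; apply/negP => h2.
  by apply: h; exists l.
have ln : (l <= n)%N by rewrite (leq_trans lN)// ltnW.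
rewrite -(subnKC ln) split_sum (le_trans (gsub _ _ _))// -addrA lerD//; last first.
  by apply: ih; rewrite ltn_subrL l0 (leq_trans l0).
rewrite (le_trans hl)// mulr_natr -[l in _ *+ l](size_iota 0) -sumr_const_seq.
by apply: ler_sum => i _; rewrite lerDl mulr_ge0// indicE.
Qed.

(** Integrating [block_bound] and letting [n] grow gives L <= c + C' mu(B N). The sets [B N]
    decrease to a null set, so the last term disappears as [N] grows. *)
Lemma subadditive_mean_le (L : R) :
  {ae mu, forall x, exists n, (0 < n)%N /\ g n x <= c * n%:R} ->
  (forall n, L * n%:R <= Ex (g n)) -> L <= c.
Proof.
move=> hae hL.
have C'0 : 0 <= C' by rewrite addr_ge0.
have step N : L <= c + C' * fine (mu (B N)).
  rewrite -subr_le0; apply: (@natmul_bounded_le0 _ _ (C' * N%:R)) => n.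
  have b1 i : bm (fun x => c + C' * \1_(B N) (iter i f x)).
    apply: bmD; first exact: bm_cst.
    apply: bmZ; apply: (bm_comp (measurable_iter i)); exact: bm_indic.
  have : Ex (g n) <= Ex (fun x => \sum_(i <- iota 0 n)
      (c + C' * \1_(B N) (iter i f x)) + C' * N%:R).
    apply: Ex_le; [exact: bg| |exact: block_bound].
    by apply: bmD; [exact: bm_sum|exact: bm_cst].
  rewrite ExD; [|exact: bm_sum|exact: bm_cst].
  rewrite Ex_cst Ex_sum//.
  under eq_bigr => i _.
    rewrite ExD; [|exact: bm_cst|apply: bmZ; apply: (bm_comp (measurable_iter i)); exact: bm_indic].
    rewrite Ex_cst ExZ; last by apply: (bm_comp (measurable_iter i)); exact: bm_indic.
    rewrite (@Ex_iter (\1_(B N)) i); last exact: bm_indic.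
    rewrite Ex_indic//.
    over.
  rewrite sumr_const_seq size_iota -mulr_natr => h.
  have := le_trans (hL n) h; lra.
have Bcap : mu (\bigcap_N B N) = 0%E.
  have mcap : measurable (\bigcap_N B N) by exact: bigcapT_measurable.
  apply/eqP; rewrite eq_le measure_ge0 andbT.
  have : mu.-negligible (\bigcap_N B N).
    apply: negligibleS hae => x /= hx [n [n0 hn]].
    by have := hx n I n; rewrite n0 leqnn => /(_ isT); rewrite ltNge hn.
  by move=> /(measure_negligible mcap) ->.
have Bcvg : fine \o (mu \o B) @ \oo --> (0 : R).
  have h : mu \o B @ \oo --> mu (\bigcap_N B N); last first.
    by move: h; rewrite Bcap => /fine_cvg.
  apply: nonincreasing_cvg_mu => //.
  - by rewrite -ge0_fin_numE// fin_num_measure.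
  - exact: bigcapT_measurable.
  - move=> i j ij; apply/subsetPset => x hx n /andP[n0 nj].
    by apply: hx; rewrite n0 (leq_trans nj).
have : (fun N => c + C' * fine (mu (B N))) @ \oo --> c + C' * 0.
  by apply: cvgD; [exact: cvg_cst|apply: cvgM => //; exact: cvg_cst].
rewrite mulr0 addr0 => h; by apply: (ler_cvg_to (cvg_cst L) h); apply: nearW => N; exact: step.
Qed.

End mean_le.
Hypothesis ergodic : forall A, measurable A -> f @^-1` A = A ->
  mu A = 0%E \/ mu A = 1%E.
Hypothesis gS : forall n x, `|g n.+1 x - g n (f x)| <= C.

Variable L : R.
Hypothesis hL : forall n, L * n%:R <= Ex (g n).

Let slow (c : R) := [set x | forall k, exists n, (k < n)%N /\ g n x <= c * n%:R].

Let mslow (c : R) : measurable (slow c).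
Proof.
have -> : slow c = \bigcap_k \bigcup_n
    (if (k < n)%N then g n @^-1` `]-oo, c * n%:R] else set0).
  apply/seteqP; split=> x /= h k.
    by move=> _; have [n [kn hn]] := h k; exists n; rewrite // kn /= in_itv.
  by have [n _] := h k I; case: ifP => // kn; rewrite /= in_itv /= => hn; exists n.
apply: bigcapT_measurable => k; apply: bigcupT_measurable => n; case: ifP => // _.
by rewrite -[_ @^-1` _]setTI; case: (bg n) => + _; apply.
Qed.

Let archi (a b : R) : 0 < a -> exists K : nat, forall n, (K <= n)%N -> b <= n%:R * a.
Proof.
move=> a0; exists (Num.truncn (b / a)).+1 => n hn.
rewrite -ler_pdivrMr// ltW// (lt_le_trans (truncnS_gt _))//.
by rewrite ler_nat.
Qed.

(** Replacing [x] by [f x] changes [g] by a bounded amount, which [e * n] absorbs once [n] is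
    large. *)
Let slow_to_shift (a e : R) x : 0 < e -> slow a x -> slow (a + e) (f x).
Proof.
move=> e0 h k; have [K hK] := archi (C + `|a|) e0.
have [[|n] [hn hg]] := h (maxn k K).+1; first by rewrite ltn0 in hn.
rewrite ltnS in hn; exists n; split; first by rewrite (leq_trans _ hn)// ltnS leq_maxl.
have := gS n x; rewrite ler_norml => /andP[h1 _].
have := hK n; rewrite (leq_trans (leq_maxr k K)) ?(ltnW hn)// => /(_ isT).
move: hg; rewrite -(natr1 n) mulrDr mulr1; have := ler_norm a; lra.
Qed.

Let slow_of_shift (a e : R) x : 0 < e -> slow a (f x) -> slow (a + e) x.
Proof.
move=> e0 h k; have [K hK] := archi (C + `|a|) e0.
have [n [hn hg]] := h (maxn k K).
exists n.+1; split; first by rewrite ltnS (leq_trans (leq_maxl k K))// ltnW.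
have := gS n x; rewrite ler_norml => /andP[_ h1].
have := hK n; rewrite (leq_trans (leq_maxr k K))// ?(ltnW hn)// => /(_ isT).
rewrite -(natr1 n) mulrDr mulr1; have := ler_norm (- a); rewrite normrN; lra.
Qed.

Let slow_mono a b x : a <= b -> slow a x -> slow b x.
Proof.
move=> ab h k; have [n [kn hn]] := h k; exists n; split=> //.
by rewrite (le_trans hn)// ler_wpM2r.
Qed.

(** The set where the lower limit of [g n x / n] is less than [c]. The sets [slow c] are invariant
    only up to an arbitrarily small change of [c]; the union over smaller thresholds is exactly
    invariant, as ergodicity requires. *)
Let slowlt (c : R) := [set x | exists2 e : R, 0 < e & slow (c - e) x].

Let mslowlt c : measurable (slowlt c).
Proof.
have -> : slowlt c = \bigcup_q slow (c - q.+1%:R^-1).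
  apply/seteqP; split=> x /=.
    move=> [e e0 he]; exists (Num.truncn e^-1) => //.
    apply: slow_mono he; rewrite lerD2l lerN2 invf_ple ?posrE//.
    by rewrite ltW// truncnS_gt.
  by move=> [q _ hq]; exists q.+1%:R^-1.
exact: bigcupT_measurable.
Qed.

Let slowlt_inv c : f @^-1` (slowlt c) = slowlt c.
Proof.
apply/seteqP; split=> x /= [e e0 h]; have e2 : 0 < e / 2 by rewrite divr_gt0.
  exists (e / 2) => //; have := slow_of_shift e2 h.
  by apply: slow_mono; lra.
exists (e / 2) => //; have := slow_to_shift e2 h.
by apply: slow_mono; lra.
Qed.

Lemma subadditive_liminf_ge c : c < L ->
  {ae mu, forall x, exists k, forall n, (k < n)%N -> c * n%:R < g n x}.
Proof.
(* The intermediate threshold leaves room on both sides: a null [slowlt c1] gives the claim for [c],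
   and a full one would give L <= c1 by [subadditive_mean_le]. *)
move=> cL; pose c1 := (c + L) / 2.
have [cc1 c1L] : c < c1 /\ c1 < L by rewrite /c1; split; lra.
have [h0|h1] := ergodic (mslowlt c1) (slowlt_inv c1).
  exists (slowlt c1); split=> // x /= hx; exists (c1 - c); first by rewrite subr_gt0.
  rewrite opprB addrC subrK => k.
  apply: contrapT => h; apply: hx; exists k => n kn; rewrite ltNge; apply/negP => h2.
  by apply: h; exists n.
suff : L <= c1 by rewrite leNgt c1L.
apply: (@subadditive_mean_le c1 L _ hL).
exists (~` slowlt c1); split; first exact: measurableC.
  by rewrite probability_setC// h1 subee.
move=> x /= hx [e e0 h]; apply: hx.
have [n [n0 hn]] := h 0%N; exists n; split=> //.
by rewrite (le_trans hn)// ler_wpM2r// gerBl ltW.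
Qed.

End subadditive.

Hypothesis ergodic : forall A, measurable A -> f @^-1` A = A ->
  mu A = 0%E \/ mu A = 1%E.

Definition birkhoff_sum phi n x : R := \sum_(i <- iota 0 n) phi (iter i f x).

Lemma birkhoff_sumSr phi n x :
  birkhoff_sum phi n.+1 x = birkhoff_sum phi n x + phi (iter n f x).
Proof. by rewrite /birkhoff_sum -addn1 iotaD big_cat /= big_seq1. Qed.

Lemma birkhoff_sumSl phi n x :
  birkhoff_sum phi n.+1 x = phi x + birkhoff_sum phi n (f x).
Proof.
rewrite /birkhoff_sum /= big_cons /= -[1%N]addn0 iotaDl big_map; congr (_ + _).
by apply: eq_bigr => i _; rewrite add1n iterSr.
Qed.

Lemma birkhoff_sumD phi a b x : birkhoff_sum phi (a + b) x =
  birkhoff_sum phi a x + birkhoff_sum phi b (iter a f x).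
Proof.
elim: b => [|b ih]; first by rewrite addn0 /birkhoff_sum big_nil addr0.
by rewrite addnS !birkhoff_sumSr ih addrA -iterD addnC.
Qed.

(** Birkhoff sums are additive, so their negatives are subadditive and [subadditive_liminf_ge]
    applies to them. *)
Lemma birkhoff_le phi c : bm phi -> Ex phi < c ->
  {ae mu, forall x, exists k, forall n, (k < n)%N -> birkhoff_sum phi n x < c * n%:R}.
Proof.
move=> b hc; have [_ [K hK]] := b.
have bS n : bm (birkhoff_sum phi n).
  by apply: bm_sum => i; apply: (bm_comp (measurable_iter i)).
have := @subadditive_liminf_ge (fun n x => - birkhoff_sum phi n x) K _ _ _ ergodic
   _ (- Ex phi) _ (- c).
move=> h; suff : {ae mu, forall x, exists k, forall n, (k < n)%N ->
    - c * n%:R < - birkhoff_sum phi n x}.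
  by apply: filterS => x [k hk]; exists k => n /hk; rewrite mulNr ltrN2.
apply: h.
- by move=> n; exact: bmN.
- move=> n x; rewrite normrN (le_trans (ler_norm_sum _ _ _))//.
  rewrite mulr_natr -[n in _ *+ n](size_iota 0) -sumr_const_seq.
  by apply: ler_sum.
- by move=> x y z; rewrite birkhoff_sumD opprD.
- by move=> n x; rewrite birkhoff_sumSl opprD addrK normrN.
- move=> n; rewrite ExN// Ex_sum//; last first.
    by move=> i; apply: (bm_comp (measurable_iter i)).
  rewrite (eq_bigr (fun=> Ex phi)); last by move=> i _; exact: (@Ex_iter phi i).
  by rewrite sumr_const_seq size_iota mulr_natr mulNrn.
- by rewrite ltrN2.
Qed.

(** Only the upper bound is new. It compares [g n] with the Birkhoff sum of [g m] along all times,
    not along multiples of [m]; thus ergodicity of [f] suffices and that of its powers does not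
    enter. *)
Lemma kingman (g : nat -> T -> R) (C L : R) :
  (forall n, bm (g n)) ->
  (forall n x, `|g n x| <= C * n%:R) ->
  (forall a b x, g (a + b)%N x <= g a x + g b (iter a f x)) ->
  (forall n x, `|g n.+1 x - g n (f x)| <= C) ->
  (forall n x, g n x <= g n.+1 x + C) ->
  (forall n, L * n%:R <= Ex (g n)) ->
  (forall e, 0 < e -> exists2 m, (0 < m)%N & Ex (g m) <= (L + e) * m%:R) ->
  {ae mu, forall x, (fun n => n%:R^-1 * g n x) @ \oo --> L}.
Proof.
move=> bg gC gsub gS gS' hL hm.
have C0 : 0 <= C.
  by have x : T := point; rewrite -[C]mulr1 (le_trans _ (gC 1 x)).
have lower (q : nat) : {ae mu, forall x, exists k, forall n, (k < n)%N ->
    (L - q.+1%:R^-1) * n%:R < g n x}.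
  apply: (@subadditive_liminf_ge g C bg gC gsub ergodic gS L hL).
  by rewrite ltrBlDr ltrDl.
have upper (q : nat) : {ae mu, forall x, exists k, forall n, (k < n)%N ->
    g n x < (L + q.+1%:R^-1) * n%:R}.
  (* One third for the choice of [m], one for the Birkhoff average, one for the boundary terms. *)
  have e0 : 0 < (q.+1%:R^-1 : R) / 3 by rewrite divr_gt0.
  set e := _ / 3 in e0; have [m m0 hgm] := hm e e0.
  have m1 : 1 <= m%:R :> R by rewrite ler1n.
  have : Ex (g m) < (L + e + e) * m%:R.
    by rewrite (le_lt_trans hgm)// ltr_pM2r ?(lt_le_trans _ m1)// ltrDl.
  move=> /(birkhoff_le (bg m)); apply: filterS => x [k hk].
  have [K hK] : exists K : nat, forall n, (K < n)%N -> C * m%:R * 2 < e * n%:R.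
    exists (Num.truncn (C * m%:R * 2 / e)).+1 => n hn.
    have := truncnS_gt (C * m%:R * 2 / e); rewrite ltr_pdivrMr// => h.
    apply: (lt_le_trans h); rewrite mulrC ler_pM2l//.
    by rewrite ler_nat ltnW.
  exists (maxn k K) => n; rewrite gtn_max => /andP[/hk kn /hK Kn].
  (* Sum over a sliding window. Moving it by one exchanges [g j] for [g (j + m)], hence adds at most
     the value of [g m] at time [j]. *)
  pose Tm n := \sum_(r <- iota 0 m) g (n + r)%N x.
  have T0 : Tm 0%N <= C * m%:R * m%:R.
    rewrite /Tm mulr_natr -[m in _ *+ m](size_iota 0) -sumr_const_seq.
    rewrite big_seq [leRHS]big_seq; apply: ler_sum => r; rewrite mem_iota add0n.
    move=> /andP[_ rm]; rewrite (le_trans (ler_norm _))// (le_trans (gC _ _))//.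
    by rewrite add0n ler_wpM2l// ler_nat ltnW.
  have TS j : Tm j.+1 <= Tm j + g m (iter j f x).
    have e1 : Tm j.+1 + g j x = Tm j + g (j + m)%N x.
      rewrite /Tm addrC; transitivity (\sum_(r <- iota 0 m.+1) g (j + r)%N x).
        rewrite /= big_cons addn0 -[1%N]addn0 iotaDl big_map; congr (_ + _).
        by apply: eq_bigr => i _; rewrite add1n addnS.
      by rewrite -addn1 iotaD big_cat /= big_seq1.
    have := gsub j m x; lra.
  have TB j : Tm j <= Tm 0%N + birkhoff_sum (g m) j x.
    elim: j => [|j ih]; first by rewrite /birkhoff_sum big_nil addr0.
    by rewrite birkhoff_sumSr (le_trans (TS j))// addrA lerD2r.
  have gr r : g n x <= g (n + r)%N x + C * r%:R.
    elim: r => [|r ih]; first by rewrite addn0 mulr0 addr0.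
    by rewrite addnS -natr1 mulrDr mulr1; have := gS' (n + r)%N x; lra.
  have gT : m%:R * g n x <= Tm n + C * m%:R * m%:R.
    have -> : m%:R * g n x = \sum_(r <- iota 0 m) g n x.
      by rewrite sumr_const_seq size_iota mulr_natl.
    have -> : C * m%:R * m%:R = \sum_(r <- iota 0 m) C * m%:R.
      by rewrite sumr_const_seq size_iota mulr_natr.
    rewrite -big_split /= big_seq [leRHS]big_seq; apply: ler_sum => r.
    rewrite mem_iota add0n => /andP[_ rm]; rewrite (le_trans (gr r))// lerD2l.
    by rewrite ler_wpM2l// ler_nat ltnW.
  have h1 : m%:R * g n x < m%:R * ((L + q.+1%:R^-1) * n%:R).
    have -> : q.+1%:R^-1 = 3 * e by rewrite /e mulrC divfK.
    have : m%:R * (C * m%:R * 2) < m%:R * (e * n%:R).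
      by rewrite ltr_pM2l// (lt_le_trans _ m1).
    have := TB n; lra.
  by move: h1; rewrite ltr_pM2l// (lt_le_trans _ m1).
have [/ae_foralln lo /ae_foralln up] := (lower, upper).
move: lo up; apply: filterS2 => x lo up.
apply/cvgrPdist_lt => e e0.
pose q := Num.truncn e^-1.
have qe : q.+1%:R^-1 < e by rewrite invf_plt ?posrE//; exact: truncnS_gt.
have [k1 h1] := lo q; have [k2 h2] := up q.
exists (maxn k1 k2).+1 => // n /= hn.
have n0 : 0 < n%:R :> R by rewrite ltr0n (leq_trans _ hn).
have {}h1 : L - q.+1%:R^-1 < n%:R^-1 * g n x.
  by rewrite ltr_pdivlMl// mulrC h1// (leq_trans _ hn)// ltnS leq_maxl.
have {}h2 : n%:R^-1 * g n x < L + q.+1%:R^-1.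
  by rewrite ltr_pdivrMl// mulrC h2// (leq_trans _ hn)// ltnS leq_maxr.
rewrite ltr_distlC; apply/andP; split.
  by apply: lt_trans h1; rewrite ltrD2l ltrN2.
by apply: (lt_trans h2); rewrite ltrD2l.
Qed.

End ergodic.

(** * The Bernoulli shift *)

Section coordinates.
Variable m : nat.
Implicit Types (x y : shift_space m) (j n : int) (i : 'I_m.+1) (J : seq int).

Definition upd x j i : shift_space m := fun n => if n == j then i else x n.

Lemma updE x j i : upd x j i j = i.
Proof. by rewrite /upd eqxx. Qed.

Lemma upd_neq x j i n : n != j -> upd x j i n = x n.
Proof. by rewrite /upd => /negbTE ->. Qed.

Lemma upd_id x j : upd x j (x j) = x.
Proof. by apply/funext => n; rewrite /upd; case: eqP => [->|]. Qed.

Definition cyl J (a : int -> 'I_m.+1) : set (shift_space m) :=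
  [set x | forall j, j \in J -> x j = a j].

Lemma cyl_cons j J a : cyl (j :: J) a = [set x | x j = a j] `&` cyl J a.
Proof.
apply/seteqP; split=> x /= h.
  by split; [apply: h; rewrite mem_head|move=> k kJ; apply: h; rewrite in_cons kJ orbT].
by move=> k; rewrite in_cons => /predU1P[->|]; [case: h|case: h => _; apply].
Qed.

Lemma measurable_coord j i : measurable ([set x | x j = i] : set (shift_space m)).
Proof. by apply: sub_sigma_algebra; exists j, i. Qed.

Lemma measurable_cyl J a : measurable (cyl J a).
Proof.
elim: J => [|j J ih]; last by rewrite cyl_cons; apply: measurableI => //; exact: measurable_coord.
by rewrite (_ : cyl [::] a = setT)//; apply/seteqP; split.
Qed.

Lemma measurable_to_shift (f : shift_space m -> shift_space m) :
  (forall j i, measurable [set x | f x j = i]) -> measurable_fun setT f.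
Proof.
move=> h; apply: (@measurability _ _ _ _ setT f (@one_cylinders m)) => //.
by move=> _ [_ [j [i ->]] <-]; rewrite setTI; exact: h.
Qed.

Lemma measurable_shift : measurable_fun setT (@shift m).
Proof. by apply: measurable_to_shift => j i; exact: (measurable_coord (j + 1)). Qed.

Lemma measurable_upd j i : measurable_fun setT (fun x => upd x j i).
Proof.
apply: measurable_to_shift => k i'; have [->|kj] := eqVneq k j.
  under eq_fun do rewrite updE.
  have [->|ne] := eqVneq i i'.
    by rewrite (_ : [set _ | _] = setT)//; apply/seteqP; split.
  rewrite (_ : [set _ | _] = set0)//; apply/seteqP; split=> // x /= e.
  by rewrite e eqxx in ne.
by under eq_fun do rewrite upd_neq//; exact: measurable_coord.
Qed.

(** The cylinders and the empty set form a family stable under intersection that generates the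
    sigma-algebra. *)
Lemma measure_eq_cyl (R : realType) (m1 m2 : {measure set (shift_space m) -> \bar R}) :
  (forall J a, uniq J -> m1 (cyl J a) = m2 (cyl J a)) -> (m1 setT < +oo)%E ->
  forall A, measurable A -> m1 A = m2 A.
Proof.
move=> h h1.
pose G : set (set (shift_space m)) :=
  [set C | C = set0 \/ exists J a, uniq J /\ C = cyl J a].
have cyl0 a : cyl [::] a = setT by apply/seteqP; split.
apply: (@measure_unique _ _ _ G (fun=> setT)) => //.
- apply/seteqP; split.
    apply: smallest_sub; first exact: smallest_sigma_algebra.
    move=> _ [j [i ->]]; apply: sub_sigma_algebra; right; exists [:: j], (fun=> i).
    split=> //; apply/seteqP; split=> x /=.
      by move=> xj k; rewrite inE => /eqP ->.
    by apply; rewrite inE.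
  apply: smallest_sub; first exact: sigma_algebra_measurable.
  by move=> _ [->|[J [a [_ ->]]]]; [exact: measurable0|exact: measurable_cyl].
- move=> A B [->|[J [a [uJ ->]]]]; first by rewrite set0I; left.
  case=> [->|[J' [a' [uJ' ->]]]]; first by rewrite setI0; left.
  (* A common point serves as the pattern of the intersection, so that [a] and [a'] need not be
     merged by cases. *)
  have [[x [xJ xJ']]|nx] := pselect (exists x, cyl J a x /\ cyl J' a' x); last first.
    by left; apply/seteqP; split=> // x hx; apply: nx; exists x.
  right; exists (undup (J ++ J')), x; split; first exact: undup_uniq.
  apply/seteqP; split=> y /= hy.
    case: hy => h2 h3 j; rewrite mem_undup mem_cat => /orP[jJ|jJ'].
      by rewrite h2// xJ.
    by rewrite h3// xJ'.
  split=> j hj; rewrite hy ?mem_undup ?mem_cat ?hj ?orbT//; first exact: xJ.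
  exact: xJ'.
- by move=> i; right; exists [::], (fun=> ord0); rewrite cyl0.
- by apply/seteqP; split=> // x _; exists 0%N.
- by move=> A [->|[J [a [uJ ->]]]]; [rewrite !measure0|exact: h].
Qed.

Definition determined J (C : set (shift_space m)) :=
  forall x y, (forall j, j \in J -> x j = y j) -> C x -> C y.

Lemma determined_upd j J C i : determined (j :: J) C ->
  determined J [set x | C (upd x j i)].
Proof.
move=> h x y xy; apply: h => k; rewrite in_cons /upd; case: eqP => //= _ kJ.
exact: xy.
Qed.

(** Split according to the letter at one place of [J]; each piece is fixed by the remaining
    places. *)
Lemma measurable_determined J C : determined J C -> measurable C.
Proof.
elim: J C => [|j J ih] C h.
  have [[x Cx]|nC] := pselect (exists x, C x).
    rewrite (_ : C = setT)//; apply/seteqP; split=> // y _.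
    by apply: (h x).
  by rewrite (_ : C = set0)//; apply/seteqP; split=> // y Cy; apply: nC; exists y.
have -> : C = \bigcup_(i in [set: 'I_m.+1]) ([set x | x j = i] `&` [set x | C (upd x j i)]).
  apply/seteqP; split=> x /=.
    by move=> Cx; exists (x j) => //; split=> //=; rewrite upd_id.
  by move=> [i _ [/= <-]]; rewrite upd_id.
apply: fin_bigcup_measurable => // i _; apply: measurableI; first exact: measurable_coord.
by apply: ih; exact: determined_upd h.
Qed.

Definition window (M : nat) : seq int :=
  [seq Posz k | k <- iota 0 M] ++ [seq - Posz k | k <- iota 0 M].

Lemma mem_window M j : (absz j < M)%N -> j \in window M.
Proof.
move=> h; rewrite mem_cat; case: j h => k h.
  by rewrite map_f// mem_iota.
by apply/orP; right; apply/mapP; exists k.+1; rewrite ?mem_iota ?NegzE.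
Qed.

Definition truncate (M : nat) x : shift_space m :=
  fun n => if (absz n < M)%N then x n else ord0.

Definition ucont (R : realType) (phi : shift_space m -> R) :=
  forall e, 0 < e -> exists M, forall x y, agree x y M -> `|phi x - phi y| <= e.

(** Pointwise limit of functions of finitely many letters, obtained by overwriting the letters
    outside a window. *)
Lemma ucont_measurable (R : realType) (phi : shift_space m -> R) :
  ucont phi -> measurable_fun setT phi.
Proof.
move=> uc; apply: (@measurable_fun_cvg _ _ _ _ (fun k x => phi (truncate k x))).
  move=> k _ Y mY; rewrite setTI; apply: (@measurable_determined (window k)) => x y xy /=.
  suff -> : truncate k x = truncate k y by [].
  apply/funext => n; rewrite /truncate; case: ifP => // h.
  by apply: xy; exact: mem_window.
move=> x _; apply/cvgrPdist_le => e /uc[M hM]; exists M => // k /= Mk.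
apply: hM => n h; rewrite /truncate ifT//; exact: leq_trans Mk.
Qed.

End coordinates.

(** * Invariance, resampling of letters, independence and ergodicity of the Bernoulli measure *)

Section bernoulli.
Variables (R : realType) (m : nat) (p : 'I_m.+1 -> R).
Variable mu : probability (shift_space m) R.
Hypotheses (hp : positive_probability_vector p) (hmu : is_bernoulli p mu).

Local Notation Ex := (Ex mu).

Let p_gt0 i : 0 < p i. Proof. by case: hp => + _; exact. Qed.
Let p_sum : \sum_i p i = 1. Proof. by case: hp. Qed.

Let mu_cyl J a : uniq J -> mu (cyl J a) = (\prod_(j <- J) p (a j))%:E.
Proof. exact: hmu. Qed.

Lemma bernoulli_shift A : measurable A -> mu (@shift m @^-1` A) = mu A.
Proof.
move=> mA; pose m1 := measure_function_pushforward__canonical__measure_function_Measure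
   mu (@measurable_shift m).
rewrite -[LHS]/(m1 A); apply: measure_eq_cyl => //; last first.
  by rewrite /m1 /= /pushforward preimage_setT -ge0_fin_numE// fin_num_measure.
move=> J a uJ; rewrite /m1 /= /pushforward (mu_cyl a uJ).
have -> : @shift m @^-1` cyl J a = [set x | forall j, j \in [seq k + 1 | k <- J] ->
    x j = a (j - 1)].
  apply/seteqP; split=> x /= h j.
    by move=> /mapP[k kJ ->]; rewrite addrK -(h k kJ).
  by move=> jJ; rewrite /shift h ?addrK//; apply/mapP; exists j.
rewrite [LHS]hmu; last by rewrite map_inj_uniq//; exact: addIr.
by rewrite big_map; congr (_%:E); apply: eq_bigr => j _; rewrite addrK.
Qed.

(** Redrawing the letter at [j] defines a mixture of image measures of [mu]; it agrees with [mu] on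
    cylinders, by cases on whether [j] is constrained. *)
Lemma bernoulli_resample_set j A : measurable A ->
  mu A = (\sum_(k < m.+1) (p k)%:E * mu [set x | A (upd x j k)])%E.
Proof.
move=> mA.
pose m_ k := mscale (NngNum (ltW (p_gt0 (inord k))))
  (measure_function_pushforward__canonical__measure_function_Measure
   mu (@measurable_upd m j (inord k))).
pose m2 : {measure set (shift_space m) -> \bar R} := msum m_ m.+1.
have m2E B : m2 B = (\sum_(k < m.+1) (p k)%:E * mu [set x | B (upd x j k)])%E.
  by apply: eq_bigr => k _; rewrite /m_ /mscale /= inord_val.
rewrite -m2E; apply: (@measure_eq_cyl _ _ mu m2) => //; last first.
  by rewrite -ge0_fin_numE// fin_num_measure.
move=> J a uJ; rewrite m2E [LHS](mu_cyl a uJ).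
have [jJ|jJ] := boolP (j \in J); last first.
  rewrite (eq_bigr (fun k => (p k * \prod_(i <- J) p (a i))%:E)).
    by rewrite sumEFin -mulr_suml p_sum mul1r.
  move=> k _; rewrite EFinM -(mu_cyl a uJ); congr (_ * mu _)%E.
  apply/seteqP; split=> x /= h i iJ; have := h i iJ; rewrite upd_neq//;
    by apply: contraNneq jJ => <-.
rewrite [RHS](bigD1 (a j))//= [X in (_ + X)%E]big1 ?adde0; last first.
  move=> k ka; rewrite (_ : [set _ | _] = set0) ?measure0 ?mule0//.
  apply/seteqP; split=> // x /= /(_ j jJ); rewrite updE => e.
  by rewrite e eqxx in ka.
rewrite (_ : [set _ | _] = cyl (rem j J) a).
  rewrite mu_cyl; last exact: rem_uniq.
  by rewrite -EFinM (perm_big _ (perm_to_rem jJ)) big_cons.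
apply/seteqP; split=> x /= h i.
  rewrite mem_rem_uniq// inE => /andP[ij iJ].
  by rewrite -(h i iJ) upd_neq.
move=> iJ; have [->|ij] := eqVneq i j; first by rewrite updE.
by rewrite upd_neq// h// mem_rem_uniq// inE ij.
Qed.

Lemma bernoulli_resample j phi : bm phi ->
  Ex phi = Ex (fun x => \sum_i p i * phi (upd x j i)).
Proof.
move=> b; have bu i : bm (fun x => phi (upd x j i)).
  exact: (bm_comp (@measurable_upd m j i)).
rewrite Ex_sum; last by move=> i; exact: bmZ.
under eq_bigr do rewrite ExZ//.
have [_ [C hC]] := b.
(* Adding the bound makes the function nonnegative, as needed for integration against a sum of
   measures; the constant cancels because the weights add up to 1. *)
pose psi x := phi x + C.
have psi0 x : 0 <= psi x.
  by rewrite /psi; have := hC x; rewrite ler_norml => /andP[]; lra.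
have bpsi : bm psi by apply: bmD => //; exact: bm_cst.
suff : Ex psi = \sum_i p i * Ex (fun x => psi (upd x j i)).
  rewrite /psi ExD ?Ex_cst//; last exact: bm_cst.
  have hs i : Ex (fun x => phi (upd x j i) + C) = Ex (fun x => phi (upd x j i)) + C.
    by rewrite (ExD mu (bu i) (bm_cst _ C)) Ex_cst.
  rewrite (eq_bigr (fun i => p i * Ex (fun x => phi (upd x j i)) + p i * C)); last first.
    by move=> i _; rewrite -mulrDr; congr (_ * _); exact: hs.
  by rewrite big_split /= -mulr_suml p_sum mul1r => /addIr.
have bupsi i : bm (fun x => psi (upd x j i)).
  exact: (bm_comp (@measurable_upd m j i)).
pose m_ k := mscale (NngNum (ltW (p_gt0 (inord k))))
  (measure_function_pushforward__canonical__measure_function_Measure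
   mu (@measurable_upd m j (inord k))).
have mpsi : measurable_fun setT (EFin \o psi) by apply/measurable_EFinP; case: bpsi.
apply: EFin_inj; rewrite -sumEFin /Ex /Rintegral fineK; last first.
  exact: integrable_fin_num (bm_integrable mu bpsi).
have -> : (\int[mu]_x (psi x)%:E = \int[msum m_ m.+1]_x (psi x)%:E)%E.
  apply: eq_measure_integral => A mA _.
  rewrite [LHS](bernoulli_resample_set j mA); apply: eq_bigr => k _.
  by rewrite /m_ /mscale /= inord_val.
rewrite ge0_integral_measure_sum//; last by move=> x _; rewrite lee_fin.
apply: eq_bigr => k _.
rewrite ge0_integral_mscale//; last by move=> x _; rewrite lee_fin.
rewrite ge0_integral_pushforward//; last by move=> x _; rewrite lee_fin.
rewrite preimage_setT inord_val EFinM fineK//.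
  exact: integrable_fin_num (bm_integrable mu (bupsi k)).
exact: measurable_upd.
Qed.

Let Pr A := fine (mu A).

Let Pr_le A B : measurable A -> measurable B -> A `<=` B -> Pr A <= Pr B.
Proof.
move=> mA mB AB; rewrite /Pr fine_le ?fin_num_measure//.
by apply: le_measure => //; rewrite inE.
Qed.

Let PrU A B : measurable A -> measurable B -> Pr (A `|` B) <= Pr A + Pr B.
Proof.
move=> mA mB; rewrite /Pr -fineD ?fin_num_measure// fine_le ?fin_num_measure//.
- by apply: measurableU.
- by rewrite fin_numD !fin_num_measure.
- exact: measureU2.
Qed.

(** Resample the letters of [J] one after another: each resampling removes one place from [C] and
    leaves [D] unchanged. *)
Lemma determined_independent J C D : determined J C -> measurable D ->
  (forall j i x, j \in J -> D (upd x j i) = D x) -> Pr (C `&` D) = Pr C * Pr D.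
Proof.
elim: J C => [|j J ih] C hC mD hD.
  have [[x Cx]|nC] := pselect (exists x, C x).
    rewrite (_ : C = setT) ?setTI; last first.
      by apply/seteqP; split=> // y _; apply: (hC x).
    by rewrite {2}/Pr [X in fine X * _](@probability_setT _ _ _ mu) mul1r.
  rewrite (_ : C = set0) ?set0I; last by apply/seteqP; split=> // y Cy; apply: nC; exists y.
  by rewrite /Pr measure0 mul0r.
have mC := measurable_determined hC.
have PrR A : measurable A -> Pr A = \sum_k p k * Pr [set x | A (upd x j k)].
  move=> mA; rewrite {1}/Pr (bernoulli_resample_set j mA).
  rewrite -sum_fine; last first.
    move=> k _; rewrite fin_numM// fin_num_measure//.
    by rewrite -[X in measurable X]setTI; exact: (@measurable_upd m j k).
  apply: eq_bigr => k _; rewrite fineM// fin_num_measure//.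
  by rewrite -[X in measurable X]setTI; exact: (@measurable_upd m j k).
rewrite (PrR _ (measurableI _ _ mC mD)) (PrR _ mC) mulr_suml.
apply: eq_bigr => k _; rewrite -mulrA; congr (_ * _).
rewrite -(ih [set x | C (upd x j k)])//.
- congr Pr; apply/seteqP; split=> x /= [h1 h2]; split=> //.
    by rewrite hD ?mem_head in h2.
  by rewrite hD ?mem_head.
- exact: determined_upd.
- by move=> j' i x j'J; apply: hD; rewrite in_cons j'J orbT.
Qed.

Let approximable A := measurable A /\
  forall e, 0 < e -> exists J C, determined J C /\ Pr (A `+` C) < e.

Let measurableY (A B : set (shift_space m)) : measurable A -> measurable B -> measurable (A `+` B).
Proof. by move=> mA mB; rewrite setY_def; apply: measurableU; exact: measurableD. Qed.

(** The approximable sets form a sigma-algebra containing the one-letter cylinders. *)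
Let approximable_all A : measurable A -> approximable A.
Proof.
have ap0 : approximable set0.
  split=> // e e0; exists [::], set0; split=> //.
  by rewrite setYK /Pr measure0.
have apC B : approximable B -> approximable (~` B).
  move=> [mB h]; split; first exact: measurableC.
  move=> e /h[J [C [dC hC]]]; exists J, (~` C); split.
    by move=> x y xy nC Cy; apply: nC; apply: dC Cy => j jJ; rewrite xy.
  by rewrite (_ : _ `+` _ = B `+` C)// !setY_def; apply/seteqP; split=> x /=;
    have [?|?] := pselect (B x); have [?|?] := pselect (C x); tauto.
have apU B B' : approximable B -> approximable B' -> approximable (B `|` B').
  move=> [mB h] [mB' h']; split; first exact: measurableU.
  move=> e e0; have e2 : 0 < e / 2 by rewrite divr_gt0.
  have [[J [C [dC hC]]] [J' [C' [dC' hC']]]] := (h _ e2, h' _ e2).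
  have mC := measurable_determined dC; have mC' := measurable_determined dC'.
  exists (J ++ J'), (C `|` C'); split.
    move=> x y xy [Cx|Cx]; [left; apply: dC Cx|right; apply: dC' Cx] => j jJ;
    by apply: xy; rewrite mem_cat jJ ?orbT.
  apply: (@le_lt_trans _ _ (Pr ((B `+` C) `|` (B' `+` C')))).
    apply: Pr_le.
    - by apply: measurableY; exact: measurableU.
    - by apply: measurableU; exact: measurableY.
    - by rewrite !setY_def => x /=; tauto.
  apply: (le_lt_trans (PrU (measurableY mB mC) (measurableY mB' mC'))).
  by rewrite [e]splitr ltrD.
have apI (B : nat -> set (shift_space m)) : (forall n, approximable (B n)) -> approximable (\bigcup_n B n).
  move=> hB; have mB n : measurable (B n) by case: (hB n).
  have mU : measurable (\bigcup_n B n) by exact: bigcupT_measurable.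
  split=> // e e0; have e2 : 0 < e / 2 by rewrite divr_gt0.
  pose S n := \big[setU/set0]_(i < n.+1) B i.
  have apS n : approximable (S n).
    rewrite /S; elim: n => [|n ih]; rewrite big_ord_recr; apply: apU => //.
    by rewrite big_ord0.
  have mS n : measurable (S n) by case: (apS n).
  have h : fine \o (mu \o S) @ \oo --> fine (mu (\bigcup_n B n)).
    have : mu \o S @ \oo --> mu (\bigcup_n S n).
      apply: nondecreasing_cvg_mu => //; first exact: bigcupT_measurable.
      by move=> i j ij; apply/subsetPset; exact: subset_bigsetU.
    rewrite bigcup_bigsetU_bigcup => h; apply: fine_cvg.
    by rewrite fineK// fin_num_measure.
  have /cvgrPdist_lt /(_ _ e2) [N _ /(_ N (leqnn N)) /= hN] := h.
  have [_ /(_ _ e2) [J [C [dC hC]]]] := apS N.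
  have mC := measurable_determined dC.
  exists J, C; split=> //.
  have SU : S N `<=` \bigcup_n B n by exact: bigsetU_bigcup.
  apply: (@le_lt_trans _ _ (Pr ((\bigcup_n B n `\` S N) `|` (S N `+` C)))).
    apply: Pr_le.
    - exact: measurableY.
    - by apply: measurableU; [exact: measurableD|exact: measurableY].
    - by rewrite !setY_def => x /=; have := SU x; have [?|?] := pselect (S N x); tauto.
  apply: (le_lt_trans (PrU (measurableD mU (mS N)) (measurableY (mS N) mC))).
  rewrite [e]splitr ltrD// /Pr measureD// ?(setIidr SU).
    rewrite fineB ?fin_num_measure//; apply: le_lt_trans hN.
    exact: ler_norm.
  by rewrite -ge0_fin_numE// fin_num_measure.
apply: smallest_sub; last first.
  move=> _ [j [i ->]]; split; first exact: measurable_coord.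
  move=> e e0; exists [:: j], [set x | x j = i]; split.
    by move=> x y xy /= <-; rewrite xy ?inE.
  by rewrite setYK /Pr measure0.
by split=> // B; rewrite setTD; exact: apC.
Qed.

Lemma iter_shift k (x : shift_space m) (n : int) :
  iter k (@shift m) x n = x (n + k%:Z).
Proof.
elim: k n => [|k ih] n; first by rewrite addr0.
by rewrite iterS /shift ih; congr x; lia.
Qed.

(** An invariant set is close both to a set [C] of finitely many letters and to a far translate of
    [C], which is independent of [C]. Hence Pr A is close to its own square. *)
Lemma bernoulli_ergodic A : measurable A -> @shift m @^-1` A = A ->
  mu A = 0%E \/ mu A = 1%E.
Proof.
move=> mA invA.
have ms k : measurable_fun setT (iter k (@shift m)).
  exact: measurable_iter (@measurable_shift m) _.
have Prk k B : measurable B -> Pr (iter k (@shift m) @^-1` B) = Pr B.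
  elim: k B => [//|k ih] B mB.
  have -> : iter k.+1 (@shift m) @^-1` B = iter k (@shift m) @^-1` (@shift m @^-1` B) by [].
  rewrite ih; first by rewrite /Pr bernoulli_shift.
  by rewrite -[X in measurable X]setTI; exact: measurable_shift.
have invk k : iter k (@shift m) @^-1` A = A.
  elim: k => [//|k ih].
  have -> : iter k.+1 (@shift m) @^-1` A = iter k (@shift m) @^-1` (@shift m @^-1` A) by [].
  by rewrite invA.
have PA01 : 0 <= Pr A <= 1.
  rewrite fine_ge0//= -[X in _ <= X]/(fine (1%E : \bar R)) fine_le ?fin_num_measure//.
  exact: probability_le1.
(* An error 2e from replacing Pr A by the square of Pr C, and another 2e from replacing that square
   by the square of Pr A. *)
suff h e : 0 < e -> `|Pr A - Pr A ^+ 2| <= 4 * e.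
  have h0 : Pr A - Pr A ^+ 2 = 0.
    apply/eqP; rewrite -normr_eq0; apply/eqP/le_anti; rewrite normr_ge0 andbT.
    apply/ler_addgt0Pl => e e0; rewrite addr0.
    have := h (e / 4); rewrite divr_gt0// => /(_ isT); lra.
  have : Pr A * (1 - Pr A) = 0 by rewrite mulrBr mulr1 -expr2.
  move=> /eqP; rewrite mulf_eq0 subr_eq0 => /orP[] /eqP hA; [left|right].
    by rewrite -[LHS]fineK ?fin_num_measure// -/(Pr A) hA.
  by rewrite -[LHS]fineK ?fin_num_measure// -/(Pr A) -hA.
move=> e0; have [_ /(_ e e0)[J [C [dC hC]]]] := approximable_all mA.
have mC := measurable_determined dC.
have [N JN] : exists N : nat, forall j k : int, j \in J -> k \in J -> k + N%:Z != j.
  exists (\sum_(j <- J) absz j).*2.+1 => j k jJ kJ; have le i : i \in J -> (absz i <= \sum_(j <- J) absz j)%N.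
    by move=> iJ; rewrite (big_rem i)//= leq_addr.
  have := le j jJ; have := le k kJ; lia.
pose D := iter N (@shift m) @^-1` C.
have mD : measurable D by rewrite -[X in measurable X]setTI; exact: ms.
have PD : Pr D = Pr C by exact: Prk.
have PCD : Pr (C `&` D) = Pr C ^+ 2.
  rewrite (determined_independent dC)// ?PD ?expr2// => j i x jJ.
  rewrite /D /=; apply/propext; split; apply: dC => k kJ; have kj := JN j k jJ kJ.
    by rewrite [LHS]iter_shift [RHS]iter_shift /upd (negbTE kj).
  by rewrite [LHS]iter_shift [RHS]iter_shift /upd (negbTE kj).
have hD : Pr (A `+` D) < e.
  rewrite (_ : A `+` D = iter N (@shift m) @^-1` (A `+` C)) ?Prk//; first exact: measurableY.
  by rewrite -[A in LHS](invk N) !setY_def.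
have clo B : measurable B -> `|Pr A - Pr B| <= Pr (A `+` B).
  move=> mB; have mY := measurableY mA mB.
  have h1 : Pr A <= Pr B + Pr (A `+` B).
    rewrite (le_trans _ (PrU _ _))//; apply: Pr_le => //; first exact: measurableU.
    by rewrite setY_def => x /=; have [?|?] := pselect (A x); have [?|?] := pselect (B x); tauto.
  have h2 : Pr B <= Pr A + Pr (A `+` B).
    rewrite (le_trans _ (PrU _ _))//; apply: Pr_le => //; first exact: measurableU.
    by rewrite setY_def => x /=; have [?|?] := pselect (A x); have [?|?] := pselect (B x); tauto.
  by rewrite ler_norml; apply/andP; split; lra.
have h1 : `|Pr A - Pr C| <= e by rewrite (le_trans (clo _ mC))// ltW.
have h2 : `|Pr A - Pr C ^+ 2| <= e + e.
  rewrite -PCD (le_trans (clo _ (measurableI _ _ mC mD)))//.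
  apply: (@le_trans _ _ (Pr ((A `+` C) `|` (A `+` D)))).
    apply: Pr_le.
    - by apply: measurableY => //; exact: measurableI.
    - by apply: measurableU; exact: measurableY.
    - by rewrite !setY_def => x /=; have [?|?] := pselect (C x); tauto.
  by apply: (le_trans (PrU (measurableY mA mC) (measurableY mA mD))); rewrite lerD// ltW.
have PC01 : 0 <= Pr C <= 1.
  rewrite fine_ge0//= -[X in _ <= X]/(fine (1%E : \bar R)) fine_le ?fin_num_measure//.
  exact: probability_le1.
move: h1 h2 PC01 PA01; rewrite !ler_norml => /andP[h1 h1'] /andP[h2 h2'] /andP[c0 c1] /andP[a0 a1].
by apply/andP; split; nra.
Qed.

End bernoulli.

(** * Cocycles over the shift *)

Section shift_metric.
Variables (R : realType) (m : nat) (rho alpha : R).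
Hypotheses (hrho : 0 < rho < 1) (halpha : 0 < alpha).
Implicit Types x y : shift_space m.

Let rho_ge0 : 0 <= rho. Proof. by case/andP: hrho => /ltW. Qed.
Let rho_le1 : rho <= 1. Proof. by case/andP: hrho => _ /ltW. Qed.

Lemma agreement_ge x y M : x <> y -> agree x y M -> (M <= agreement x y)%N.
Proof.
move=> xy xyM; rewrite /agreement; case: xgetP => [N _ [_ h]|h]; first exact: h.
(* The default branch of [xget]: it cannot occur, since a place where the points differ bounds all
   lengths of agreement, so that a maximum exists. *)
exfalso; have [n hn] : exists n : int, x n != y n.
  apply: contrapT => hn; apply: xy; apply/funext => n.
  by apply/eqP; apply: contrapT => /negP e; apply: hn; exists n.
have bnd N : agree x y N -> (N <= absz n)%N.
  by move=> hN; rewrite leqNgt; apply: contra hn => /hN ->.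
have exP : exists N, `[< agree x y N >] by exists M; apply/asboolP.
have ubP N : `[< agree x y N >] -> (N <= absz n)%N by move=> /asboolP; exact: bnd.
have [N /asboolP hN1 hN2] := ex_maxnP exP ubP.
by apply: (h N); split=> // N' hN'; apply: hN2; apply/asboolP.
Qed.

Lemma shift_dist_agree x y M : agree x y M -> shift_dist rho x y <= rho ^+ M.
Proof.
move=> xyM; rewrite /shift_dist; case: asboolP => xy; first by rewrite exprn_ge0.
by rewrite ler_wiXn2l// agreement_ge.
Qed.

Lemma shift_dist_ge0 x y : 0 <= shift_dist rho x y.
Proof. by rewrite /shift_dist; case: asboolP => // _; rewrite exprn_ge0. Qed.

Lemma holder_bound_agree (F : shift_space m -> 'M[R]_2) C x y M :
  holder_bound rho alpha F C -> agree x y M ->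
  opnorm (F x - F y) <= C * (rho `^ alpha) ^+ M.
Proof.
move=> [C0 h] xyM; apply: (le_trans (h x y)); rewrite ler_wpM2l//.
rewrite -powR_mulrn ?powR_ge0// -powRrM mulrC powRrM.
rewrite ge0_ler_powR ?nnegrE ?powR_ge0 ?shift_dist_ge0//; first exact: ltW.
by rewrite powR_mulrn// shift_dist_agree.
Qed.

Lemma ratio_gt0 : 0 < rho `^ alpha.
Proof. by rewrite powR_gt0//; case/andP: hrho. Qed.

Lemma ratio_lt1 : rho `^ alpha < 1.
Proof.
case/andP: hrho => r0 r1; rewrite [X in _ < X](_ : 1 = 1 `^ alpha); last by rewrite powR1.
by rewrite gt0_ltr_powR// ?nnegrE// ltW.
Qed.

End shift_metric.

Section cocycles.
Variables (R : realType) (m : nat).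
Local Notation X := (shift_space m).
Implicit Types (A B : X -> 'M[R]_2) (x y : X).

Lemma opnorm_mulB (P Q M N : 'M[R]_2) :
  opnorm (P *m M - Q *m N) <= opnorm (P - Q) * opnorm M + opnorm Q * opnorm (M - N).
Proof.
have -> : P *m M - Q *m N = (P - Q) *m M + Q *m (M - N).
  by rewrite mulmxBl mulmxBr addrA subrK.
by rewrite (le_trans (opnormD _ _))// lerD// opnormM.
Qed.

Lemma cocycleD A a b x :
  cocycle A (a + b) x = cocycle A b (iter a (@shift m) x) *m cocycle A a x.
Proof.
elim: b => [|b ih]; first by rewrite addn0 mul1mx.
by rewrite addnS /= ih mulmxA -iterD addnC.
Qed.

Lemma cocycle1 A x : cocycle A 1 x = A x.
Proof. by rewrite /= mulmx1. Qed.

Lemma det_cocycle A n x : (forall y, \det (A y) = 1) -> \det (cocycle A n x) = 1.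
Proof. by move=> h; elim: n => [|n ih] /=; rewrite ?det1// det_mulmx h ih mulr1. Qed.

Lemma opnorm_cocycle A C n x : 1 <= C -> (forall y, opnorm (A y) <= C) ->
  opnorm (cocycle A n x) <= C ^+ n.
Proof.
move=> C1 h; elim: n => [|n ih]; first by rewrite expr0 opnorm1_le.
by rewrite exprS /= (le_trans (opnormM _ _))// ler_pM ?opnorm_ge0.
Qed.

(** Factors are exchanged one at a time. Two cocycles and two base points are allowed, since the
    bound serves both for perturbation and for uniform continuity. *)
Lemma cocycle_close A B C e n x y : 1 <= C ->
  (forall z, opnorm (A z) <= C) -> (forall z, opnorm (B z) <= C) ->
  (forall i, (i < n)%N ->
    opnorm (A (iter i (@shift m) x) - B (iter i (@shift m) y)) <= e) ->
  opnorm (cocycle A n x - cocycle B n y) <= n%:R * C ^+ n * e.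
Proof.
move=> C1 hA hB; elim: n => [|n ih] h.
  by rewrite !mul0r subrr opnorm_le// => v; rewrite mul0mx mul0r enormE !mxE expr0n addr0 sqrtr0.
have e0 : 0 <= e by rewrite (le_trans _ (h 0%N _))// opnorm_ge0.
have C0 : 0 <= C by rewrite (le_trans ler01).
rewrite /= (le_trans (opnorm_mulB _ _ _ _))//.
have h1 : opnorm (A (iter n (@shift m) x) - B (iter n (@shift m) y)) *
    opnorm (cocycle A n x) <= e * C ^+ n.+1.
  rewrite ler_pM ?opnorm_ge0 ?h//.
  by rewrite (le_trans (opnorm_cocycle _ _ C1 hA))// ler_weXn2l.
have h2 : opnorm (B (iter n (@shift m) y)) * opnorm (cocycle A n x - cocycle B n y)
    <= C * (n%:R * C ^+ n * e).
  by rewrite ler_pM ?opnorm_ge0// ih// => i hi; rewrite h// ltnW.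
rewrite (le_trans (lerD h1 h2))// -natr1 exprS.
by rewrite le_eqVlt; apply/orP; left; apply/eqP; ring.
Qed.

Definition lognorm A n x : R := ln (opnorm (cocycle A n x)).

Section SL2_cocycle.
Variables (A : X -> 'M[R]_2) (C : R).
Hypotheses (dA : forall x, \det (A x) = 1) (C1 : 1 <= C).
Hypothesis AC : forall x, opnorm (A x) <= C.

Lemma lognorm_ge0 n x : 0 <= lognorm A n x.
Proof. by rewrite ln_opnorm_ge0// det_cocycle. Qed.

Lemma lognorm_le n x : lognorm A n x <= ln C * n%:R.
Proof.
rewrite mulr_natr -lnXn ?(lt_le_trans ltr01)// ler_ln ?posrE ?exprn_gt0 ?(lt_le_trans ltr01)//.
  exact: opnorm_cocycle.
by rewrite opnorm_ge1// det_cocycle.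
Qed.

Lemma lognorm_bound n x : `|lognorm A n x| <= ln C * n%:R.
Proof. by rewrite ger0_norm ?lognorm_ge0// lognorm_le. Qed.

Lemma lognormD a b x :
  lognorm A (a + b) x <= lognorm A a x + lognorm A b (iter a (@shift m) x).
Proof.
by rewrite /lognorm cocycleD addrC ln_opnormM// det_cocycle.
Qed.

Let lnA_le x : ln (opnorm (A x)) <= ln C.
Proof. by rewrite ler_ln ?posrE ?opnorm_gt0// (lt_le_trans ltr01). Qed.

Lemma lognorm_shift n x : `|lognorm A n.+1 x - lognorm A n (shift x)| <= ln C.
Proof.
have h1 : lognorm A n.+1 x <= ln C + lognorm A n (shift x).
  by have := lognormD 1 n x; rewrite add1n => /le_trans; apply; rewrite lerD2r /lognorm cocycle1.
have h2 : lognorm A n (shift x) <= lognorm A n.+1 x + ln C.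
  apply: (@le_trans _ _ (lognorm A n.+1 x + ln (opnorm (A x)))); last by rewrite lerD2l.
  have := cocycleD A 1 n x; rewrite add1n cocycle1 /lognorm /= => ->.
  have dc : \det (cocycle A n (shift x)) = 1 by exact: det_cocycle.
  rewrite -lnM ?posrE ?opnorm_gt0 ?det_mulmx ?dc ?dA ?mulr1//.
  rewrite ler_ln ?posrE ?mulr_gt0 ?opnorm_gt0 ?det_mulmx ?dc ?dA ?mulr1//.
  exact: opnorm_le_mulr.
by rewrite ler_norml; apply/andP; split; lra.
Qed.

Lemma lognorm_succ n x : lognorm A n x <= lognorm A n.+1 x + ln C.
Proof.
apply: (@le_trans _ _ (lognorm A n.+1 x + ln (opnorm (A (iter n (@shift m) x)))));
  last by rewrite lerD2l.
have dc : \det (cocycle A n x) = 1 by exact: det_cocycle.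
rewrite /lognorm /= -lnM ?posrE ?opnorm_gt0 ?det_mulmx ?dc ?dA ?mulr1//.
rewrite ler_ln ?posrE ?mulr_gt0 ?opnorm_gt0 ?det_mulmx ?dc ?dA ?mulr1//.
by rewrite mulrC opnorm_le_mull.
Qed.

Hypothesis Auc : forall e, 0 < e -> exists M, forall x y, agree x y M ->
  opnorm (A x - A y) <= e.

Lemma agree_iter x y i M : agree x y (i + M) ->
  agree (iter i (@shift m) x) (iter i (@shift m) y) M.
Proof. by move=> h k hk; rewrite !iter_shift; apply: h; lia. Qed.

Lemma agreeW x y M N : (M <= N)%N -> agree x y N -> agree x y M.
Proof. by move=> MN h k hk; apply: h; exact: leq_trans MN. Qed.

Lemma lognorm_ucont n : ucont (lognorm A n).
Proof.
move=> e e0; have C0 : 0 < C by rewrite (lt_le_trans ltr01).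
have K0 : 0 < n.+1%:R * C ^+ n by rewrite mulr_gt0// exprn_gt0.
have [M hM] := Auc (divr_gt0 e0 K0); exists (n + M)%N.
suff h x y : agree x y (n + M) -> lognorm A n x - lognorm A n y <= e.
  move=> x y xy; rewrite ler_norml lerNl opprB.
  apply/andP; split; last exact: h.
  by apply: h => k hk; rewrite xy.
move=> xy; rewrite /lognorm (le_trans (ln_opnorm_lip _ _)) ?det_cocycle//.
apply: (@le_trans _ _ (n%:R * C ^+ n * (e / (n.+1%:R * C ^+ n)))).
  apply: cocycle_close => // i hi; apply: hM; apply: agree_iter.
  by apply: agreeW xy; rewrite leq_add2r ltnW.
rewrite mulrA ler_pdivrMr// mulrC ler_wpM2l ?(ltW e0)// ler_wpM2r ?exprn_ge0 ?(ltW C0)//.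
by rewrite ler_nat.
Qed.

Lemma lognorm_bm n : bm (lognorm A n).
Proof.
split; first exact: ucont_measurable (lognorm_ucont n).
by exists (ln C * n%:R) => x; exact: lognorm_bound.
Qed.

End SL2_cocycle.

Section lyapunov.
Variables (p : 'I_m.+1 -> R) (mu : probability X R).
Hypotheses (hp : positive_probability_vector p) (hmu : is_bernoulli p mu).

Lemma is_lyapunov_unique A l1 l2 :
  is_lyapunov mu A l1 -> is_lyapunov mu A l2 -> l1 = l2.
Proof.
move=> h1 h2.
have pf : ProperFilter (almost_everywhere mu).
  by apply: ae_properfilter_algebraOfSetsType; rewrite [X in (_ < X)%E](@probability_setT _ _ _ mu) lte01.
have [x [c1 c2]] : exists x,
    (fun n => n%:R^-1 * ln (opnorm (cocycle A n x))) @ \oo --> l1 /\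
    (fun n => n%:R^-1 * ln (opnorm (cocycle A n x))) @ \oo --> l2.
  by apply: (@filter_ex _ _ pf); apply: filterI.
exact: (cvg_unique _ c1 c2).
Qed.

(** Identifies the almost everywhere limit chosen in [lambda_plus] with the infimum of the
    normalized means. All later arguments know the exponent through these two inequalities. *)
Lemma lambda_plusP A C : (forall x, \det (A x) = 1) -> 1 <= C ->
  (forall x, opnorm (A x) <= C) ->
  (forall e, 0 < e -> exists M, forall x y, agree x y M -> opnorm (A x - A y) <= e) ->
  (forall n, lambda_plus mu A * n%:R <= Ex mu (lognorm A n)) /\
  (forall e, 0 < e -> exists2 n, (0 < n)%N &
     Ex mu (lognorm A n) <= (lambda_plus mu A + e) * n%:R).
Proof.
move=> dA C1 AC Auc.
have bg n : bm (lognorm A n) by exact: (lognorm_bm dA C1 AC Auc).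
have Eg0 n : 0 <= Ex mu (lognorm A n) by apply: Rintegral_ge0 => x _; exact: lognorm_ge0.
pose S := [set n.+1%:R^-1 * Ex mu (lognorm A n.+1) | n in [set: nat]].
have S0 : has_inf S.
  split; first by exists (1%:R^-1 * Ex mu (lognorm A 1)), 0%N.
  by exists 0 => _ [n _ <-]; rewrite mulr_ge0.
pose L := inf S.
have hL n : L * n%:R <= Ex mu (lognorm A n).
  case: n => [|n]; first by rewrite mulr0.
  rewrite -ler_pdivlMr// mulrC; apply: ge_inf; last by exists n.
  by case: S0.
have hL' e : 0 < e -> exists2 n, (0 < n)%N & Ex mu (lognorm A n) <= (L + e) * n%:R.
  move=> e0; have [_ [n _ <-] hn] := inf_adherent e0 S0.
  by exists n.+1 => //; rewrite -ler_pdivrMr// mulrC ltW.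
suff -> : lambda_plus mu A = L by [].
have isL : is_lyapunov mu A L.
  apply: (@kingman _ _ _ mu (@shift m) (@measurable_shift m) (bernoulli_shift hmu)
    (bernoulli_ergodic hp hmu) (lognorm A) (ln C)) => //.
  - by move=> n x; exact: lognorm_bound.
  - by move=> a b x; exact: lognormD.
  - by move=> n x; exact: lognorm_shift.
  - by move=> n x; exact: lognorm_succ.
rewrite /lambda_plus; apply: xget_unique => // l hl.
exact: is_lyapunov_unique hl isL.
Qed.

End lyapunov.
End cocycles.

(** * Random products of matrices *)

Lemma seq_argmin (R : realType) (T : eqType) (F : T -> R) (s : seq T) :
  s != [::] -> exists2 v, v \in s & forall w, w \in s -> F v <= F w.
Proof.
elim: s => [//|x s ih] _; have [->|s0] := eqVneq s [::].
  by exists x; [rewrite mem_head|move=> w; rewrite inE => /eqP ->].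
have [v vs hv] := ih s0; have [xv|vx] := leP (F x) (F v).
  exists x; first by rewrite mem_head.
  by move=> w; rewrite inE => /predU1P[->//|/hv]; exact: le_trans.
exists v; first by rewrite inE vs orbT.
by move=> w; rewrite inE => /predU1P[->|/hv//]; exact: ltW.
Qed.

Section markov.
Variables (R : realType) (m : nat) (p : 'I_m.+1 -> R) (A0 : 'I_m.+1 -> 'M[R]_2).
Hypothesis hp : positive_probability_vector p.
Hypothesis dA : forall i, \det (A0 i) = 1.
Implicit Types (u v w : 'cV[R]_2) (M N : 'M[R]_2) (phi psi : 'M[R]_2 -> R).

Let p_gt0 i : 0 < p i. Proof. by case: hp => + _; exact. Qed.
Let p_sum : \sum_i p i = 1. Proof. by case: hp. Qed.

Lemma mean_cst (c : R) : \sum_i p i * c = c.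
Proof. by rewrite -mulr_suml p_sum mul1r. Qed.

Lemma mean_le (F G : 'I_m.+1 -> R) : (forall i, F i <= G i) ->
  \sum_i p i * F i <= \sum_i p i * G i.
Proof. by move=> h; apply: ler_sum => i _; rewrite ler_wpM2l// ltW. Qed.

Definition markov phi M : R := \sum_i p i * phi (A0 i *m M).

(* [markovn n phi 1%:M] is the mean of [phi] over random words of length [n]. *)
Definition markovn n := iter n markov.

Lemma markovnS n phi M : markovn n.+1 phi M = \sum_i p i * markovn n phi (A0 i *m M).
Proof. by []. Qed.

Lemma markovnSr n phi : markovn n.+1 phi = markovn n (markov phi).
Proof. exact: iterSr. Qed.

Lemma markovnD a b phi : markovn (a + b) phi = markovn a (markovn b phi).
Proof. exact: iterD. Qed.

Lemma markovn_mulr n phi N M : markovn n (fun M => phi (M *m N)) M = markovn n phi (M *m N).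
Proof.
elim: n M => [//|n ih] M; rewrite !markovnS.
by apply: eq_bigr => i _; rewrite ih mulmxA.
Qed.

Section invariant.
Variable P : 'M[R]_2 -> Prop.
Hypothesis PA : forall i M, P M -> P (A0 i *m M).

(** Only matrices reached by the walk are seen by the operator. [P] will be determinant one, or such
    a condition together with a permutation of given lines. *)
Lemma markovn_le n phi psi M : (forall M, P M -> phi M <= psi M) -> P M ->
  markovn n phi M <= markovn n psi M.
Proof.
move=> h; elim: n M => [|n ih] M PM; first exact: h.
by rewrite !markovnS; apply: mean_le => i; apply: ih; exact: PA.
Qed.

Lemma markovn_eq n phi psi M : (forall M, P M -> phi M = psi M) -> P M ->
  markovn n phi M = markovn n psi M.
Proof.
move=> h PM; apply/le_anti; rewrite !markovn_le// => N PN; by rewrite h.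
Qed.

Lemma markovn_geom n phi (c : R) M : 0 <= c ->
  (forall i M, P M -> phi (A0 i *m M) <= c * phi M) -> P M ->
  markovn n phi M <= c ^+ n * phi M.
Proof.
move=> c0 h; elim: n M => [|n ih] M PM; first by rewrite expr0 mul1r.
rewrite markovnS -[leRHS]mean_cst; apply: mean_le => i.
rewrite (le_trans (ih _ (PA _ PM)))// exprSr -mulrA ler_wpM2l ?exprn_ge0//.
exact: h.
Qed.

End invariant.

Lemma markovn_cst n (c : R) M : markovn n (fun=> c) M = c.
Proof.
elim: n M => [//|n ih] M; rewrite markovnS.
by under eq_bigr do rewrite ih; exact: mean_cst.
Qed.

Lemma markovnDf n phi psi M :
  markovn n (fun M => phi M + psi M) M = markovn n phi M + markovn n psi M.
Proof.
elim: n M => [//|n ih] M; rewrite !markovnS -big_split /=.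
by apply: eq_bigr => i _; rewrite ih mulrDr.
Qed.

Lemma markovnZ n (c : R) phi M : markovn n (fun M => c * phi M) M = c * markovn n phi M.
Proof.
elim: n M => [//|n ih] M; rewrite !markovnS mulr_sumr.
by apply: eq_bigr => i _; rewrite ih mulrCA.
Qed.

Lemma markovn_sum n (I : Type) (s : seq I) (phi : I -> 'M[R]_2 -> R) M :
  markovn n (fun M => \sum_(i <- s) phi i M) M = \sum_(i <- s) markovn n (phi i) M.
Proof.
elim: s => [|i s ih].
  rewrite big_nil -[RHS](markovn_cst n 0 M).
  by congr markovn; apply/funext => N; rewrite big_nil.
rewrite big_cons -ih -markovnDf.
by congr markovn; apply/funext => N; rewrite big_cons.
Qed.

Let det1_inv i M : \det M = 1 -> \det (A0 i *m M) = 1.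
Proof. by move=> dM; rewrite det_mulmx dA dM mulr1. Qed.

Let det11 : \det (1%:M : 'M[R]_2) = 1. Proof. exact: det1. Qed.

Definition mean_log n v := markovn n (fun M => ln (enorm (M *m v))) 1%:M.
Definition mean_lognorm n := markovn n (fun M => ln (opnorm M)) 1%:M.

Lemma markovn_mean_log n v M :
  markovn n (fun M => ln (enorm (M *m v))) M = mean_log n (M *m v).
Proof.
rewrite /mean_log -[in LHS](mul1mx M) -markovn_mulr; congr markovn.
by apply/funext => N; rewrite mulmxA.
Qed.

Lemma mean_logS n v : mean_log n.+1 v = \sum_i p i * mean_log n (A0 i *m v).
Proof.
rewrite /mean_log markovnS; apply: eq_bigr => i _.
by rewrite mulmx1 markovn_mean_log.
Qed.

Lemma mean_logD a b v :
  mean_log (a + b) v = markovn a (fun M => mean_log b (M *m v)) 1%:M.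
Proof.
rewrite /mean_log markovnD; congr markovn; apply/funext => M.
exact: markovn_mean_log.
Qed.

Lemma mean_log0 v : mean_log 0 v = ln (enorm v).
Proof. by rewrite /mean_log /= mul1mx. Qed.

Lemma mean_logZ n (c : R) v : c != 0 -> v != 0 ->
  mean_log n (c *: v) = ln `|c| + mean_log n v.
Proof.
move=> c0 v0; rewrite -[ln `|c|](markovn_cst n _ 1%:M) -markovnDf.
apply: (@markovn_eq (fun M => \det M = 1)) => // M dM.
by rewrite -scalemxAr enormZ lnM ?posrE ?normr_gt0// enorm_gt0 mulSL2_neq0.
Qed.

Variable C0 : R.
Hypotheses (C1 : 1 <= C0) (AC : forall i, opnorm (A0 i) <= C0).

Let lnA_le i : ln (opnorm (A0 i)) <= ln C0.
Proof. by rewrite ler_ln ?posrE ?opnorm_gt0// (lt_le_trans ltr01). Qed.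

Let lnC_ge0 : 0 <= ln C0. Proof. exact: ln_ge0. Qed.

Let step_bound i v : v != 0 -> `|ln (enorm (A0 i *m v)) - ln (enorm v)| <= ln C0.
Proof.
move=> v0; have := lgrow_le (dA i) v0; have := lgrow_ge (dA i) v0.
rewrite /lgrow ler_norml; have := lnA_le i; move=> h1 h2 h3; apply/andP; split; lra.
Qed.

Lemma mean_log_step n v : v != 0 -> `|mean_log n.+1 v - mean_log n v| <= ln C0.
Proof.
move=> v0; elim: n v v0 => [|n ih] v v0.
  rewrite mean_logS mean_log0 -[X in _ - X]mean_cst -sumrB.
  rewrite (le_trans (ler_norm_sum _ _ _))// -[leRHS]mean_cst; apply: ler_sum => i _.
  by rewrite -mulrBr normrM gtr0_norm// ler_pM2l// mean_log0 step_bound.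
rewrite mean_logS [X in _ - X]mean_logS -sumrB.
rewrite (le_trans (ler_norm_sum _ _ _))// -[leRHS]mean_cst; apply: ler_sum => i _.
by rewrite -mulrBr normrM gtr0_norm// ler_pM2l// ih// mulSL2_neq0.
Qed.

Lemma mean_log_bound n v : v != 0 -> `|mean_log n v - ln (enorm v)| <= n%:R * ln C0.
Proof.
move=> v0; elim: n => [|n ih]; first by rewrite mean_log0 subrr normr0 mul0r.
rewrite -natr1 mulrDl mul1r -(subrKA (mean_log n v)) addrC.
by rewrite (le_trans (ler_normD _ _))// lerD// mean_log_step.
Qed.

(** The mean of [lgrow_lip] over words. The constant explodes with [n], but [n] is fixed in the
    compactness argument that uses it. *)
Lemma mean_log_lip n u w : u != 0 -> w != 0 ->
  (mean_log n u - ln (enorm u)) - (mean_log n w - ln (enorm w)) <=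
  (C0 ^+ 2) ^+ n * sdist u w.
Proof.
move=> u0 w0.
have h v : v != 0 -> mean_log n v - ln (enorm v) = markovn n (fun M => lgrow M v) 1%:M.
  move=> v0; rewrite /lgrow markovnDf (markovn_cst n (- _)); exact: erefl.
rewrite !h// lerBlDr -[in leRHS](mul1r (sdist u w)).
apply: (@le_trans _ _ (markovn n (fun M => opnorm M ^+ 2 * sdist u w + lgrow M w) 1%:M)).
  apply: (@markovn_le (fun M => \det M = 1)) => // M dM.
  by rewrite -lerBlDr lgrow_lip.
rewrite markovnDf lerD2r.
apply: (@le_trans _ _ ((C0 ^+ 2) ^+ n * (opnorm (1%:M : 'M[R]_2) ^+ 2 * sdist u w))).
  apply: (@markovn_geom (fun=> True)) => //; first by rewrite exprn_ge0// (le_trans ler01).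
  move=> i M _; rewrite mulrA ler_wpM2r ?sdist_ge0// -exprMn.
  rewrite ler_pXn2r ?nnegrE ?mulr_ge0 ?opnorm_ge0 ?(le_trans ler01)//.
  by rewrite (le_trans (opnormM _ _))// ler_wpM2r ?opnorm_ge0.
rewrite ler_wpM2l ?exprn_ge0 ?(le_trans ler01)// ler_wpM2r ?sdist_ge0//.
by rewrite expr_le1// ?opnorm_ge0// opnorm1_le.
Qed.

Definition nonparallel (s : seq 'cV[R]_2) := pairwise (fun u v => wedge u v != 0) s.

Lemma nonparallel_wedge s u v : nonparallel s -> u \in s -> v \in s -> u != v ->
  wedge u v != 0.
Proof.
elim: s => [//|x s ih] /= /andP[/allP h hs]; rewrite !inE.
move=> /predU1P[->|us] /predU1P[->|vs]; rewrite ?eqxx// => uv.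
- exact: h.
- by rewrite wedgeC oppr_eq0 h.
- exact: ih.
Qed.

Lemma nonparallel_uniq s : nonparallel s -> uniq s.
Proof.
elim: s => [//|x s ih] /= /andP[/allP h /ih ->]; rewrite andbT.
by apply/negP => /h; rewrite /wedge mulrC subrr eqxx.
Qed.

(* All but one of the vectors of [s] are expanded almost as much as possible. *)
Lemma sum_ln_ge s : nonparallel s -> (forall v, v \in s -> v != 0) ->
  exists C, forall M, \det M = 1 ->
    (size s)%:R * ln (opnorm M) - 2 * ln (opnorm M) - C <=
    \sum_(v <- s) ln (enorm (M *m v)).
Proof.
move=> np s0.
pose D u v : R := `|ln ((enorm u + enorm v) / `|wedge u v|)|.
exists (\sum_(u <- s) \sum_(v <- s) D u v + \sum_(v <- s) `|ln (enorm v)|) => M dM.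
have D0 u v : 0 <= D u v by exact: normr_ge0.
have DD0 : 0 <= \sum_(u <- s) \sum_(v <- s) D u v.
  by apply: sumr_ge0 => u _; apply: sumr_ge0 => v _.
have L0 : 0 <= \sum_(v <- s) `|ln (enorm v)| by apply: sumr_ge0.
have lM : 0 <= ln (opnorm M) by exact: ln_opnorm_ge0.
have [->|sn] := eqVneq s [::].
  by rewrite !big_nil /=; lra.
(* The exceptional vector is the least expanded one. Any other vector is expanded at least as much,
   so [opnorm_le_pair] bounds the norm of [M] by its expansion alone. The exceptional vector may
   contract by the full norm, whence the loss of 2 ln |M|. *)
have [v0 v0s hv0] := seq_argmin (fun v => enorm (M *m v)) sn.
have us := nonparallel_uniq np.
rewrite [leRHS](perm_big _ (perm_to_rem v0s)) /= big_cons.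
have h0 : - ln (opnorm M) - \sum_(v <- s) `|ln (enorm v)| <= ln (enorm (M *m v0)).
  have := lgrow_ge dM (s0 _ v0s); rewrite /lgrow => h.
  have : `|ln (enorm v0)| <= \sum_(v <- s) `|ln (enorm v)|.
    by rewrite (perm_big _ (perm_to_rem v0s)) big_cons lerDl sumr_ge0.
  have := ler_norm (- ln (enorm v0)); rewrite normrN; lra.
have h1 : \sum_(v <- rem v0 s) (ln (opnorm M) - D v0 v) <=
    \sum_(v <- rem v0 s) ln (enorm (M *m v)).
  rewrite big_seq [leRHS]big_seq; apply: ler_sum => v; rewrite mem_rem_uniq// inE => /andP[vv0 vs].
  have w0 : wedge v0 v != 0 by rewrite (nonparallel_wedge np)// eq_sym.
  have eMv : 0 < enorm (M *m v) by rewrite enorm_gt0 mulSL2_neq0// s0.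
  have ew : 0 < `|wedge v0 v| by rewrite normr_gt0.
  have ed : 0 < (enorm v0 + enorm v) / `|wedge v0 v|.
    by rewrite divr_gt0// addr_gt0 ?enorm_gt0 ?s0.
  rewrite lerBlDr (@le_trans _ _ (ln (enorm (M *m v)) + ln ((enorm v0 + enorm v) / `|wedge v0 v|)))//.
    have em := mulr_gt0 eMv ed.
    rewrite -lnM ?posrE// ler_ln ?posrE ?opnorm_gt0//.
    rewrite (le_trans (opnorm_le_pair _ w0))// mulrA ler_pM2r ?invr_gt0//.
    have := hv0 v vs; have := enorm_ge0 v; have := enorm_ge0 v0; nra.
  by rewrite lerD2l ler_norm.
have h2 : \sum_(v <- rem v0 s) (ln (opnorm M) - D v0 v) =
    (size s)%:R * ln (opnorm M) - ln (opnorm M) - \sum_(v <- rem v0 s) D v0 v.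
  rewrite sumrB sumr_const_seq size_rem// -mulr_natl -[in RHS](prednK (_ : 0 < size s)%N).
    by rewrite -natr1; ring.
  by rewrite lt0n size_eq0.
have h3 : \sum_(v <- rem v0 s) D v0 v <= \sum_(u <- s) \sum_(v <- s) D u v.
  rewrite [leRHS](perm_big _ (perm_to_rem v0s)) big_cons.
  rewrite (@le_trans _ _ (\sum_(v <- s) D v0 v))//.
    by rewrite [leRHS](perm_big _ (perm_to_rem v0s)) big_cons lerDr.
  by rewrite lerDl; apply: sumr_ge0 => u _; apply: sumr_ge0 => v _.
lra.
Qed.

Lemma sum_mean_log_ge s : nonparallel s -> (forall v, v \in s -> v != 0) ->
  exists C, forall n,
    (size s)%:R * mean_lognorm n - 2 * mean_lognorm n - C <= \sum_(v <- s) mean_log n v.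
Proof.
move=> np s0; have [C hC] := sum_ln_ge np s0; exists C => n.
rewrite -markovn_sum.
have -> : (size s)%:R * mean_lognorm n - 2 * mean_lognorm n - C =
   markovn n (fun M => ((size s)%:R - 2) * ln (opnorm M) + - C) 1%:M.
  by rewrite markovnDf markovnZ markovn_cst mulrBl.
apply: (@markovn_le (fun M => \det M = 1)) => // M dM.
by rewrite mulrBl; exact: hC.
Qed.

Lemma parallelP u v : u != 0 -> v != 0 -> wedge u v = 0 ->
  exists2 c, c != 0 & v = c *: u.
Proof.
move=> u0 v0 /(wedge0P u0)[c vE]; exists c => //.
by apply: contra_neq v0 => c0; rewrite vE c0 scale0r.
Qed.

(* When the lines of [u] and [v] are exchanged by the family, the growth of [u]
   is a random walk with random sign changes: its mean stays bounded and its
   variance grows linearly. *)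
Section exchanged_lines.
Variables u v : 'cV[R]_2.
Hypotheses (eu : enorm u = 1) (ev : enorm v = 1) (uv : wedge u v != 0).

Let fixes M := wedge (M *m u) u = 0 /\ wedge (M *m v) v = 0.
Let swaps M := wedge (M *m u) v = 0 /\ wedge (M *m v) u = 0.
Hypothesis Auv : forall i, fixes (A0 i) \/ swaps (A0 i).
Hypothesis Au : exists i, wedge (A0 i *m u) u != 0.

Let u0 : u != 0. Proof. by rewrite -enorm_gt0 eu. Qed.
Let v0 : v != 0. Proof. by rewrite -enorm_gt0 ev. Qed.

Let fixesP M : \det M = 1 -> fixes M ->
  exists c d, [/\ M *m u = c *: u, M *m v = d *: v & c * d = 1].
Proof.
move=> dM [hu hv].
have [c _ cE] : exists2 c, c != 0 & M *m u = c *: u.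
  by apply: parallelP; rewrite ?mulSL2_neq0// wedgeC hu oppr0.
have [d _ dE] : exists2 c, c != 0 & M *m v = c *: v.
  by apply: parallelP; rewrite ?mulSL2_neq0// wedgeC hv oppr0.
exists c, d; split=> //; have := wedge_mul M u v.
rewrite cE dE wedgeZl wedgeZr dM mul1r mulrA => /eqP.
by rewrite -subr_eq0 -{2}[wedge u v]mul1r -mulrBl mulf_eq0 (negbTE uv) orbF subr_eq0 => /eqP.
Qed.

Let swapsP M : \det M = 1 -> swaps M ->
  exists c d, [/\ M *m u = c *: v, M *m v = d *: u & c * d = - 1].
Proof.
move=> dM [hu hv].
have [c _ cE] : exists2 c, c != 0 & M *m u = c *: v.
  by apply: parallelP; rewrite ?mulSL2_neq0// wedgeC hu oppr0.
have [d _ dE] : exists2 c, c != 0 & M *m v = c *: u.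
  by apply: parallelP; rewrite ?mulSL2_neq0// wedgeC hv oppr0.
exists c, d; split=> //; have := wedge_mul M u v.
rewrite cE dE wedgeZl wedgeZr dM mul1r mulrA wedgeC => /eqP.
rewrite -subr_eq0 mulrN -opprD oppr_eq0 -{2}[wedge u v]mul1r -mulrDl mulf_eq0 (negbTE uv) orbF.
by rewrite addr_eq0 => /eqP.
Qed.

Let good M := \det M = 1 /\ (fixes M \/ swaps M).

Let good1 : good 1%:M.
Proof. by split; [exact: det1|left; rewrite /fixes !mul1mx /wedge; split; ring]. Qed.

Let wedgexx w : wedge w w = 0. Proof. by rewrite /wedge; ring. Qed.

Let goodA i M : good M -> good (A0 i *m M).
Proof.
move=> [dM gM]; split; first exact: det1_inv.
have [/(fixesP (dA i))|/(swapsP (dA i))] := Auv i => -[c [d [Aiu Aiv _]]];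
  case: gM => [/(fixesP dM)|/(swapsP dM)] [a [b [Mu Mv _]]].
- by left; rewrite /fixes -!mulmxA Mu Mv -!scalemxAr Aiu Aiv !wedgeZl !wedgexx !mulr0.
- by right; rewrite /swaps -!mulmxA Mu Mv -!scalemxAr Aiu Aiv !wedgeZl !wedgexx !mulr0.
- by right; rewrite /swaps -!mulmxA Mu Mv -!scalemxAr Aiu Aiv !wedgeZl !wedgexx !mulr0.
- by left; rewrite /fixes -!mulmxA Mu Mv -!scalemxAr Aiu Aiv !wedgeZl !wedgexx !mulr0.
Qed.

Let abs_prod_ln (c d : R) : `|c * d| = 1 -> ln `|d| = - ln `|c|.
Proof.
rewrite normrM => h.
have c0 : 0 < `|c|.
  by rewrite lt0r normr_ge0 andbT; apply/eqP => c0; move: h; rewrite c0 mul0r => /esym/eqP; rewrite oner_eq0.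
have d0 : 0 < `|d|.
  by rewrite lt0r normr_ge0 andbT; apply/eqP => d0; move: h; rewrite d0 mulr0 => /esym/eqP; rewrite oner_eq0.
by apply/eqP; rewrite -addr_eq0 addrC -lnM ?posrE// h ln1.
Qed.

(** Both images lie on the two given lines, so preservation of area makes the two stretching factors
    reciprocal. *)
Let good_ln M : good M -> ln (enorm (M *m v)) = - ln (enorm (M *m u)).
Proof.
move=> [dM [/(fixesP dM)|/(swapsP dM)]] [c [d [-> -> cd]]];
  by rewrite !enormZ eu ev !mulr1; apply: abs_prod_ln; rewrite cd ?normrN normr1.
Qed.

Let mean_log_v n : mean_log n v = - mean_log n u.
Proof.
rewrite -mulN1r -markovnZ; apply: (@markovn_eq good) => // M gM.
by rewrite good_ln// mulN1r.
Qed.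

Let beta i := ln (enorm (A0 i *m u)).
Let sgn i : R := if wedge (A0 i *m u) u == 0 then 1 else -1.

Let wedge_vu : wedge v u != 0. Proof. by rewrite wedgeC oppr_eq0. Qed.

Let beta_le i : `|beta i| <= ln C0.
Proof. by have := step_bound i u0; rewrite eu ln1 subr0. Qed.

(** If the first letter exchanges the lines, the walk continues from [v], whose growth is opposite
    to that of [u] by [good_ln]. *)
Let ln_word i M : good M -> ln (enorm (M *m (A0 i *m u))) = beta i + sgn i * ln (enorm (M *m u)).
Proof.
move=> gM; have dM : \det M = 1 by case: gM.
have Au0 : A0 i *m u != 0 by rewrite mulSL2_neq0.
rewrite /beta /sgn.
have [/(fixesP (dA i))|/(swapsP (dA i))] := Auv i => -[c [d [Aiu _ cd]]].
  rewrite Aiu wedgeZl wedgexx mulr0 eqxx mul1r -scalemxAr !enormZ eu mulr1.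
  rewrite lnM ?posrE ?enorm_gt0 ?mulSL2_neq0//.
  by rewrite normr_gt0; apply: contraNneq Au0 => c0; rewrite Aiu c0 scale0r.
have c0 : c != 0 by apply: contraNneq Au0 => c0; rewrite Aiu c0 scale0r.
rewrite Aiu wedgeZl mulf_eq0 (negbTE c0) (negbTE wedge_vu) mulN1r -good_ln//.
rewrite -scalemxAr !enormZ ev mulr1 lnM ?posrE ?enorm_gt0 ?mulSL2_neq0//.
by rewrite normr_gt0.
Qed.

Let b := \sum_i p i * beta i.
Let kappa := \sum_i p i * sgn i.

Let mean_logS_u n : mean_log n.+1 u = b + kappa * mean_log n u.
Proof.
rewrite mean_logS /kappa mulr_suml -big_split /=; apply: eq_bigr => i _.
rewrite -mulrA -mulrDr; congr (_ * _).
rewrite /mean_log -[sgn i * _]markovnZ -[beta i](markovn_cst n _ 1%:M) -markovnDf.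
by apply: (@markovn_eq good) => // M gM; rewrite ln_word.
Qed.

Let sgn_le1 i : `|sgn i| <= 1.
Proof. by rewrite /sgn; case: ifP => _; rewrite ?normrN normr1. Qed.

Let kappa_lt1 : kappa < 1.
Proof.
have [i0 hi0] := Au.
rewrite -[X in _ < X](mean_cst 1) /kappa (bigD1 i0)//= [ltRHS](bigD1 i0)//=.
rewrite ltr_leD//; first by rewrite ltr_pM2l// /sgn (negbTE hi0) ltrNl; lra.
by apply: ler_sum => i _; rewrite ler_pM2l// (le_trans (ler_norm _)).
Qed.

Let kappa_geN1 : - 1 <= kappa.
Proof.
rewrite -[leLHS]mean_cst; apply: mean_le => i.
by have := sgn_le1 i; rewrite ler_norml => /andP[].
Qed.

(** The mean obeys an affine recursion of slope [kappa] in [-1, 1[, solved by b (1 - kappa^n) / (1 -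
    kappa). The factor 2 covers [kappa] equal to -1. *)
Let F := 2 * `|b| / (1 - kappa).

Let mean_log_u_bound n : `|mean_log n u| <= F.
Proof.
have k1 : 0 < 1 - kappa by rewrite subr_gt0.
have e : mean_log n u * (1 - kappa) = b * (1 - kappa ^+ n).
  elim: n => [|n ih]; first by rewrite mean_log0 eu ln1 expr0; ring.
  by rewrite mean_logS_u exprS mulrDl -mulrA ih; ring.
rewrite ler_pdivlMr// -{1}(gtr0_norm k1) -normrM e normrM mulrC ler_wpM2r//.
rewrite (le_trans (ler_normB _ _))// normr1 normrX.
have : `|kappa| <= 1 by rewrite ler_norml kappa_geN1 ltW.
move=> h; have : `|kappa| ^+ n <= 1 by rewrite exprn_ile1.
lra.
Qed.

Let second n := markovn n (fun M => ln (enorm (M *m u)) ^+ 2) 1%:M.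

Let K2 := ln C0 ^+ 2 + 2 * ln C0 * F.

Let F_ge0 : 0 <= F.
Proof. by rewrite divr_ge0 ?mulr_ge0// subr_ge0 ltW. Qed.

(** Squaring [ln_word] keeps the old square with coefficient 1; the cross term is bounded because
    the mean is, so each letter adds at most [K2]. *)
Let second_le n : second n <= n%:R * K2.
Proof.
elim: n => [|n ih].
  by rewrite /second /= mul1mx eu ln1 expr0n mul0r.
have -> : second n.+1 = \sum_i p i * (beta i ^+ 2 + 2 * beta i * sgn i * mean_log n u + second n).
  rewrite /second markovnS; apply: eq_bigr => i _; congr (_ * _).
  rewrite -[beta i ^+ 2](markovn_cst n _ 1%:M) -[2 * _ * _ * _]markovnZ -!markovnDf.
  rewrite mulmx1 -[X in markovn n _ X]mul1mx -markovn_mulr.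
  apply: (@markovn_eq good) => // M gM.
  rewrite -mulmxA ln_word// sqrrD exprMn.
  have -> : sgn i ^+ 2 = 1 by rewrite /sgn; case: ifP => _; rewrite ?sqrrN expr1n.
  by rewrite mul1r -mulr_natl; ring.
rewrite -[leRHS]mean_cst; apply: mean_le => i.
have -> : n.+1%:R * K2 = K2 + n%:R * K2 by rewrite -natr1; ring.
rewrite lerD// /K2 lerD//.
  rewrite -[leLHS]real_normK ?num_real// ler_pXn2r ?nnegrE//.
rewrite (le_trans (ler_norm _))// !normrM (ger0_norm (ler0n _ 2)).
have h1 := beta_le i; have h2 := sgn_le1 i; have h3 := mean_log_u_bound n.
have h4 : `|beta i| * `|sgn i| <= ln C0.
  by rewrite -[leRHS]mulr1 ler_pM.
rewrite -!mulrA ler_pM2l// mulrA; exact: ler_pM.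
Qed.

Lemma exchanged_lines_mean_lognorm (L : R) :
  (forall n, L * n%:R <= mean_lognorm n) -> L <= 0.
Proof.
move=> hL; rewrite leNgt; apply/negP => L0.
have w0 : 0 < `|wedge u v| by rewrite normr_gt0.
pose c0 := ln (2 / `|wedge u v|).
(* The norm is controlled by |x| with x the logarithmic growth of [u], and |x| <= T/2 + x^2/(2T)
   brings in the second moment. *)
have h T n : 0 < T -> mean_lognorm n <= c0 + (T / 2 + (2 * T)^-1 * second n).
  move=> T0.
  have -> : c0 + (T / 2 + (2 * T)^-1 * second n) =
      markovn n (fun M => (c0 + T / 2) + (2 * T)^-1 * ln (enorm (M *m u)) ^+ 2) 1%:M.
    by rewrite markovnDf markovn_cst markovnZ addrA.
  apply: (@markovn_le good) => // M gM; have dM : \det M = 1 by case: gM.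
  have hl := good_ln gM.
  set x := ln (enorm (M *m u)) in hl *.
  have eMu : 0 < enorm (M *m u) by rewrite enorm_gt0 mulSL2_neq0.
  have eMv : 0 < enorm (M *m v) by rewrite enorm_gt0 mulSL2_neq0.
  have h1 : enorm (M *m u) <= expR `|x|.
    by rewrite -[leLHS]lnK ?posrE// ler_expR ler_norm.
  have h2 : enorm (M *m v) <= expR `|x|.
    by rewrite -[leLHS]lnK ?posrE// ler_expR hl -normrN ler_norm.
  have h3 : opnorm M <= 2 / `|wedge u v| * expR `|x|.
    rewrite (le_trans (opnorm_le_pair M uv))// eu ev !mulr1 mulrAC ler_pM2r ?invr_gt0//.
    lra.
  have h4 : ln (opnorm M) <= c0 + `|x|.
    rewrite /c0 -[`|x|]expRK -lnM ?posrE ?divr_gt0 ?expR_gt0// ler_ln ?posrE ?opnorm_gt0//.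
    by rewrite mulr_gt0 ?divr_gt0 ?expR_gt0.
  rewrite (le_trans h4)// -addrA lerD2l -subr_ge0.
  have -> : T / 2 + (2 * T)^-1 * x ^+ 2 - `|x| = (2 * T)^-1 * (T - `|x|) ^+ 2.
    rewrite sqrrB real_normK ?num_real//; field; rewrite gt_eqF//.
  by rewrite mulr_ge0 ?sqr_ge0// invr_ge0 mulr_ge0// ltW.
suff : L / 2 <= 0 by lra.
apply: (@natmul_bounded_le0 _ _ (`|c0| + K2 / (2 * L))) => -[|n].
  rewrite mul0r addr_ge0// divr_ge0 ?mulr_ge0 ?(ltW L0)//.
  by rewrite /K2 addr_ge0 ?sqr_ge0// mulr_ge0// mulr_ge0.
have n0 : 0 < n.+1%:R :> R by [].
(* With T = L n, half of the assumed growth L n survives, while the second moment contributes only a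
   bounded term. *)
have h0 := h (L * n.+1%:R) n.+1 (mulr_gt0 L0 n0); have h1 := hL n.+1.
have h2 := second_le n.+1; have i0 : 0 < (2 * (L * n.+1%:R))^-1 by rewrite invr_gt0 !mulr_gt0.
have cancel (y : R) : 0 < y -> (2 * (L * y))^-1 * (y * K2) = K2 / (2 * L).
  by move=> y0; field; rewrite !gt_eqF.
rewrite -(ler_pM2l i0) cancel// in h2.
set z := (2 * _)^-1 * second _ in h0 h2; clearbody z; move: h0 h1 h2 (ler_norm c0).
set y := n.+1%:R; clearbody y; lra.
Qed.

End exchanged_lines.

(** * A maximum principle for harmonic growth rates *)

Section harmonic_rate.
Variable lam : R.
Hypotheses (lam_gt0 : 0 < lam) (hlam : forall n, lam * n%:R <= mean_lognorm n).
Hypothesis irr : irreducible_family A0.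

Variable b : 'cV[R]_2 -> R.
Hypothesis b_harm : forall v, v != 0 -> b v = \sum_i p i * b (A0 i *m v).
Hypothesis bZ : forall c v, c != 0 -> v != 0 -> b (c *: v) = b v.
Hypothesis b_sum : forall s, nonparallel s -> (forall v, v \in s -> v != 0) ->
  (1 < size s)%N -> ((size s)%:R - 2) * lam <= \sum_(v <- s) b v.
Hypothesis b_pair : forall u v D, u != 0 -> v != 0 ->
  (forall n, mean_log n u + mean_log n v <= D) -> b u + b v <= 0.

(* The vectors at which the harmonic function [b] is minimal form finitely many
   lines permuted by the family; irreducibility excludes a single line, [b_pair]
   excludes three of them, and two lines are excluded by
   [exchanged_lines_mean_lognorm]. *)
Lemma harmonic_rate_ge v : v != 0 -> lam <= b v.
Proof.
move=> v00; rewrite leNgt; apply/negP => hv.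
(* The defect of the rate. By [b_sum] its total over two or more distinct lines is at most 2 lam, so
   only finitely many lines have a defect of at least [a v]. *)
pose a w := lam - b w.
have t0 : 0 < a v by rewrite /a subr_gt0.
pose big (s : seq 'cV[R]_2) :=
  [/\ nonparallel s, forall w, w \in s -> w != 0 & forall w, w \in s -> a v <= a w].
have sum_a s : nonparallel s -> (forall w, w \in s -> w != 0) -> (1 < size s)%N ->
    \sum_(w <- s) a w <= 2 * lam.
  move=> np s0 s2; have := b_sum np s0 s2; rewrite /a sumrB sumr_const_seq -mulr_natl; lra.
pose P n := `[< exists2 s, big s & size s = n >].
have exP : exists n, P n by exists 0%N; apply/asboolP; exists [::].
(* [maxn 1] covers the families with fewer than two lines, to which [b_sum] does not apply. *)
have ubP n : P n -> (n <= maxn 1 (Num.truncn (2 * lam / a v)).+1)%N.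
  move=> /asboolP[s [np s0 sa] <-]; have [s2|] := ltnP 1 (size s); last by rewrite leq_max => ->.
  rewrite leq_max; apply/orP; right; rewrite -(ler_nat R).
  apply: (@le_trans _ _ (2 * lam / a v)); last by rewrite ltW// truncnS_gt.
  rewrite ler_pdivlMr// (le_trans _ (sum_a s np s0 s2))// mulr_natl -sumr_const_seq.
  by rewrite big_seq [leRHS]big_seq; apply: ler_sum.
have [_ /asboolP[V [npV V0 Va] <-] maxV] := ex_maxnP exP ubP.
have parV w : w != 0 -> a v <= a w -> exists2 u, u \in V & wedge u w = 0.
  move=> w0 aw; apply: contrapT => h.
  have : P (size V).+1.
    apply/asboolP; exists (w :: V) => //; split.
    - rewrite /nonparallel /= [X in _ && X]npV andbT; apply/allP => u uV.
      by rewrite wedgeC oppr_eq0; apply/eqP => e; apply: h; exists u.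
    - by move=> u; rewrite inE => /predU1P[->|/V0].
    - by move=> u; rewrite inE => /predU1P[->|/Va].
  by move=> /maxV; rewrite ltnn.
have aZ c w : c != 0 -> w != 0 -> a (c *: w) = a w by move=> c0 w0; rewrite /a bZ.
have a_par u w : u != 0 -> w != 0 -> wedge u w = 0 -> a w = a u.
  by move=> u0 w0 /(parallelP u0 w0)[c c0 ->]; rewrite aZ.
have [z zV _] := parV v v00 (lexx _).
have Vn : V != [::] by apply: contraTneq zV => ->.
(* By maximality of [V], every line of defect at least [a v] is represented in it; the largest
   defect on [V] is therefore the largest of all. *)
have [v1 v1V hv1] := seq_argmin (fun w => - a w) Vn.
pose s := a v1.
have ts : a v <= s by exact: Va.
have s_gt0 : 0 < s by exact: lt_le_trans ts.
have a_le w : w != 0 -> a w <= s.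
  move=> w0; have [h|/ltW h] := leP (a v) (a w); last exact: le_trans ts.
  have [u uV uw] := parV w w0 h; rewrite (a_par u w)// ?V0//.
  by rewrite -lerN2 hv1.
pose S := [seq w <- V | a w == s].
have memS w : w \in S = (a w == s) && (w \in V) by rewrite mem_filter.
have npS : nonparallel S by apply: subseq_pairwise npV; exact: filter_subseq.
have S0 w : w \in S -> w != 0 by rewrite memS => /andP[_ /V0].
(* Maximum principle: the maximal defect of [w] is a mean, with positive weights, of the defects of
   its images, so each image is again maximal. *)
have Sinv w i : w \in S -> exists2 u, u \in S & wedge u (A0 i *m w) = 0.
  move=> wS; have w0 := S0 _ wS; move: wS; rewrite memS => /andP[/eqP aw wV].
  have Aw0 j : A0 j *m w != 0 by rewrite mulSL2_neq0.
  have aAw : a (A0 i *m w) = s.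
    apply/le_anti; rewrite a_le//= leNgt; apply/negP => lt.
    have : a w = \sum_j p j * a (A0 j *m w).
      rewrite /a b_harm// -[X in X - _]mean_cst -sumrB.
      by apply: eq_bigr => j _; rewrite mulrBr.
    apply/eqP; rewrite gt_eqF// aw -[ltRHS]mean_cst (bigD1 i)//= [ltRHS](bigD1 i)//=.
    rewrite ltr_leD ?ltr_pM2l//; apply: ler_sum => j _.
    by rewrite ler_pM2l// a_le.
  have avA : a v <= a (A0 i *m w) by rewrite aAw.
  have [u uV uw] := parV _ (Aw0 i) avA.
  exists u => //; rewrite memS uV andbT -(a_par _ _ (V0 _ uV) (Aw0 i) uw) aAw.
  exact: eqxx.
have v1S : v1 \in S by rewrite memS eqxx.
have [S1|S2] := leqP (size S) 1.
  have SE w : w \in S -> w = v1.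
    case: (S) S1 v1S => [//|x [|//]] _; rewrite !inE => /eqP -> /eqP ->.
    exact: erefl.
  apply: irr; exists <[v1]>%VS; split; first by rewrite dim_vline S0.
  move=> i w /vlineP[c ->]; rewrite -scalemxAr memvZ//.
  have [u uS uw] := Sinv v1 i v1S; rewrite (SE _ uS) in uw.
  have [d ->] := wedge0P (S0 _ v1S) uw.
  by rewrite memvZ// memv_line.
pose Q M := \det M = 1 /\ forall w, w \in S -> exists2 u, u \in S & wedge u (M *m w) = 0.
have QA i M : Q M -> Q (A0 i *m M).
  move=> [dM hM]; split; first exact: det1_inv.
  move=> w wS; have [u uS uw] := hM w wS; have [u' u'S hu'] := Sinv u i uS.
  exists u' => //.
  have Mw0 : M *m w != 0 by rewrite mulSL2_neq0// S0.
  have [c c0 e] := parallelP (S0 _ uS) Mw0 uw.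
  by rewrite -mulmxA e -scalemxAr wedgeZr hu' mulr0.
have Q1 : Q 1%:M.
  split; first exact: det1.
  by move=> w wS; exists w => //; rewrite mul1mx /wedge; ring.
(* A word sends the two lines to lines of [S]. Area is preserved and there are finitely many angles
   between lines of [S], so the product of the two lengths stays bounded. *)
have pairS x y : x \in S -> y \in S -> x != y -> b x + b y <= 0.
  move=> xS yS xy.
  pose D := \sum_(x' <- S) \sum_(y' <- S) `|ln (sdist x' y')|.
  apply: (@b_pair x y (ln `|wedge x y| + D)) => [||n]; rewrite ?S0//.
  rewrite -markovnDf -[X in _ <= X](markovn_cst n _ 1%:M).
  apply: (@markovn_le Q) => // M [dM hM].
  have [[x' x'S hx] [y' y'S hy]] := (hM x xS, hM y yS).
  have Mx0 : M *m x != 0 by rewrite mulSL2_neq0// S0.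
  have My0 : M *m y != 0 by rewrite mulSL2_neq0// S0.
  have [c c0 Ec] := parallelP (S0 _ x'S) Mx0 hx.
  have [d d0 Ed] := parallelP (S0 _ y'S) My0 hy.
  have wxy : wedge x y != 0 by exact: nonparallel_wedge npS xS yS xy.
  have W : `|wedge x y| = `|c| * `|d| * `|wedge x' y'|.
    have := wedge_mul M x y; rewrite dM mul1r => <-.
    by rewrite Ec Ed wedgeZl wedgeZr !normrM mulrA.
  have w0' : 0 < `|wedge x' y'|.
    rewrite normr_gt0; apply: contraNneq wxy => e.
    by rewrite -normr_eq0 W e normr0 mulr0.
  have [ex ey] : 0 < enorm x' /\ 0 < enorm y' by rewrite !enorm_gt0 !S0.
  have [nc nd] : 0 < `|c| /\ 0 < `|d| by rewrite !normr_gt0.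
  have sd0 : 0 < sdist x' y' by rewrite divr_gt0// mulr_gt0.
  have e : ln (enorm (M *m x)) + ln (enorm (M *m y)) = ln `|wedge x y| - ln (sdist x' y').
    rewrite Ec Ed !enormZ -lnM ?posrE ?mulr_gt0// -ln_div ?posrE//; last by rewrite normr_gt0.
    congr ln; rewrite W /sdist; field; rewrite !gt_eqF//.
  rewrite e lerD2l (le_trans (ler_norm _))// normrN /D.
  rewrite (perm_big _ (perm_to_rem x'S)) big_cons (perm_big _ (perm_to_rem y'S)) big_cons /=.
  rewrite -addrA lerDl addr_ge0// ?sumr_ge0// => k _.
  exact: sumr_ge0.
have sumS := sum_a S npS S0 S2.
have sumS' : \sum_(w <- S) a w = (size S)%:R * s.
  rewrite mulr_natl -sumr_const_seq; apply: eq_big_seq => w.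
  by rewrite memS => /andP[/eqP].
have uS := nonparallel_uniq npS.
case: S S2 memS npS S0 Sinv v1S Q QA Q1 pairS sumS sumS' uS =>
  [//|x [//|y S']] _ memS npS S0 Sinv v1S Q QA Q1 pairS sumS sumS' uS.
have xS : x \in [:: x, y & S'] by rewrite !inE eqxx.
have yS : y \in [:: x, y & S'] by rewrite !inE eqxx orbT.
have xy : x != y by move: uS; rewrite /= inE negb_or => /andP[/andP[]].
have axy : a x = s /\ a y = s.
  by move: xS yS; rewrite !memS => /andP[/eqP -> _] /andP[/eqP -> _].
have lam_s : lam <= s.
  by have := pairS x y xS yS xy; case: axy; rewrite /a => h1 h2; lra.
(* From [pairS] the maximal defect is at least lam; three lines would have total defect at least 3
   lam, more than the 2 lam allowed. *)
have S'0 : S' = [::].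
  case: (S') sumS' sumS => [//|z' S''] /= -> h; exfalso.
  have : 3 * s <= (size S'').+3%:R * s by rewrite ler_wpM2r ?(ltW s_gt0)// ler_nat.
  lra.
rewrite {}S'0 in memS npS S0 Sinv v1S Q QA Q1 pairS sumS sumS' uS xS yS.
have wxy : wedge x y != 0 by exact: nonparallel_wedge npS xS yS xy.
have [x0 y0] : x != 0 /\ y != 0 by rewrite !S0.
have [ex ey] : 0 < enorm x /\ 0 < enorm y by rewrite !enorm_gt0.
have := @exchanged_lines_mean_lognorm ((enorm x)^-1 *: x) ((enorm y)^-1 *: y).
have unit w : 0 < enorm w -> enorm ((enorm w)^-1 *: w) = 1.
  by move=> w0; rewrite enormZ gtr0_norm ?invr_gt0// mulVf// gt_eqF.
have [ix iy] : (enorm x)^-1 != 0 /\ (enorm y)^-1 != 0 by rewrite !invr_eq0 !gt_eqF.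
have wZ c d w z' : c != 0 -> d != 0 ->
    (wedge (c *: w) (d *: z') == 0) = (wedge w z' == 0).
  by move=> c0 d0; rewrite wedgeZl wedgeZr !mulf_eq0 (negbTE c0) (negbTE d0).
have wZ0 c d w z' : wedge w z' = 0 -> wedge (c *: w) (d *: z') = 0.
  by rewrite wedgeZl wedgeZr => ->; rewrite !mulr0.
move=> /(_ (unit _ ex) (unit _ ey)); rewrite wZ// => /(_ wxy) h.
suff : lam <= 0 by rewrite leNgt lam_gt0.
apply: h hlam.
  move=> i; rewrite -!scalemxAr.
  have Ax0 : A0 i *m x != 0 by rewrite mulSL2_neq0.
  have Ay0 : A0 i *m y != 0 by rewrite mulSL2_neq0.
  have [u1 u1S h1] := Sinv x i xS; have [u2 u2S h2] := Sinv y i yS.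
  have diff : u1 != u2.
    apply/eqP => e; rewrite -{}e in h2 u2S.
    have [c _ Ec] := parallelP (S0 _ u1S) Ax0 h1; have [d _ Ed] := parallelP (S0 _ u1S) Ay0 h2.
    have := wedge_mul (A0 i) x y; rewrite Ec Ed wedgeZl wedgeZr dA mul1r => e.
    by move: wxy; rewrite -e /wedge [u1 0 0 * _]mulrC subrr !mulr0 eqxx.
  have sym w z' : wedge w z' = 0 -> wedge z' w = 0 by rewrite wedgeC => /eqP; rewrite oppr_eq0 => /eqP.
  move: u1S u2S diff h1 h2; rewrite !inE => /orP[] /eqP -> /orP[] /eqP ->; rewrite ?eqxx// => _ h1 h2.
    by left; split; apply: wZ0; exact: sym.
  by right; split; apply: wZ0; exact: sym.
(* Some letter must move the line of [x], since otherwise that line would be invariant. *)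
apply: contrapT => nx; apply: irr; exists <[x]>%VS; split; first by rewrite dim_vline x0.
move=> i w /vlineP[c ->]; rewrite -scalemxAr memvZ//.
have : wedge x (A0 i *m x) = 0.
  apply/eqP; rewrite wedgeC oppr_eq0; apply: contrapT => /negP hi; apply: nx; exists i.
  by rewrite -scalemxAr wZ.
by move=> /(wedge0P x0)[d ->]; rewrite memvZ// memv_line.
Qed.

End harmonic_rate.

(** * Rates along an ultrafilter and uniform stretching *)

Section full_rate.
Variable lam : R.
Hypotheses (lam_gt0 : 0 < lam) (hlam : forall n, lam * n%:R <= mean_lognorm n).
Hypothesis irr : irreducible_family A0.

Variable U : set_system nat.
Hypotheses (UU : UltraFilter U) (Uoo : \oo `<=` U).

Let UP : ProperFilter U := ultra_proper.

Let ucvg (s : nat -> R) (l1 l2 : R) : s @ U --> l1 -> s @ U --> l2 -> l1 = l2.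
Proof. by move=> h1 h2; exact: (cvg_unique (@Rhausdorff R) h1 h2). Qed.

Let eqcvg (s s' : nat -> R) (l : R) : s @ U --> l -> s =1 s' -> s' @ U --> l.
Proof. by move=> h /funext <-. Qed.

Let cvgDu (s s' : nat -> R) (l l' : R) : s @ U --> l -> s' @ U --> l' ->
  (fun n => s n + s' n) @ U --> l + l'.
Proof. by move=> h h'; apply: cvgD. Qed.

Let cvgMu (s s' : nat -> R) (l l' : R) : s @ U --> l -> s' @ U --> l' ->
  (fun n => s n * s' n) @ U --> l * l'.
Proof. by move=> h h'; apply: cvgM. Qed.

Let cvg_ultra (s : nat -> R) (l : R) : s @ \oo --> l -> s @ U --> l.
Proof. by move=> h A hA; apply: Uoo; exact: h. Qed.

(** By compactness the values have a cluster point; an ultrafilter converges to each of its cluster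
    points. *)
Lemma ultra_bounded_cvg (s : nat -> R) K :
  (forall n, `|s n| <= K) -> exists l : R, s @ U --> l.
Proof.
move=> hK; have := @segment_compact R (- K) K.
move=> /(_ (s @ U) _) [|l [_ cl]].
  suff : U (s @^-1` `[- K, K]%classic) by [].
  by apply: filterS filterT => n _; rewrite /= in_itv /= -ler_norml.
exists l => B nB; have [//|nUB] := in_ultra_setVsetC (s @^-1` B) UU.
have [x [/= h1 h2]] := cl (~` B) B nUB nB.
by [].
Qed.

(* A limit along an ultrafilter exists for every vector and is exactly harmonic
   and additive, where a liminf would only give inequalities. *)
Let rate v n : R := n.+1%:R^-1 * mean_log n v.
Let b v : R := xget 0 [set l : R | rate v @ U --> l].

Let b_cvg v : v != 0 -> rate v @ U --> b v.
Proof.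
move=> v0; have [|l hl] := @ultra_bounded_cvg (rate v) (ln C0 + `|ln (enorm v)|).
  move=> n; rewrite /rate normrM gtr0_norm ?invr_gt0// ler_pdivrMl//.
  have := mean_log_bound n v0 => h.
  have h1 : `|mean_log n v| <= n%:R * ln C0 + `|ln (enorm v)|.
    by rewrite -[mean_log n v](subrK (ln (enorm v))) (le_trans (ler_normD _ _))// lerD2r.
  rewrite (le_trans h1)// mulrDr lerD//; first by rewrite ler_wpM2r// ler_nat.
  by rewrite ler_peMl// ler1n.
by rewrite /b; case: xgetP => [//|/(_ l)].
Qed.

Let cvg_rate_unique v (l : R) : v != 0 -> rate v @ U --> l -> b v = l.
Proof. by move=> v0 hl; exact: ucvg (b_cvg v0) hl. Qed.

Let harm0 : (fun n => n.+1%:R^-1 : R) @ U --> (0 : R).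
Proof. by apply: cvg_ultra; exact: cvg_harmonic. Qed.

Let harmK (K : R) : (fun n => n.+1%:R^-1 * K) @ U --> (0 : R).
Proof. by rewrite -[X in _ --> X](mul0r K); apply: cvgM => //; exact: cvg_cst. Qed.

Let cvg_sum_seq (I : Type) (s : seq I) (F : I -> nat -> R) (l : I -> R) :
  (forall i, F i @ U --> l i) ->
  (fun n => \sum_(i <- s) F i n) @ U --> \sum_(i <- s) l i.
Proof.
move=> h; elim: s => [|i s ih].
  by rewrite big_nil; under eq_fun do rewrite big_nil; exact: cvg_cst.
by rewrite big_cons; under eq_fun do rewrite big_cons; exact: cvgD.
Qed.

Let b_harm v : v != 0 -> b v = \sum_i p i * b (A0 i *m v).
Proof.
move=> v0.
have h1 : (fun n => \sum_i p i * rate (A0 i *m v) n) @ U --> \sum_i p i * b (A0 i *m v).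
  apply: cvg_sum_seq => i; apply: cvgM; first exact: cvg_cst.
  by apply: b_cvg; rewrite mulSL2_neq0.
(* Harmonicity relates length [n.+1] to length [n]; the one-step difference is bounded and vanishes
   in the limit. *)
have d0 : (fun n => n.+1%:R^-1 * (mean_log n.+1 v - mean_log n v)) @ U --> (0 : R).
  apply: (@squeeze_cvgr _ _ _ _ (fun n => n.+1%:R^-1 * - ln C0) (fun n => n.+1%:R^-1 * ln C0)).
  - apply: filterS filterT => n _; have := mean_log_step n v0; rewrite ler_norml => /andP[h2 h3].
    by rewrite !ler_pM2l ?invr_gt0// h2.
  - exact: harmK.
  - exact: harmK.
have h2 := cvgDu (b_cvg v0) d0; rewrite addr0 in h2.
apply: (ucvg h2); apply: (eqcvg h1) => n; rewrite /rate -mulrDr addrC subrK mean_logS mulr_sumr.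
by apply: eq_bigr => i _; rewrite mulrCA.
Qed.

Let bZ c v : c != 0 -> v != 0 -> b (c *: v) = b v.
Proof.
move=> c0 v0; apply: cvg_rate_unique.
  by rewrite -enorm_gt0 enormZ mulr_gt0 ?normr_gt0 ?enorm_gt0.
have h := cvgDu (harmK (ln `|c|)) (b_cvg v0); rewrite add0r in h.
by apply: (eqcvg h) => n; rewrite /rate mean_logZ// mulrDr.
Qed.

Let b_sum s : nonparallel s -> (forall v, v \in s -> v != 0) -> (1 < size s)%N ->
  ((size s)%:R - 2) * lam <= \sum_(v <- s) b v.
Proof.
move=> np s0 s2; have [C hC] := sum_mean_log_ge np s0.
have h0 : 0 <= (size s)%:R - 2 :> R by rewrite subr_ge0 ler_nat.
pose k : R := ((size s)%:R - 2) * lam.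
(* This is (k n - C) / (n + 1); the shifted denominator of [rate] accounts for the extra [k]. *)
have h1 : (fun n => k + n.+1%:R^-1 * (- (k + C))) @ U --> k.
  by rewrite -[X in _ --> X]addr0; apply: cvgD; [exact: cvg_cst|exact: harmK].
have h2 : (fun n => \sum_(v <- s) (if v != 0 then rate v n else b v)) @ U --> \sum_(v <- s) b v.
  by apply: cvg_sum_seq => v; case: eqVneq => [_|v0]; [exact: cvg_cst|exact: b_cvg].
apply: (ler_cvg_to h1 h2); apply: filterS filterT => n _.
have -> : \sum_(v <- s) (if v != 0 then rate v n else b v) =
    n.+1%:R^-1 * \sum_(v <- s) mean_log n v.
  by rewrite mulr_sumr; apply: eq_big_seq => v /s0 ->.
have e (y : R) : y + 1 != 0 -> k + (y + 1)^-1 * (- (k + C)) = (y + 1)^-1 * (k * y - C).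
  by move=> y1; field.
have {e} -> : k + n.+1%:R^-1 * (- (k + C)) = n.+1%:R^-1 * (k * n%:R - C).
  by rewrite -natr1 e// natr1.
rewrite ler_pM2l ?invr_gt0// (le_trans _ (hC n))// lerD2r -mulrBl -mulrA.
by rewrite ler_wpM2l.
Qed.

Let b_pair u v D : u != 0 -> v != 0 ->
  (forall n, mean_log n u + mean_log n v <= D) -> b u + b v <= 0.
Proof.
move=> u0 v0 h.
have hb := cvgDu (b_cvg u0) (b_cvg v0).
apply: (ler_cvg_to hb (harmK D)).
by apply: filterS filterT => n _; rewrite /rate -mulrDr ler_pM2l ?invr_gt0.
Qed.

Lemma full_rate v : v != 0 -> lam <= b v.
Proof. exact: (@harmonic_rate_ge lam lam_gt0 hlam irr b b_harm bZ b_sum b_pair v). Qed.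

Lemma full_rate_le v e : v != 0 -> (forall n, (0 < n)%N -> mean_log n v <= n%:R * (lam - e)) ->
  0 < e -> False.
Proof.
move=> v0 h e0; have := full_rate v0; apply/negP; rewrite -ltNge.
apply: (@le_lt_trans _ _ (lam - e)); last by rewrite ltrBlDr ltrDl.
have h1 : (fun n => (lam - e) + n.+1%:R^-1 * (`|ln (enorm v)| + `|lam - e|)) @ U --> lam - e.
  by rewrite -[X in _ --> X]addr0; apply: cvgD; [exact: cvg_cst|exact: harmK].
apply: (ler_cvg_to (b_cvg v0) h1); apply: filterS filterT => n _.
have e1 (y c d : R) : y + 1 != 0 -> c + (y + 1)^-1 * d = (y + 1)^-1 * ((y + 1) * c + d).
  by move=> y1; field.
rewrite /rate -natr1 e1 ?natr1// ler_pM2l ?invr_gt0//.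
have hn := ler_norm (- (lam - e)); rewrite normrN in hn.
case: n => [|n]; first by rewrite mean_log0 mul1r; have := ler_norm (ln (enorm v)); lra.
have := h n.+1 isT; rewrite -(natr1 n.+1) mulrDl mul1r.
have := normr_ge0 (ln (enorm v)); lra.
Qed.

(** Compactness of the circle: a limit along [U] of unit vectors that grow too slowly up to time [k]
    grows too slowly at every positive time, by [mean_log_lip], contradicting [full_rate_le]. *)
Let uniform_rate e : 0 < e -> exists N : nat, forall v, enorm v = 1 ->
  exists n, (0 < n <= N)%N /\ n%:R * (lam - e) <= mean_log n v.
Proof.
move=> e0; apply: contrapT => hN.
have /choice[vs hvs] : forall k, exists v, enorm v = 1 /\
    forall n, (0 < n <= k)%N -> mean_log n v < n%:R * (lam - e).
  move=> k; apply: contrapT => h; apply: hN; exists k => v ev.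
  apply: contrapT => h2; apply: h; exists v; split=> // n hn.
  by rewrite ltNge; apply/negP => h3; apply: h2; exists n.
have ev k : enorm (vs k) = 1 by case: (hvs k).
have vb i k : `|vs k i 0| <= 1 by rewrite -(ev k) coord_le_enorm.
have [x hx] := @ultra_bounded_cvg (fun k => vs k 0 0) 1 (vb 0).
have [y hy] := @ultra_bounded_cvg (fun k => vs k 1 0) 1 (vb 1).
pose v : 'cV[R]_2 := \col_i (if i == 0 then x else y).
have v0E : v 0 0 = x by rewrite mxE. have v1E : v 1 0 = y by rewrite mxE.
have sq : x ^+ 2 + y ^+ 2 = 1.
  apply: (ucvg (cvgDu (cvgMu hx hx) (cvgMu hy hy))).
  apply: (eqcvg (cvg_cst (1 : R))) => k; have := enorm_sq (vs k); rewrite ev expr1n -!expr2.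
  by move=> <-.
have env : enorm v = 1 by rewrite enormE v0E v1E sq sqrtr1.
have vn0 : v != 0 by rewrite -enorm_gt0 env.
have wcvg : (fun k => wedge v (vs k)) @ U --> (0 : R).
  rewrite [X in _ --> X](_ : 0 = x * y - y * x); last by ring.
  rewrite /wedge v0E v1E; apply: cvgB; apply: cvgM => //; exact: cvg_cst.
apply: (full_rate_le vn0 _ e0) => n n0.
have sdE k : sdist v (vs k) = `|wedge v (vs k)| by rewrite /sdist env ev mulr1 divr1.
have h1 : (fun k => n%:R * (lam - e) + (C0 ^+ 2) ^+ n * `|wedge v (vs k)|) @ U -->
    n%:R * (lam - e) + (C0 ^+ 2) ^+ n * `|0 : R|.
  apply: cvgD; first exact: cvg_cst.
  by apply: cvgM; [exact: cvg_cst|exact: cvg_norm].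
rewrite normr0 mulr0 addr0 in h1.
apply: (ler_cvg_to (cvg_cst (mean_log n v)) h1).
have : U [set k | (n <= k)%N] by apply: Uoo; exists n.
apply: filterS => k /= nk; have vk0 : vs k != 0 by rewrite -enorm_gt0 ev.
have := mean_log_lip n vn0 vk0; rewrite env ev ln1 !subr0 sdE.
by case: (hvs k) => _ /(_ n); rewrite n0 nk => /(_ isT); lra.
Qed.

(** The good length in [uniform_rate] depends on the vector. Concatenating good blocks, the next one
    chosen for the image vector, gives any long common length with a bounded loss. *)
Lemma uniform_growth_aux e : 0 < e -> exists2 n, (0 < n)%N &
  forall v, v != 0 -> n%:R * (lam - e) <= mean_log n v - ln (enorm v).
Proof.
move=> e0; have e2 : 0 < e / 2 by rewrite divr_gt0.
have [N hN] := uniform_rate e2.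
(* Pays for the last, incomplete block: it may contract by [ln C0] per letter where [lam] was
   expected. *)
pose C := N%:R * (ln C0 + lam).
have hN' v : v != 0 -> exists n, (0 < n <= N)%N /\ n%:R * (lam - e / 2) <= mean_log n v - ln (enorm v).
  move=> v0; have ev : 0 < enorm v by rewrite enorm_gt0.
  have iv : (enorm v)^-1 != 0 by rewrite invr_eq0 gt_eqF.
  have [|n [hn hr]] := hN ((enorm v)^-1 *: v).
    by rewrite enormZ gtr0_norm ?invr_gt0// mulVf// gt_eqF.
  exists n; split=> //; move: hr; rewrite mean_logZ// gtr0_norm ?invr_gt0// lnV ?posrE//.
  by rewrite [- _ + _]addrC.
have long k v : v != 0 -> k%:R * (lam - e / 2) - C <= mean_log k v - ln (enorm v).
  elim/ltn_ind: k v => k ih v v0.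
  have [kN|Nk] := leqP k N.
    have := mean_log_bound k v0; rewrite ler_norml => /andP[h _].
    apply: le_trans h; rewrite /C.
    have h1 : k%:R * (ln C0 + lam) <= N%:R * (ln C0 + lam).
      by rewrite ler_wpM2r ?ler_nat// addr_ge0// ltW.
    have h2 : 0 <= k%:R * (e / 2) by rewrite mulr_ge0// ltW.
    lra.
  have [n [/andP[n0 nN] hn]] := hN' v v0.
  have nk : (n <= k)%N by rewrite (leq_trans nN)// ltnW.
  rewrite -(subnKC nk) mean_logD natrD.
  have : markovn n (fun M => ln (enorm (M *m v)) + ((k - n)%:R * (lam - e / 2) - C)) 1%:M <=
      markovn n (fun M => mean_log (k - n) (M *m v)) 1%:M.
    apply: (@markovn_le (fun M => \det M = 1)) => // M dM.
    rewrite -lerBrDl; apply: ih; last by rewrite mulSL2_neq0.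
    by rewrite ltn_subrL n0 (leq_trans n0).
  rewrite markovnDf markovn_cst -/(mean_log n v) => h.
  lra.
pose k := (Num.truncn (C / (e / 2))).+1.
exists k => // v v0; have := long k v v0.
have : C <= k%:R * (e / 2) by rewrite -ler_pdivrMr// ltW// truncnS_gt.
lra.
Qed.

End full_rate.

Lemma uniform_growth (lam e : R) : 0 < lam -> (forall n, lam * n%:R <= mean_lognorm n) ->
  irreducible_family A0 -> 0 < e -> exists2 n, (0 < n)%N &
  forall v, v != 0 -> n%:R * (lam - e) <= mean_log n v - ln (enorm v).
Proof.
move=> l0 hl irr e0.
have [U [UU Uoo]] := ultraFilterLemma (F := \oo) _.
exact: (@uniform_growth_aux lam l0 hl irr U UU Uoo e e0).
Qed.

End markov.

(** * Perturbation of locally constant cocycles *)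

Section resampling.
Variables (R : realType) (m : nat) (p : 'I_m.+1 -> R).
Hypothesis hp : positive_probability_vector p.
Local Notation X := (shift_space m).
Implicit Types (x y : X) (phi psi : X -> R) (a n k N : nat).

Let p_gt0 i : 0 < p i. Proof. by case: hp => + _; exact. Qed.

Definition avg (j : int) phi x : R := \sum_i p i * phi (upd x j i).

(* The mean of [phi] over the letters in [a, a + n), the others being fixed. *)
Fixpoint avgn a n phi : X -> R :=
  if n is k.+1 then avgn a k (avg (a + k)%N phi) else phi.

Lemma avg_le j phi psi : (forall x, phi x <= psi x) -> forall x, avg j phi x <= avg j psi x.
Proof. by move=> h x; apply: mean_le => // i; exact: h. Qed.

Lemma avgn_le a n phi psi x : (forall x, phi x <= psi x) -> avgn a n phi x <= avgn a n psi x.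
Proof.
elim: n phi psi x => [|n ih] phi psi x h; first exact: h.
by apply: ih; exact: avg_le.
Qed.

Lemma eq_avgn a n phi psi x : (forall y, phi y = psi y) -> avgn a n phi x = avgn a n psi x.
Proof. by move=> /funext ->. Qed.

Lemma avgnD a n phi psi x :
  avgn a n (fun x => phi x + psi x) x = avgn a n phi x + avgn a n psi x.
Proof.
elim: n phi psi x => [//|n ih] phi psi x /=; rewrite -ih.
congr avgn; apply/funext => y; rewrite /avg -big_split /=.
by apply: eq_bigr => i _; rewrite mulrDr.
Qed.

Lemma avgnZ a n c phi x : avgn a n (fun x => c * phi x) x = c * avgn a n phi x.
Proof.
elim: n phi x => [//|n ih] phi x /=; rewrite -ih.
congr avgn; apply/funext => y; rewrite /avg mulr_sumr.
by apply: eq_bigr => i _; rewrite mulrCA.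
Qed.

Lemma avgn_cst a n c x : avgn a n (fun=> c) x = c.
Proof.
elim: n x => [//|n ih] x /=; rewrite -[RHS](ih x).
by congr avgn; apply/funext => y; rewrite /avg mean_cst.
Qed.

Lemma avgn_sum a n (I : Type) (s : seq I) (F : I -> X -> R) x :
  avgn a n (fun x => \sum_(i <- s) F i x) x = \sum_(i <- s) avgn a n (F i) x.
Proof.
elim: s => [|i s ih].
  rewrite big_nil -[RHS](avgn_cst a n 0 x).
  by congr avgn; apply/funext => y; rewrite big_nil.
rewrite big_cons -ih -avgnD.
by congr avgn; apply/funext => y; rewrite big_cons.
Qed.

Lemma updC x (j k : int) i i' : j != k -> upd (upd x j i) k i' = upd (upd x k i') j i.
Proof.
move=> jk; apply/funext => n; rewrite /upd.
by have [->|//] := eqVneq n k; rewrite eq_sym (negbTE jk).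
Qed.

Lemma upd_upd x j i i' : upd (upd x j i) j i' = upd x j i'.
Proof. by apply/funext => n; rewrite /upd; case: eqP. Qed.

Lemma avgC (j k : int) phi : j != k -> avg j (avg k phi) = avg k (avg j phi).
Proof.
move=> jk; apply/funext => x; rewrite /avg.
under eq_bigr do rewrite mulr_sumr.
rewrite exchange_big; apply: eq_bigr => i _; rewrite mulr_sumr; apply: eq_bigr => i' _.
by rewrite mulrCA updC.
Qed.

Lemma avg_avg j phi : avg j (avg j phi) = avg j phi.
Proof.
apply/funext => x; rewrite /avg.
under eq_bigr do under eq_bigr do rewrite upd_upd.
exact: mean_cst.
Qed.

Lemma avgn_avg N k phi : (k < N)%N -> avgn 0 N (avg k phi) = avgn 0 N phi.
Proof.
elim: N phi => [//|N ih] phi; rewrite ltnS leq_eqVlt => /predU1P[->|kN] /=.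
  by rewrite add0n avg_avg.
by rewrite add0n avgC ?ih//; lia.
Qed.

(** Tower property: one block may be averaged first, with all other letters frozen. *)
Lemma avgn_avgn N a n phi : (a + n <= N)%N -> avgn 0 N (avgn a n phi) = avgn 0 N phi.
Proof.
elim: n phi => [//|n ih] phi h /=; rewrite ih; last by rewrite (leq_trans _ h)// leq_add2l.
by rewrite avgn_avg// (leq_trans _ h)// addnS.
Qed.

Definition off a n x y := forall j : int, ~~ ((a%:Z <= j) && (j < (a + n)%:Z)) -> y j = x j.

Lemma avgn_ext a n phi psi x : (forall y, off a n x y -> phi y = psi y) ->
  avgn a n phi x = avgn a n psi x.
Proof.
elim: n phi psi x => [|n ih] phi psi x h /=; first by apply: h => j _.
apply: ih => y hy; rewrite /avg; apply: eq_bigr => i _; congr (_ * _); apply: h => j hj.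
rewrite upd_neq; last by apply: contra hj => /eqP ->; lia.
by apply: hy; apply: contra hj; lia.
Qed.

Lemma avg_bm mu j phi : is_bernoulli p mu -> bm phi ->
  bm (avg j phi) /\ Ex mu (avg j phi) = Ex mu phi.
Proof.
move=> hmu b; split; last by rewrite -(bernoulli_resample hp hmu j b).
apply: bm_sum => i; apply: bmZ.
exact: (bm_comp (@measurable_upd m j i)).
Qed.

Lemma Ex_avgn mu a n phi : is_bernoulli p mu -> bm phi ->
  bm (avgn a n phi) /\ Ex mu (avgn a n phi) = Ex mu phi.
Proof.
move=> hmu; elim: n phi => [//|n ih] phi b /=.
have [b' e'] := avg_bm (a + n)%N hmu b.
by have [b'' ->] := ih _ b'.
Qed.

Variable A0 : 'I_m.+1 -> 'M[R]_2.

Definition locally_constant x := A0 (x 0).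
Local Notation A := locally_constant.

Lemma cocycle_off n a x y : (forall j : int, a%:Z <= j < (a + n)%:Z -> x j = y j) ->
  cocycle A n (iter a (@shift m) x) = cocycle A n (iter a (@shift m) y).
Proof.
elim: n => [//|n ih] h /=; rewrite ih; last by move=> j hj; apply: h; lia.
congr (_ *m _); rewrite /A -!iterD !iter_shift; congr A0; apply: h; lia.
Qed.

Lemma avgn_word a n (phi : 'M[R]_2 -> R) x :
  avgn a n (fun y => phi (cocycle A n (iter a (@shift m) y))) x = markovn p A0 n phi 1%:M.
Proof.
elim: n phi x => [//|n ih] phi x; rewrite markovnSr -(ih _ x) /=.
congr avgn; apply/funext => y; rewrite /avg /markov; apply: eq_bigr => i _.
rewrite (@cocycle_off n a (upd y (a + n)%N i) y); last first.
  by move=> j hj; rewrite upd_neq//; lia.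
by rewrite {1}/A -iterD iter_shift add0r addnC updE.
Qed.

(** The form in which independence is used: whatever does not depend on the letters of the block may
    be frozen while the word over the block is averaged. *)
Lemma avgn_word_dep a n (Phi : X -> 'M[R]_2 -> R) x :
  (forall y, off a n x y -> Phi y = Phi x) ->
  avgn a n (fun y => Phi y (cocycle A n (iter a (@shift m) y))) x =
  markovn p A0 n (Phi x) 1%:M.
Proof.
by move=> h; rewrite -(avgn_word a n (Phi x) x); apply: avgn_ext => y /h ->.
Qed.

End resampling.

(** * Fiber bunching turned into a contraction of small moments *)

Section small_exponent.
Variables (R : realType) (m : nat) (p : 'I_m.+1 -> R) (A0 : 'I_m.+1 -> 'M[R]_2).
Hypothesis hp : positive_probability_vector p.
Hypothesis dA : forall i, \det (A0 i) = 1.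
Variable C0 : R.
Hypotheses (C1 : 1 <= C0) (AC : forall i, opnorm (A0 i) <= C0).

Lemma markovn_le_words n (phi psi : 'M[R]_2 -> R) :
  (forall M, \det M = 1 -> opnorm M <= C0 ^+ n -> phi M <= psi M) ->
  markovn p A0 n phi 1%:M <= markovn p A0 n psi 1%:M.
Proof.
suff gen k M : \det M = 1 -> opnorm M <= C0 ^+ k ->
    (forall M, \det M = 1 -> opnorm M <= C0 ^+ (n + k) -> phi M <= psi M) ->
    markovn p A0 n phi M <= markovn p A0 n psi M.
  by move=> h; apply: (gen 0%N); rewrite ?det1 ?addn0// expr0 opnorm1_le.
elim: n k M => [|n ih] k M dM oM h; first exact: h.
rewrite !markovnS; apply: mean_le => // i; apply: (ih k.+1).
- by rewrite det_mulmx dA dM mulr1.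
- rewrite exprS (le_trans (opnormM _ _))// ler_pM ?opnorm_ge0//.
- by move=> N dN oN; apply: h => //; rewrite addSnnS.
Qed.

(** Since exp(-y) >= 1 - y, it suffices that the right-hand side times 1 - y is at least 1; it
    equals 1 + y^2 (1 - 2y). *)
Lemma expR_le_quadratic (y : R) : y <= 1 / 2 -> expR y <= 1 + y + 2 * y ^+ 2.
Proof.
move=> hy; have h := expR_ge1Dx (- y).
have h1 : 0 < 1 - y by lra.
have e0 := expR_gt0 y.
have h2 : expR y * (1 - y) <= 1.
  apply: (@le_trans _ _ (expR y * expR (- y))); first by rewrite ler_pM2l.
  by rewrite -expRD subrr expR0.
have h3 : 1 <= (1 + y + 2 * y ^+ 2) * (1 - y).
  have -> : (1 + y + 2 * y ^+ 2) * (1 - y) = 1 + y ^+ 2 * (1 - 2 * y) by ring.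
  by rewrite lerDl mulr_ge0 ?sqr_ge0//; lra.
by rewrite -(ler_pM2r h1) (le_trans h2).
Qed.

(* At s = 0 the left-hand side is 1 and its derivative is
   [2 * mean_lognorm p A0 q + q%:R * ln r]. *)
Lemma small_exponent (r : R) q : 0 < r -> 2 * mean_lognorm p A0 q + q%:R * ln r < 0 ->
  exists s, [/\ 0 < s, s <= 1 &
    (r `^ s) ^+ q * markovn p A0 q (fun M => opnorm M `^ (2 * s)) 1%:M < 1].
Proof.
move=> r0; set y := - (2 * mean_lognorm p A0 q + q%:R * ln r) => hy.
have y0 : 0 < y by rewrite oppr_gt0.
pose Y M := 2 * ln (opnorm M) + q%:R * ln r.
pose D := 2 * (q%:R * ln C0) + q%:R * `|ln r|.
have lC0 : 0 <= ln C0 by exact: ln_ge0.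
have D0 : 0 <= D by rewrite addr_ge0 ?mulr_ge0.
have YD M : \det M = 1 -> opnorm M <= C0 ^+ q -> `|Y M| <= D.
  move=> dM oM; have l0 := ln_opnorm_ge0 dM.
  have e1 : `|2 * ln (opnorm M)| = 2 * ln (opnorm M) by rewrite ger0_norm// mulr_ge0.
  have e2 : `|q%:R * ln r| = q%:R * `|ln r| by rewrite normrM ger0_norm.
  rewrite (le_trans (ler_normD _ _))// e1 e2 lerD2r ler_pM2l// mulr_natl -lnXn ?(lt_le_trans ltr01)//.
  by rewrite ler_ln ?posrE ?opnorm_gt0 ?exprn_gt0// (lt_le_trans ltr01).
have EY : markovn p A0 q Y 1%:M = - y.
  by rewrite /y opprK /Y markovnDf markovnZ markovn_cst.
have yD : y <= D.
  rewrite -[y]opprK -EY -[D](markovn_cst A0 hp q _ 1%:M) -[- markovn _ _ _ _ _]mulN1r -markovnZ.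
  apply: markovn_le_words => M dM oM; rewrite mulN1r.
  by rewrite (le_trans (ler_norm _))// normrN YD.
(* [D] bounds [Y] on words of length [q]. This [s] keeps the exponents below 1/2 and makes the
   quadratic error at most half of the linear gain s y. *)
pose s := y / (4 * (D + 1) ^+ 2).
have D1 : 0 < D + 1 by lra.
have den : 0 < 4 * (D + 1) ^+ 2 by rewrite mulr_gt0// exprn_gt0.
have s0 : 0 < s by rewrite divr_gt0.
have sD : s * D <= 1 / 4.
  rewrite mulrAC ler_pdivrMr//.
  have : y * D <= D * D by rewrite ler_wpM2r.
  have -> : 1 / 4 * (4 * (D + 1) ^+ 2) = D * D + 2 * D + 1 by field.
  lra.
have s1 : s <= 1.
  rewrite ler_pdivrMr// mul1r.
  have -> : 4 * (D + 1) ^+ 2 = 4 * (D * D) + 8 * D + 4 by ring.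
  have : 0 <= D * D by rewrite mulr_ge0.
  lra.
exists s; split=> //.
have e1 M : \det M = 1 -> (r `^ s) ^+ q * opnorm M `^ (2 * s) = expR (s * Y M).
  move=> dM; rewrite -powR_mulrn ?powR_ge0// -powRrM.
  rewrite /powR !gt_eqF ?opnorm_gt0// -expRD; congr expR; rewrite /Y; ring.
have sq : 2 * (s * D) ^+ 2 <= s * y / 2.
  have h1 : s * (D + 1) ^+ 2 = y / 4 by rewrite /s; field; rewrite gt_eqF.
  have h2 : s * D ^+ 2 <= y / 4.
    by rewrite -h1 ler_pM2l// ler_pXn2r ?nnegrE//; lra.
  have -> : 2 * (s * D) ^+ 2 = (2 * s) * (s * D ^+ 2) by ring.
  have -> : s * y / 2 = (2 * s) * (y / 4) by field.
  by rewrite ler_pM2l// mulr_gt0.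
rewrite -markovnZ.
apply: (@le_lt_trans _ _ (markovn p A0 q (fun M => (1 + 2 * (s * D) ^+ 2) + s * Y M) 1%:M)).
  apply: markovn_le_words => M dM oM; rewrite e1//.
  have sYD : `|s * Y M| <= s * D by rewrite normrM gtr0_norm// ler_pM2l// YD.
  have h1 := le_trans (ler_norm _) sYD.
  have h2 : (s * Y M) ^+ 2 <= (s * D) ^+ 2.
    rewrite -[leLHS]real_normK ?num_real// ler_pXn2r ?nnegrE// mulr_ge0// ltW//.
  have h3 : s * Y M <= 1 / 2 by lra.
  by have := expR_le_quadratic h3; lra.
rewrite markovnDf markovn_cst// markovnZ EY.
have : 0 < s * y by rewrite mulr_gt0.
lra.
Qed.

End small_exponent.

(** If some term is at least 1, so is its power, which dominates [x]; otherwise each term is at most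
    its own power. *)
Lemma le_sum_powR (R : realType) (I : eqType) (u : seq I) (t : I -> R) (x s : R) :
  0 < s -> s <= 1 -> (forall i, 0 <= t i) -> x <= 1 -> x <= \sum_(i <- u) t i ->
  x <= \sum_(i <- u) t i `^ s.
Proof.
move=> s0 s1 t0 x1 hx.
have [/hasP[i iu ti]|] := boolP (has (fun i => 1 <= t i) u).
  rewrite (perm_big _ (perm_to_rem iu)) big_cons /=.
  have h1 : 1 <= t i `^ s.
    rewrite [leLHS](_ : 1 = 1 `^ s); last by rewrite powR1.
    by rewrite ge0_ler_powR ?nnegrE ?(ltW s0).
  rewrite (le_trans x1)// (le_trans h1)// lerDl sumr_ge0// => j _.
  exact: powR_ge0.
rewrite -all_predC => /allP h; rewrite (le_trans hx)// big_seq [leRHS]big_seq.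
apply: ler_sum => i /h /=; rewrite -ltNge => ti.
have [->|ti0] := eqVneq (t i) 0; first exact: powR_ge0.
by apply: ger1_powR => //; rewrite lt0r ti0 t0 ltW.
Qed.

Lemma sum_geometric_blocks (R : realType) (th : R) q J : (0 < q)%N ->
  0 <= th -> th < 1 -> \sum_(t <- iota 0 J) th ^+ (t %/ q) <= q%:R / (1 - th).
Proof.
move=> q0 th0 th1; have h1 : 0 < 1 - th by rewrite subr_gt0.
have full k : \sum_(t <- iota 0 (k * q)) th ^+ (t %/ q) = q%:R * (1 - th ^+ k) / (1 - th).
  elim: k => [|k ih]; first by rewrite mul0n big_nil expr0 subrr mulr0 mul0r.
  rewrite mulSnr iotaD big_cat /= ih add0n.
  have -> : \sum_(t <- iota (k * q) q) th ^+ (t %/ q) = q%:R * th ^+ k.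
    rewrite -[in RHS](size_iota (k * q) q) mulr_natl -sumr_const_seq.
    apply: eq_big_seq => t; rewrite mem_iota => /andP[h2 h3]; congr (_ ^+ _).
    apply/eqP; rewrite eqn_leq leq_divRL// h2 andbT -ltnS ltn_divLR//.
    by rewrite mulSnr.
  by rewrite exprS; field; rewrite gt_eqF.
apply: (@le_trans _ _ (\sum_(t <- iota 0 (J * q)) th ^+ (t %/ q))).
  have JJ : (J <= J * q)%N by rewrite leq_pmulr.
  rewrite -(subnKC JJ) iotaD big_cat /= lerDl sumr_ge0// => i _.
  exact: exprn_ge0.
rewrite full ler_pM2r ?invr_gt0// -[leRHS]mulr1 ler_wpM2l// gerBl.
exact: exprn_ge0.
Qed.

Lemma powR_exprC (R : realType) (a s : R) n : 0 <= a -> (a ^+ n) `^ s = (a `^ s) ^+ n.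
Proof.
move=> a0; elim: n => [|n ih]; first by rewrite !expr0 powR1.
by rewrite !exprS powRM ?exprn_ge0// ih.
Qed.

(** * Growth of vectors under a cocycle close to a locally constant one *)

Section perturbation.
Variables (R : realType) (m : nat) (p : 'I_m.+1 -> R) (A0 : 'I_m.+1 -> 'M[R]_2).
Hypothesis hp : positive_probability_vector p.
Hypothesis dA : forall i, \det (A0 i) = 1.
Variable C0 : R.
Hypotheses (C1 : 1 <= C0) (AC : forall i, opnorm (A0 i) <= C0).
Local Notation X := (shift_space m).
Local Notation A := (locally_constant A0).
Local Notation f := (@shift m).

Variables (B : X -> 'M[R]_2) (e r : R).
Hypotheses (e0 : 0 <= e) (e1 : e <= 1) (r0 : 0 < r) (r1 : r <= 1).
Hypothesis dB : forall x, \det (B x) = 1.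
Hypothesis BA : forall x, opnorm (B x - A x) <= e.
(** With M positive the zeroth letters agree and the values of [A] cancel; what remains is the
    variation of [B - A], whence the factor [e]. *)
Hypothesis Bagree : forall x y M, (0 < M)%N -> agree x y M ->
  opnorm (B x - B y) <= e * r ^+ M.

Let D := C0 + 1.

Let D1 : 1 <= D. Proof. by rewrite (le_trans C1)// lerDl. Qed.
Let D0 : 0 <= D. Proof. exact: le_trans D1. Qed.

Let AD x : opnorm (A x) <= D.
Proof. by rewrite (le_trans (AC _))// lerDl. Qed.

Let dAx x : \det (A x) = 1. Proof. exact: dA. Qed.

Lemma perturbation_opnorm x : opnorm (B x) <= D.
Proof.
rewrite (le_trans (opnorm_sub_le (B x) (A x)))// lerD//; first exact: AC.
exact: le_trans (BA x) e1.
Qed.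

Let BD := perturbation_opnorm.

Let K n : R := n%:R * D ^+ n.

Let K_ge0 n : 0 <= K n. Proof. by rewrite mulr_ge0// exprn_ge0. Qed.

Let block_close n y : opnorm (cocycle B n y - cocycle A n y) <= K n * e.
Proof. by apply: cocycle_close => // i _; exact: BA. Qed.

Let detA n y : \det (cocycle A n y) = 1. Proof. exact: det_cocycle. Qed.
Let detB n y : \det (cocycle B n y) = 1. Proof. exact: det_cocycle. Qed.

(** The additive error becomes a factor because the norm of [A^n] is at least 1. *)
Let block_opnorm n y :
  opnorm (cocycle B n y) <= (1 + K n * e) * opnorm (cocycle A n y).
Proof.
have h := opnorm_sub_le (cocycle B n y) (cocycle A n y).
have h1 := block_close n y; have h2 := opnorm_ge1 (detA n y).
have : K n * e * 1 <= K n * e * opnorm (cocycle A n y).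
  by rewrite ler_wpM2l// mulr_ge0.
lra.
Qed.

Variables (s : R) (q : nat).
Hypotheses (s0 : 0 < s) (s1 : s <= 1) (q0 : (0 < q)%N).

Let kappa0 := markovn p A0 q (fun M => opnorm M `^ (2 * s)) 1%:M.
Let c := (1 + K q * e) `^ (2 * s).

Let s2_ge0 : 0 <= 2 * s. Proof. by rewrite mulr_ge0// ltW. Qed.

(** Blocks of [B] are not independent. Each block of length [q] is replaced by the corresponding
    block of [A], at the cost of the factor [c]; blocks of [A] read disjoint sets of letters, so the
    mean of the product is a power. *)
Fixpoint majorant k (y : X) : R :=
  if k is k'.+1 then
    majorant k' y * (c * opnorm (cocycle A q (iter (k' * q) f y)) `^ (2 * s))
  else 1.

Let majorant_ge0 k y : 0 <= majorant k y.
Proof.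
by elim: k => [//|k ih] /=; rewrite !mulr_ge0// powR_ge0.
Qed.

Let opnorm_powR_le (M : 'M[R]_2) (b : R) : opnorm M <= b ->
  opnorm M `^ (2 * s) <= b `^ (2 * s).
Proof.
move=> h; rewrite ge0_ler_powR ?nnegrE ?opnorm_ge0//.
by rewrite (le_trans _ h)// opnorm_ge0.
Qed.

Let majorantP k y : opnorm (cocycle B (k * q) y) `^ (2 * s) <= majorant k y.
Proof.
elim: k => [|k ih] /=.
  by rewrite (le_trans (opnorm_powR_le (opnorm1_le R)))// powR1.
rewrite mulSnr cocycleD.
have h : opnorm (cocycle B q (iter (k * q) f y) *m cocycle B (k * q) y) <=
    (1 + K q * e) * opnorm (cocycle A q (iter (k * q) f y)) * opnorm (cocycle B (k * q) y).
  by rewrite (le_trans (opnormM _ _))// ler_wpM2r ?opnorm_ge0.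
have k0 : 0 <= 1 + K q * e by rewrite addr_ge0// mulr_ge0.
rewrite (le_trans (opnorm_powR_le h))// !powRM ?mulr_ge0 ?opnorm_ge0//.
by rewrite [leRHS]mulrC ler_wpM2l// mulr_ge0 ?powR_ge0.
Qed.

Let majorant_local k a x y : (forall j : int, a%:Z <= j < (a + k * q)%:Z -> x j = y j) ->
  majorant k (iter a f x) = majorant k (iter a f y).
Proof.
elim: k => [//|k ih] h /=; rewrite ih; last first.
  by move=> j hj; apply: h; clear -hj; lia.
rewrite -!iterD (@cocycle_off _ _ A0 q (k * q + a) x y)// => j hj.
by apply: h; clear -hj; lia.
Qed.

Let kappa := c * kappa0.

Let avg_majorant N k a x : (a + k * q <= N)%N ->
  avgn p 0 N (fun y => majorant k (iter a f y)) x = kappa ^+ k.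
Proof.
elim: k => [|k ih] h; first by rewrite avgn_cst// expr0.
have h' : ((a + k * q) + q <= N)%N by rewrite -addnA -mulSnr.
rewrite -(avgn_avgn hp _ h') exprS -(ih (leq_trans (leq_addr _ _) h')).
rewrite -avgnZ; congr (avgn _ _ _ _ x); apply/funext => z /=.
pose Phi y M := majorant k (iter a f y) * (c * opnorm M `^ (2 * s)).
rewrite (@eq_avgn _ _ p _ _ _ (fun y => Phi y (cocycle A q (iter (a + k * q) f y)))); last first.
  move=> y; have -> : iter (a + k * q) f y = iter (k * q) f (iter a f y) by rewrite addnC iterD.
  exact: erefl.
rewrite (@avgn_word_dep _ _ p A0 (a + k * q) q Phi z).
  rewrite /Phi (_ : (fun M => _) = fun M => (majorant k (iter a f z) * c) * opnorm M `^ (2 * s)).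
    by rewrite markovnZ /kappa -/kappa0; ring.
  by apply/funext => M; rewrite mulrA.
move=> y hy; apply/funext => M; rewrite /Phi (@majorant_local k a y z)// => j hj.
by apply: hy; clear -hj; lia.
Qed.

(** Pays for the remainder of a word after division into blocks of length [q]. *)
Let Cq := (D ^+ q) `^ (2 * s).

Let avg_opnorm N a t x : (a + t <= N)%N ->
  avgn p 0 N (fun y => opnorm (cocycle B t (iter a f y)) `^ (2 * s)) x <=
  Cq * kappa ^+ (t %/ q).
Proof.
move=> h; have h' : (a + t %/ q * q <= N)%N.
  by rewrite (leq_trans _ h)// leq_add2l leq_trunc_div.
rewrite -(avg_majorant x h') -avgnZ; apply: avgn_le => // y.
rewrite {1}(divn_eq t q) cocycleD; set z := iter a f y.
have h1 : opnorm (cocycle B (t %% q) (iter (t %/ q * q) f z) *m cocycle B (t %/ q * q) z)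
    <= D ^+ q * opnorm (cocycle B (t %/ q * q) z).
  rewrite (le_trans (opnormM _ _))// ler_wpM2r ?opnorm_ge0//.
  rewrite (le_trans (opnorm_cocycle _ _ D1 BD))// ler_weXn2l//.
  by rewrite ltnW// ltn_mod.
rewrite (le_trans (opnorm_powR_le h1))// powRM ?exprn_ge0 ?opnorm_ge0//.
by rewrite ler_wpM2l ?powR_ge0// majorantP.
Qed.

Definition past (J : nat) (y : X) : X := fun n => if n < J%:Z then y n else ord0.

Lemma past_off J n x y : off J n x y -> past J y = past J x.
Proof.
move=> h; apply/funext => k; rewrite /past; case: ifP => // hk; apply: h; clear -hk; lia.
Qed.

Lemma agree_past J i y : agree (iter i f y) (iter i f (past J y)) (J - i).
Proof.
by move=> n hn; rewrite !iter_shift /past ifT//; clear -hn; lia.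
Qed.

(** The sine created at time [i] by changing the letters from [J] on, as in [sdist_pert], then
    stretched up to time [J], as in [sdist_mul]. *)
Let term J i y := opnorm (cocycle B (J - i.+1) (iter i.+1 f y)) ^+ 2 * (D * e * r ^+ (J - i)).

(* Pass from the orbit of [y] to the orbit of [past J y] one factor at a time. *)
Let sdist_past J y v : v != 0 ->
  sdist (cocycle B J y *m v) (cocycle B J (past J y) *m v) <= \sum_(i <- iota 0 J) term J i y.
Proof.
move=> v0; pose y' := past J y.
(* [w i] uses the factors along [y'] for [i] steps and those along [y] afterwards; [w 0] and [w J]
   are the two vectors to be compared. *)
pose w i := cocycle B (J - i) (iter i f y) *m (cocycle B i y' *m v).
have w0 i : w i != 0 by rewrite !mulSL2_neq0.
have step i : (i < J)%N -> sdist (w i) (w i.+1) <= term J i y.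
  move=> iJ; rewrite /w.
  have -> : (J - i = 1 + (J - i.+1))%N by rewrite add1n subnSK.
  rewrite cocycleD cocycle1 -iterD add1n /= -!mulmxA.
  set M := cocycle B (J - i.+1) _; set u := cocycle B i y' *m v.
  have u0 : u != 0 by rewrite mulSL2_neq0.
  apply: (le_trans (sdist_mul (detB _ _) _ _)); rewrite ?mulSL2_neq0//.
  rewrite /term -/M ler_wpM2l ?sqr_ge0//.
  apply: (le_trans (sdist_pert (dB _) (dB _) u0)).
  rewrite mulrC -mulrA ler_pM ?opnorm_ge0//.
  by apply: Bagree; [rewrite subn_gt0|exact: agree_past].
have tel k : (k <= J)%N -> sdist (w 0%N) (w k) <= \sum_(i <- iota 0 k) term J i y.
  elim: k => [|k ih] kJ; first by rewrite sdistxx big_nil.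
  rewrite (le_trans (sdist_tri (w0 0%N) (w0 k.+1) (w0 k)))//.
  rewrite -addn1 iotaD big_cat /= big_seq1 add0n lerD//; first by rewrite ih// ltnW.
  by rewrite addn1 step.
have := tel J (leqnn J); rewrite /w subn0 subnn !mul1mx.
by [].
Qed.

Let th := (r `^ s) ^+ q * kappa.
Hypothesis th1 : th < 1.

Let kappa_ge0 : 0 <= kappa.
Proof.
rewrite mulr_ge0 ?powR_ge0// -(markovn_cst A0 hp q 0 1%:M).
apply: (@markovn_le _ _ _ A0 hp (fun=> True)) => // M _; exact: powR_ge0.
Qed.

Let th_ge0 : 0 <= th. Proof. by rewrite mulr_ge0 ?exprn_ge0 ?powR_ge0. Qed.

Let delta := (D * e) `^ s * Cq * (q%:R / (1 - th)).

Let avg_sdist N J x v : v != 0 -> (J <= N)%N ->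
  avgn p 0 N (fun y => sdist (cocycle B J y *m v) (cocycle B J (past J y) *m v)) x <= delta.
Proof.
move=> v0 JN.
have rs0 : 0 <= r `^ s by exact: powR_ge0.
have rs1 : r `^ s <= 1.
  rewrite [leRHS](_ : 1 = 1 `^ s); last by rewrite powR1.
  by rewrite ge0_ler_powR ?nnegrE ?(ltW s0)// ltW.
have De0 : 0 <= D * e by rewrite mulr_ge0.
have t0 i y : 0 <= term J i y.
  by rewrite mulr_ge0 ?sqr_ge0// mulr_ge0// exprn_ge0// ltW.
pose w t := (D * e) `^ s * (r `^ s) ^+ t.+1.
have termE i y : (i < J)%N -> term J i y `^ s =
    w (J - i.+1)%N * opnorm (cocycle B (J - i.+1) (iter i.+1 f y)) `^ (2 * s).
  move=> iJ; rewrite /term powRM ?sqr_ge0 ?mulr_ge0 ?exprn_ge0 ?(ltW r0)//.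
  rewrite powRM ?exprn_ge0 ?(ltW r0)// mulrC /w; congr (_ * _ * _).
    rewrite powR_exprC ?(ltW r0)//; by rewrite subnSK.
  by rewrite -powR_mulrn ?opnorm_ge0// -powRrM.
apply: (@le_trans _ _ (avgn p 0 N (fun y => \sum_(i <- iota 0 J) term J i y `^ s) x)).
  apply: avgn_le => // y; apply: le_sum_powR => //.
    by apply: sdist_le1; rewrite mulSL2_neq0.
  exact: sdist_past.
rewrite avgn_sum//.
apply: (@le_trans _ _ (\sum_(i <- iota 0 J) w (J - i.+1)%N * (Cq * kappa ^+ ((J - i.+1) %/ q)))).
  rewrite big_seq [leRHS]big_seq; apply: ler_sum => i; rewrite mem_iota add0n => /andP[_ iJ].
  rewrite (_ : (fun y => _) = fun y => w (J - i.+1)%N *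
      opnorm (cocycle B (J - i.+1) (iter i.+1 f y)) `^ (2 * s)); last first.
    by apply/funext => y; rewrite termE.
  rewrite avgnZ ler_wpM2l ?mulr_ge0 ?powR_ge0 ?exprn_ge0//.
  apply: avg_opnorm; rewrite addnC subnK//.
have -> : \sum_(i <- iota 0 J) w (J - i.+1)%N * (Cq * kappa ^+ ((J - i.+1) %/ q)) =
    \sum_(t <- iota 0 J) w t * (Cq * kappa ^+ (t %/ q)).
  by have := big_nat_rev _ _ 0 J xpredT (fun t => w t * (Cq * kappa ^+ (t %/ q)));
    rewrite /index_iota subn0 add0n => ->.
have W0 : 0 <= (D * e) `^ s * Cq by rewrite mulr_ge0 ?powR_ge0.
apply: (@le_trans _ _ (\sum_(t <- iota 0 J) (D * e) `^ s * Cq * th ^+ (t %/ q))).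
  apply: ler_sum => t _; rewrite /w.
  have -> : (D * e) `^ s * (r `^ s) ^+ t.+1 * (Cq * kappa ^+ (t %/ q)) =
      (D * e) `^ s * Cq * ((r `^ s) ^+ t.+1 * kappa ^+ (t %/ q)) by ring.
  (* The exponent t + 1 of r^s is lowered to a multiple of [q], so that it pairs with the power of
     [kappa]. *)
  have -> : th ^+ (t %/ q) = (r `^ s) ^+ (q * (t %/ q)) * kappa ^+ (t %/ q).
    by rewrite exprM -exprMn.
  rewrite ler_wpM2l// ler_wpM2r ?exprn_ge0//.
  by rewrite ler_wiXn2l// mulnC (leq_trans (leq_trunc_div _ _)).
rewrite -mulr_sumr /delta ler_wpM2l//.
exact: sum_geometric_blocks.
Qed.

Variables (n : nat) (L : R).
Hypothesis hgrow : forall v, v != 0 -> n%:R * L <= mean_log p A0 n v - ln (enorm v).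

(** First the price of replacing [B] by [A] on the block, then that of replacing the actual vector
    by the one that ignores the block. *)
Let loss := K n * e * D ^+ n + (D ^+ n) ^+ 2 * delta.

Let grow_step k y v : v != 0 ->
  lgrow (cocycle A n (iter (k * n) f y)) (cocycle B (k * n) (past (k * n) y) *m v)
  - (K n * e * D ^+ n + (D ^+ n) ^+ 2 *
      sdist (cocycle B (k * n) y *m v) (cocycle B (k * n) (past (k * n) y) *m v)) <=
  ln (enorm (cocycle B (k.+1 * n) y *m v)) - ln (enorm (cocycle B (k * n) y *m v)).
Proof.
move=> v0; rewrite mulSnr cocycleD -mulmxA.
set M := cocycle B n _; set N := cocycle A n _; set u := cocycle B _ y *m v.
set w := cocycle B _ (past _ _) *m v.
have u0 : u != 0 by rewrite mulSL2_neq0.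
have w0 : w != 0 by rewrite mulSL2_neq0.
have h1 : lgrow N u - lgrow M u <= K n * e * D ^+ n.
  rewrite (le_trans (lgrow_pert _ _ u0)) ?detA ?detB// ler_pM ?opnorm_ge0//.
    by rewrite opnorm_distC block_close.
  by rewrite opnorm_cocycle.
have h2 : lgrow N w - lgrow N u <= (D ^+ n) ^+ 2 * sdist u w.
  rewrite (le_trans (lgrow_lip _ w0 u0)) ?detA// sdistC ler_wpM2r ?sdist_ge0//.
  by rewrite ler_pXn2r ?nnegrE ?opnorm_ge0 ?exprn_ge0// opnorm_cocycle.
have e2 : lgrow M u = ln (enorm (M *m u)) - ln (enorm u) by [].
lra.
Qed.

Let avg_grow N k x v : v != 0 -> (k * n <= N)%N ->
  k%:R * (n%:R * L - loss) <=
  avgn p 0 N (fun y => ln (enorm (cocycle B (k * n) y *m v)) - ln (enorm v)) x.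
Proof.
move=> v0; elim: k => [|k ih] kN.
  rewrite mul0r (_ : (fun y => _) = fun=> 0) ?avgn_cst//.
  by apply/funext => y; rewrite mul0n mul1mx subrr.
have kN' : (k * n + n <= N)%N by rewrite -mulSnr.
have {}ih := ih (leq_trans (leq_addr _ _) kN').
pose G y := lgrow (cocycle A n (iter (k * n) f y)) (cocycle B (k * n) (past (k * n) y) *m v).
pose S y := sdist (cocycle B (k * n) y *m v) (cocycle B (k * n) (past (k * n) y) *m v).
have hstep y : G y - (K n * e * D ^+ n + (D ^+ n) ^+ 2 * S y) <=
    ln (enorm (cocycle B (k.+1 * n) y *m v)) - ln (enorm (cocycle B (k * n) y *m v)).
  exact: grow_step.
have hS : avgn p 0 N S x <= delta by apply: avg_sdist => //; rewrite (leq_trans (leq_addr _ _) kN').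
(* The vector along [past] does not see the letters of the block, so averaging these letters alone
   yields the mean growth under [A]. *)
have hG : n%:R * L <= avgn p 0 N G x.
  rewrite -(avgn_avgn hp _ kN') -(avgn_cst hp 0 N (n%:R * L) x).
  apply: avgn_le => // z.
  pose Phi y M := lgrow M (cocycle B (k * n) (past (k * n) y) *m v).
  rewrite (@avgn_word_dep _ _ p A0 (k * n) n Phi z).
    have w0 : cocycle B (k * n) (past (k * n) z) *m v != 0 by rewrite mulSL2_neq0.
    rewrite (le_trans (hgrow w0))// /Phi /lgrow markovnDf (markovn_cst A0 hp n (- _)).
    exact: lexx.
  by move=> y hy; rewrite /Phi (past_off hy).
clearbody G S; apply: (@le_trans _ _ (avgn p 0 N (fun y => (ln (enorm (cocycle B (k * n) y *m v)) - ln (enorm v))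
    + (G y + (- (K n * e * D ^+ n) + - (D ^+ n) ^+ 2 * S y))) x)); last first.
  by apply: avgn_le => // y; have := hstep y; lra.
rewrite avgnD -natr1 mulrDl mul1r lerD//.
rewrite avgnD avgnD (avgn_cst hp 0 N (- (K n * e * D ^+ n)) x) avgnZ.
have : (D ^+ n) ^+ 2 * avgn p 0 N S x <= (D ^+ n) ^+ 2 * delta.
  by rewrite ler_wpM2l// exprn_ge0// exprn_ge0.
rewrite /loss mulNr; lra.
Qed.

Lemma perturbation_growth k x :
  k%:R * (n%:R * L - loss) <= avgn p 0 (k * n) (lognorm B (k * n)) x.
Proof.
rewrite (le_trans (@avg_grow (k * n) k x _ (e1_neq0 R) (leqnn _)))//; apply: avgn_le => // y.
exact: (lgrow_le (detB _ _) (e1_neq0 R)).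
Qed.

End perturbation.

(** * Continuity of the exponent *)

Section small.
Variable R : realType.

Definition small (P : R -> Prop) := exists2 e0, 0 < e0 & forall e, 0 <= e -> e <= e0 -> P e.

Lemma smallI (P Q : R -> Prop) : small P -> small Q -> small (fun e => P e /\ Q e).
Proof.
move=> [a a0 hP] [b b0 hQ]; exists (Num.min a b); first by rewrite lt_min a0.
by move=> e e0; rewrite le_min => /andP[ea eb]; split; [exact: hP|exact: hQ].
Qed.

Lemma smallW (P Q : R -> Prop) : (forall e, 0 <= e -> P e -> Q e) -> small P -> small Q.
Proof. by move=> PQ [a a0 hP]; exists a => // e e0 ea; apply: PQ => //; exact: hP. Qed.

Lemma small_linear (K b : R) : 0 <= K -> 0 < b -> small (fun e => K * e <= b).
Proof.
move=> K0 b0; have K1 : 0 < K + 1 by lra.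
exists (b / (K + 1)); first by rewrite divr_gt0.
move=> e e0; rewrite ler_pdivlMr//; nra.
Qed.

Lemma small_powR (K b s : R) : 0 <= K -> 0 < b -> 0 < s -> small (fun e => (K * e) `^ s <= b).
Proof.
move=> K0 b0 s0; have h : 0 < b `^ s^-1 by rewrite powR_gt0.
apply: smallW (small_linear K0 h) => e e0 he.
have -> : b = (b `^ s^-1) `^ s by rewrite -powRrM mulVf ?gt_eqF// powRr1// ltW.
by rewrite ge0_ler_powR ?nnegrE ?(ltW s0)// ?mulr_ge0// ltW.
Qed.

End small.

Section holder.
Variables (R : realType) (m : nat) (rho alpha : R).
Hypotheses (hrho : 0 < rho < 1) (halpha : 0 < alpha).
Local Notation X := (shift_space m).
Local Notation r := (rho `^ alpha).
Implicit Types F G : X -> 'M[R]_2.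

Let x0 : X := fun=> ord0.

Lemma holder_opnorm_bound F C x : holder_bound rho alpha F C ->
  opnorm (F x) <= opnorm (F x0) + C.
Proof.
move=> h; rewrite (le_trans (opnorm_sub_le (F x) (F x0)))// lerD2l.
have := @holder_bound_agree R m rho alpha hrho halpha F C x x0 0%N h.
by rewrite expr0 mulr1; apply => n.
Qed.

Lemma exists_expr_le (C e : R) : 0 <= C -> 0 < e -> exists M, C * r ^+ M <= e.
Proof.
move=> C0 e0; have [r0 r1] := (ratio_gt0 alpha hrho, ratio_lt1 hrho halpha).
have h : (fun n => r ^+ n) @ \oo --> (0 : R).
  by apply: cvg_expr; rewrite ger0_norm// ltW.
have C1 : 0 < C + 1 by lra.
have /cvgrPdist_lt /(_ (e / (C + 1)) (divr_gt0 e0 C1)) [M _ /(_ M (leqnn M)) /=] := h.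
rewrite sub0r normrN ger0_norm ?exprn_ge0 ?(ltW r0)// ltr_pdivlMr// => hM.
by exists M; have : 0 <= r ^+ M; [rewrite exprn_ge0// ltW|nra].
Qed.

Lemma holder_lambda_plus (p : 'I_m.+1 -> R) (mu : probability X R) F :
  positive_probability_vector p -> is_bernoulli p mu -> holder_SL2 rho alpha F ->
  [/\ forall n, bm (lognorm F n),
      forall n, lambda_plus mu F * n%:R <= Ex mu (lognorm F n) &
      forall e, 0 < e -> exists2 n, (0 < n)%N &
        Ex mu (lognorm F n) <= (lambda_plus mu F + e) * n%:R].
Proof.
move=> hp hmu [dF [C hC]]; have C0 : 0 <= C by case: hC.
pose D := opnorm (F x0) + C.
have D1 : 1 <= D by rewrite (le_trans (opnorm_ge1 (dF x0)))// lerDl.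
have FD x : opnorm (F x) <= D by exact: holder_opnorm_bound.
have uF e : 0 < e -> exists M, forall x y, agree x y M -> opnorm (F x - F y) <= e.
  move=> e0; have [M hM] := exists_expr_le C0 e0; exists M => x y xy.
  exact: le_trans (holder_bound_agree hrho halpha hC xy) hM.
have [h1 h2] := lambda_plusP hp hmu dF D1 FD uF.
by split=> // n; exact: (lognorm_bm dF D1 FD uF).
Qed.

Lemma holder_boundB F G C C' : holder_bound rho alpha F C -> holder_bound rho alpha G C' ->
  holder_bound rho alpha (fun x => F x - G x) (C + C').
Proof.
move=> [C0 h] [C0' h']; split; first exact: addr_ge0.
move=> x y; rewrite mulrDl.
have -> : F x - G x - (F y - G y) = (F x - F y) + - (G x - G y).
  by apply/matrixP => i j; rewrite !mxE; ring.
by rewrite (le_trans (opnormD _ _))// opnormN lerD.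
Qed.

(** The supremum is over a bounded set and the infimum over a nonempty one, because [F - G] is
    Hölder; both are nonnegative, hence each is below [e]. Strictness provides an actual Hölder
    bound. *)
Lemma holder_dist_close F G e : holder_SL2 rho alpha F -> holder_SL2 rho alpha G ->
  holder_dist rho alpha F G < e ->
  (forall x, opnorm (F x - G x) <= e) /\ holder_bound rho alpha (fun x => F x - G x) e.
Proof.
move=> [_ [C hC]] [_ [C' hC']]; rewrite /holder_dist => he.
have hB := holder_boundB hC hC'.
pose H := fun x => F x - G x.
have ubS x : opnorm (H x) <= sup (range (fun x => opnorm (H x))).
  apply: sup_upper_bound; last by exists x.
  split; first by exists (opnorm (H x)), x.
  by exists (opnorm (H x0) + (C + C')) => _ [y _ <-]; exact: holder_opnorm_bound.
have S0 : 0 <= sup (range (fun x => opnorm (H x))).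
  exact: le_trans (opnorm_ge0 _) (ubS x0).
have hinf : has_inf [set K | holder_bound rho alpha H K].
  by split; [exists (C + C')|exists 0 => K []].
have H0 : 0 <= holder_const rho alpha H.
  by apply: lb_le_inf; [case: hinf|move=> K []].
split=> [x|].
  rewrite (le_trans (ubS x))// ltW// (le_lt_trans _ he)// lerDl.
  exact: H0.
have e1 : 0 < e - holder_const rho alpha H.
  by rewrite subr_gt0 (le_lt_trans _ he)// lerDr.
have [K [K0 hK] Ke] := inf_adherent e1 hinf.
have Ke' : K <= e.
  by move: Ke; rewrite addrC subrK => /ltW.
split; first exact: le_trans Ke'.
move=> x y; rewrite (le_trans (hK x y))// ler_wpM2r// powR_ge0//.
Qed.

End holder.

Section lower_bound.
Variables (R : realType) (m : nat) (p : 'I_m.+1 -> R) (A0 : 'I_m.+1 -> 'M[R]_2).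
Hypothesis hp : positive_probability_vector p.
Hypothesis dA : forall i, \det (A0 i) = 1.
Variable C0 : R.
Hypotheses (C1 : 1 <= C0) (AC : forall i, opnorm (A0 i) <= C0).
Local Notation X := (shift_space m).
Variables (r lam : R).
Hypotheses (r0 : 0 < r) (r1 : r < 1).

Definition close_cocycle (e : R) (B : X -> 'M[R]_2) :=
  [/\ forall x, \det (B x) = 1,
      forall x, opnorm (B x - locally_constant A0 x) <= e &
      forall x y M, (0 < M)%N -> agree x y M -> opnorm (B x - B y) <= e * r ^+ M].

Lemma close_cocycle_growth eta :
  0 < lam -> (forall n, lam * n%:R <= mean_lognorm p A0 n) ->
  (exists2 q, (0 < q)%N & 2 * mean_lognorm p A0 q + q%:R * ln r < 0) ->
  irreducible_family A0 -> 0 < eta ->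
  exists2 n, (0 < n)%N & small (fun e => forall B, close_cocycle e B ->
    forall k x, k%:R * (n%:R * (lam - eta)) <= avgn p 0 (k * n) (lognorm B (k * n)) x).
Proof.
move=> lam0 hlam [q q0 hq] irr eta0.
have [s [s0 s1 hs]] := small_exponent hp dA C1 AC r0 hq.
have eta2 : 0 < eta / 2 by rewrite divr_gt0.
have [n n0 hn] := uniform_growth hp dA C1 AC lam0 hlam irr eta2.
exists n => //.
set th0 := _ * _ in hs.
pose D := C0 + 1; pose K k : R := k%:R * D ^+ k.
have D0 : 0 <= D by rewrite addr_ge0// (le_trans ler01).
have K0 k : 0 <= K k by rewrite mulr_ge0// exprn_ge0.
have kap0 : 0 <= markovn p A0 q (fun M => opnorm M `^ (2 * s)) 1%:M.
  rewrite -(markovn_cst A0 hp q 0 1%:M).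
  by apply: (@markovn_le _ _ _ A0 hp (fun=> True)) => // M _; exact: powR_ge0.
have th00 : 0 <= th0 by rewrite mulr_ge0 ?exprn_ge0 ?powR_ge0.
(* With g this gap, K q e <= g gives th <= (1 + 3 g) th0 <= 1 - g, so the geometric series stays
   bounded uniformly in [e]. *)
have g0 : 0 < (1 - th0) / 4 by rewrite divr_gt0// subr_gt0.
have nR : 0 < n%:R :> R by rewrite ltr0n.
(* Coefficient of (D e)^s in the loss once [th] is replaced by its uniform bound. Half of [eta] goes
   to [uniform_growth], a quarter to each summand of the loss. *)
pose Q := (D ^+ n) ^+ 2 * ((D ^+ q) `^ (2 * s) * (q%:R / ((1 - th0) / 4))).
have Q0 : 0 <= Q by rewrite !mulr_ge0 ?exprn_ge0 ?powR_ge0 ?invr_ge0 ?(ltW g0).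
have b0 : 0 < n%:R * eta / (4 * (Q + 1)) by rewrite divr_gt0 ?mulr_gt0//; lra.
have KD : 0 <= K n * D ^+ n by rewrite mulr_ge0 ?exprn_ge0.
have c0 : 0 < n%:R * eta / 4 by rewrite divr_gt0 ?mulr_gt0.
have := smallI (small_linear ler01 ltr01) (smallI (small_linear (K0 q) g0)
  (smallI (small_powR D0 b0 s0) (small_linear KD c0))).
apply: smallW => e e0 [e1 [hK [hpow hlin]]] B [dB BA Bagree] k x.
rewrite mul1r in e1.
pose th := (r `^ s) ^+ q * ((1 + K q * e) `^ (2 * s) *
   markovn p A0 q (fun M => opnorm M `^ (2 * s)) 1%:M).
have thle : th <= 1 - (1 - th0) / 4.
  have k1 : 1 <= 1 + K q * e by rewrite lerDl mulr_ge0.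
  have h1 : (1 + K q * e) `^ (2 * s) <= 1 + 3 * (K q * e).
    apply: (@le_trans _ _ ((1 + K q * e) `^ 2%:R)).
      by rewrite ler_powR//; move: s1; lra.
    rewrite powR_mulrn ?(le_trans ler01)//.
    have : 0 <= K q * e by rewrite mulr_ge0.
    have : K q * e <= 1 by move: hK th00; lra.
    nra.
  have -> : th = (1 + K q * e) `^ (2 * s) * th0 by rewrite /th /th0; ring.
  apply: (@le_trans _ _ ((1 + 3 * (K q * e)) * th0)); first by rewrite ler_wpM2r.
  have : 0 <= K q * e by rewrite mulr_ge0.
  move: hK th00 hs; nra.
have th1 : th < 1 by rewrite (le_lt_trans thle)// ltrBlDr ltrDl.
have := perturbation_growth hp dA C1 AC e0 e1 r0 (ltW r1) dB BA Bagree s0 s1 q0 th1 hn k x.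
apply: le_trans; rewrite ler_wpM2l//.
rewrite -/D -/(K n) -/th.
have h1 : (D * e) `^ s * (D ^+ q) `^ (2 * s) * (q%:R / (1 - th)) <=
    (D * e) `^ s * (D ^+ q) `^ (2 * s) * (q%:R / ((1 - th0) / 4)).
  rewrite ler_wpM2l ?mulr_ge0 ?powR_ge0// ler_wpM2l// lef_pV2 ?posrE ?subr_gt0//.
  by move: thle; lra.
have h2 : (D ^+ n) ^+ 2 * ((D * e) `^ s * (D ^+ q) `^ (2 * s) * (q%:R / (1 - th))) <=
    n%:R * eta / 4.
  apply: (@le_trans _ _ ((D * e) `^ s * Q)).
    rewrite /Q; apply: (le_trans (ler_wpM2l _ h1)); first by rewrite exprn_ge0// exprn_ge0.
    by rewrite le_eqVlt; apply/orP; left; apply/eqP; ring.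
  apply: (@le_trans _ _ (n%:R * eta / (4 * (Q + 1)) * Q)); first by rewrite ler_wpM2r.
  have Q1 : 0 < Q + 1 by lra.
  have -> : n%:R * eta / (4 * (Q + 1)) * Q = n%:R * eta / 4 * (Q / (Q + 1)).
    by field; rewrite gt_eqF.
  rewrite -[leRHS]mulr1 ler_pM2l// ler_pdivrMr// mul1r; lra.
have h3 : K n * e * D ^+ n <= n%:R * eta / 4 by rewrite mulrAC.
have : 0 < n%:R * eta by rewrite mulr_gt0.
move: h2 h3; lra.
Qed.

End lower_bound.

Section continuity.
Variables (R : realType) (m : nat) (p : 'I_m.+1 -> R) (mu : probability (shift_space m) R).
Hypotheses (hp : positive_probability_vector p) (hmu : is_bernoulli p mu).

Lemma Ex_lognorm_locally_constant (A0 : 'I_m.+1 -> 'M[R]_2) n :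
  bm (lognorm (locally_constant A0) n) ->
  Ex mu (lognorm (locally_constant A0) n) = mean_lognorm p A0 n.
Proof.
move=> b; have [_ <-] := Ex_avgn hp 0 n hmu b.
rewrite -[RHS](Ex_cst mu); congr (Ex mu); apply/funext => x.
exact: (avgn_word p A0 0 n (fun M => ln (opnorm M)) x).
Qed.

Lemma Ex_lognormM (B : shift_space m -> 'M[R]_2) a k : (forall x, \det (B x) = 1) ->
  (forall n, bm (lognorm B n)) ->
  Ex mu (lognorm B (a * k)) <= k%:R * Ex mu (lognorm B a).
Proof.
move=> dB b; elim: k => [|k ih].
  rewrite muln0 mul0r -(Ex_cst mu 0); apply: Ex_le => //; first exact: bm_cst.
  by move=> x; rewrite /lognorm /= ln_le0// opnorm1_le.
rewrite mulnS addnC -natr1 mulrDl mul1r.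
have bi : bm (lognorm B a \o iter (a * k) (@shift m)).
  by apply: bm_comp => //; exact: measurable_iter (@measurable_shift m) _.
apply: (@le_trans _ _ (Ex mu (fun x => lognorm B (a * k) x +
    (lognorm B a \o iter (a * k) (@shift m)) x))).
  by apply: Ex_le => //; [exact: bmD|move=> x; exact: lognormD].
rewrite (ExD mu (b (a * k)%N) bi); apply: lerD; first exact: ih.
by rewrite le_eqVlt; apply/orP; left; apply/eqP;
  exact: (Ex_iter (@measurable_shift m) (bernoulli_shift hmu) (a * k) (b a)).
Qed.

End continuity.

Theorem theoremB (R : realType) (m : nat) (rho alpha : R)
  (p : 'I_m.+1 -> R) (mu : probability (shift_space m) R)
  (A : shift_space m -> 'M[R]_2) (A0 : 'I_m.+1 -> 'M[R]_2)
  (Ak : nat -> shift_space m -> 'M[R]_2)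
  (hrho : 0 < rho < 1) (halpha : 0 < alpha)
  (hp : positive_probability_vector p) (hmu : is_bernoulli p mu)
  (hA : holder_SL2 rho alpha A)
  (hbunched : nonunif_fiber_bunched rho alpha mu A)
  (hconst : locally_constant_by A A0) (hirr : irreducible_family A0)
  (hAk : forall k, holder_SL2 rho alpha (Ak k))
  (hcvg : (fun k => holder_dist rho alpha (Ak k) A) @ \oo --> (0 : R)) :
  (fun k => lambda_plus mu (Ak k)) @ \oo --> lambda_plus mu A.
Proof.
have AE : A = locally_constant A0 by apply/funext.
have [bA hl1 hl2] := holder_lambda_plus hrho halpha hp hmu hA.
pose C0 := 1 + \sum_i opnorm (A0 i).
have C1 : 1 <= C0 by rewrite lerDl sumr_ge0// => i _; exact: opnorm_ge0.
have AC i : opnorm (A0 i) <= C0.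
  rewrite /C0 (bigD1 i)//= addrCA lerDl addr_ge0// sumr_ge0// => j _.
  exact: opnorm_ge0.
have dA i : \det (A0 i) = 1.
  by case: hA => /(_ ((fun=> i) : shift_space m)); rewrite hconst.
have EA n : Ex mu (lognorm A n) = mean_lognorm p A0 n.
  by rewrite AE (Ex_lognorm_locally_constant hp hmu)// -AE.
have dAx x : \det (A x) = 1 by case: hA.
set lam := lambda_plus mu A in hl1 hl2 hbunched *.
pose r := rho `^ alpha.
have [r0 r1] : 0 < r /\ r < 1 := conj (ratio_gt0 alpha hrho) (ratio_lt1 hrho halpha).
have close k e : holder_dist rho alpha (Ak k) A < e -> close_cocycle A0 r e (Ak k).
  move=> /(holder_dist_close hrho halpha (hAk k) hA)[h1 h2]; split.
  - by case: (hAk k).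
  - by rewrite -AE.
  - move=> x y M M0 xy; have := holder_bound_agree hrho halpha h2 xy.
    have -> : A x = A y by rewrite AE /locally_constant xy.
    by rewrite opprB addrA subrK.
have hk1 k n : lambda_plus mu (Ak k) * n%:R <= Ex mu (lognorm (Ak k) n).
  by have [] := holder_lambda_plus hrho halpha hp hmu (hAk k).
have hk2 k e : 0 < e -> exists2 n, (0 < n)%N &
    Ex mu (lognorm (Ak k) n) <= (lambda_plus mu (Ak k) + e) * n%:R.
  by have [_ _] := holder_lambda_plus hrho halpha hp hmu (hAk k); apply.
have bk k n : bm (lognorm (Ak k) n).
  by have [] := holder_lambda_plus hrho halpha hp hmu (hAk k).
have dk k x : \det (Ak k x) = 1 by case: (hAk k).
have lamk_ge0 k : 0 <= lambda_plus mu (Ak k).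
  apply/ler_addgt0Pr => e e0; have [n n0 hn] := hk2 k e e0.
  have : 0 <= (lambda_plus mu (Ak k) + e) * n%:R.
    by rewrite (le_trans _ hn)//; apply: Rintegral_ge0 => x _; exact: lognorm_ge0.
  by rewrite pmulr_lge0 ?ltr0n.
have upper eta : 0 < eta -> small (fun e => forall k, close_cocycle A0 r e (Ak k) ->
    lambda_plus mu (Ak k) <= lam + eta).
  move=> eta0; have eta2 : 0 < eta / 2 by rewrite divr_gt0.
  have [n n0 hn] := hl2 _ eta2; have nR : 0 < n%:R :> R by rewrite ltr0n.
  have K0 : 0 <= n%:R * (C0 + 1) ^+ n by rewrite mulr_ge0// exprn_ge0// addr_ge0// (le_trans ler01).
  have b0 : 0 < eta / 2 * n%:R by rewrite mulr_gt0.
  apply: smallW (smallI (small_linear ler01 ltr01) (small_linear K0 b0)).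
  move=> e e0 [e1 he] k [dB BA _]; rewrite mul1r in e1.
  have D1 : 1 <= C0 + 1 by rewrite (le_trans C1)// lerDl.
  have hx x : lognorm (Ak k) n x <= lognorm A n x + eta / 2 * n%:R.
    rewrite -lerBlDl; apply: (le_trans (ln_opnorm_lip (det_cocycle _ _ (dk k)) (det_cocycle _ _ dAx))).
    apply: le_trans he; apply: cocycle_close => //.
    + exact: (perturbation_opnorm AC e1 BA).
    + by move=> z; rewrite AE (le_trans (AC _))// lerDl.
    + by move=> i _; rewrite AE; exact: BA.
  have : Ex mu (lognorm (Ak k) n) <= Ex mu (lognorm A n) + eta / 2 * n%:R.
    rewrite -[eta / 2 * n%:R](Ex_cst mu) -ExD//; last exact: bm_cst.
    by apply: Ex_le => //; apply: bmD => //; exact: bm_cst.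
  move=> h; rewrite -(ler_pM2r nR) (le_trans (hk1 k n))// (le_trans h)//.
  by rewrite [in leRHS](splitr eta) addrA [leRHS]mulrDl lerD2r.
have lower eta : 0 < eta -> small (fun e => forall k, close_cocycle A0 r e (Ak k) ->
    lam - eta <= lambda_plus mu (Ak k)).
  move=> eta0; have [lam0|lam0] := leP lam 0.
    exists 1 => // e _ _ k _; rewrite (le_trans _ (lamk_ge0 k))//; lra.
  have hq : exists2 q, (0 < q)%N & 2 * mean_lognorm p A0 q + q%:R * ln r < 0.
    have lnr : ln r = - (alpha * ln rho^-1).
      by rewrite /r ln_powR lnV ?posrE ?mulrN ?opprK//; case/andP: hrho.
    (* This is the fiber bunching gap. Allowing a quarter of it as error in the mean of ln |A^q|
       leaves half of the gap. *)
    have g0 : 0 < (- ln r - 2 * lam) / 4.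
      by rewrite divr_gt0// subr_gt0 lnr opprK.
    have [q q0 hq] := hl2 _ g0; exists q => //.
    have qR : 0 < q%:R :> R by rewrite ltr0n.
    rewrite EA in hq.
    have h1 : 2 * mean_lognorm p A0 q + q%:R * ln r <=
        - 2 * ((- ln r - 2 * lam) / 4) * q%:R by lra.
    rewrite (le_lt_trans h1)// pmulr_llt0// mulNr oppr_lt0 mulr_gt0//.
  have hlam n : lam * n%:R <= mean_lognorm p A0 n by rewrite -EA.
  have [n n0] := close_cocycle_growth hp dA C1 AC r0 r1 lam0 hlam hq hirr eta0.
  apply: smallW => e e0 he k hB; have {}he := he _ hB.
  have nR : 0 < n%:R :> R by rewrite ltr0n.
  (* The block length [n] is fixed before [k], while a length [a] at which the mean is close to the
     exponent depends on [k]; the two are compared at the common length [a * n]. *)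
  apply/ler_addgt0Pr => d d0; have [a a0 ha] := hk2 k d d0.
  have aR : 0 < a%:R :> R by rewrite ltr0n.
  have [bav Eav] := Ex_avgn hp 0 (a * n) hmu (bk k (a * n)%N).
  have h1 : a%:R * (n%:R * (lam - eta)) <= Ex mu (lognorm (Ak k) (a * n)).
    rewrite -Eav -[leLHS](Ex_cst mu); apply: Ex_le => //; exact: bm_cst.
  have h2 := le_trans h1 (Ex_lognormM hmu a n (dk k) (bk k)).
  have h3 : n%:R * Ex mu (lognorm (Ak k) a) <= n%:R * ((lambda_plus mu (Ak k) + d) * a%:R).
    by rewrite ler_pM2l.
  have := le_trans h2 h3; rewrite mulrCA ler_pM2l// mulrC ler_pM2r//.
apply/cvgrPdist_le => eta eta0.
have [e0 e00 he] := smallI (upper _ eta0) (lower _ eta0).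
have /cvgrPdist_lt /(_ _ e00) := hcvg; apply: filterS => k.
rewrite sub0r normrN => hk.
have hk' := close k e0 (le_lt_trans (ler_norm _) hk).
have [hu hl] := he e0 (ltW e00) (lexx _).
rewrite ler_distlC; apply/andP; split; first exact: hl.
exact: hu.
Qed.
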